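(* Let the coefficients $b,\sigma,f,g$ satisfy the regularity assumption (A) stated in the context, fix $y\in\mathbb R$, and let $u^*(\cdot,y)\in\mathcal A$ be given. Let $x^*(\cdot,y)$ be the solution of $$dx^*(t,y)=b(t,x^*(t,y),u^*(t,y),y)\,dt+\sigma(t,x^*(t,y),u^*(t,y),y)\,dB(t),\qquad x^*(0,y)=x_0,$$ and let $(p(\cdot,y),q(\cdot,y))$ be the adapted solution of the adjoint backward equation $$\begin{cases}-dp(t,y)=\big[b_x(t,x^*(t,y),u^*(t,y),y)\,p(t,y)+\sigma_x(t,x^*(t,y),u^*(t,y),y)\,q(t,y)\\ \qquad\qquad\quad+f_x(t,x^*(t,y),u^*(t,y),y)\,m_t(y)\big]dt-q(t,y)\,dB(t),\\ p(T,y)=g_x(x^*(T,y),y)\,m_T(y).\end{cases}$$ Suppose that $$H(t,x^*(t,y),u^*(t,y),p(t,y),q(t,y))=\max_{u\in U}H(t,x^*(t,y),u,p(t,y),q(t,y))$$ holds for all $t\in[0,T]$, that $$\widehat H(t,x):=\max_{u\in U}H(t,x,u,p(t,y),q(t,y))$$ exists and is concave in $x$, and that $g$ is concave in $x$. Then $u^*(\cdot,y)$ is optimal, i.e. $\widehat J(u^*(\cdot,y))=\sup_{u\in\mathcal A}\widehat J(u(\cdot,y))$.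
   Context: Setting. $0<T<T_0<\infty$; $B$ is a standard real Brownian motion on a complete probability space $(\Omega,\mathbb F,\mathbb P)$, and $\{\mathcal F_t\}$ is the filtration generated by $B$ augmented by all $\mathbb P$-null sets. $x_0\in\mathbb R$, and $U\subseteq\mathbb R$ is a nonempty convex set. Inside information. $\varphi\in L^2(0,T_0)$ is deterministic, $\|\varphi\|^2_{[t,T_0]}:=\int_t^{T_0}\varphi(s)^2\,ds>0$ for $t\in[0,T]$, $Y(t):=\int_0^t\varphi(s)\,dB(s)$, and $Y:=Y(T_0)$. $\delta_Y(y)$ denotes the Donsker delta function of $Y$, and $$m_t(y):=\mathbb E[\delta_Y(y)\mid\mathcal F_t]=\big(2\pi\|\varphi\|^2_{[t,T_0]}\big)^{-1/2}\exp\Big[-\frac{(Y(t)-y)^2}{2\|\varphi\|^2_{[t,T_0]}}\Big],\qquad t\in[0,T].$$ Coefficients. $b,\sigma,f:\Omega\times[0,T]\times\mathbb R\times U\times\mathbb R\to\mathbb R$, written $b(t,x,u,y)$ etc., are $\mathcal F_t$-adapted for each $(x,u,y)$; $g:\Omega\times\mathbb R\times\mathbb R\to\mathbb R$, written $g(x,y)$, is $\mathcal F_T$-measurable for each $(x,y)$. Assumption (A). $b,\sigma,f,g$ are twice continuously differentiable in $x$; they and $b_x,b_{xx},\sigma_x,\sigma_{xx},f_x,f_{xx},g_x,g_{xx}$ are continuous in $(t,x,u)$; $b_x,b_{xx},\sigma_x,\sigma_{xx},f_{xx},g_{xx}$ are bounded by a constant $L>0$; and $b,\sigma,f_x,g_x$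 are bounded in absolute value by $L(1+|x|+|u|)$. Controls and performance. For fixed $y$, $\mathcal A$ is the set of $U$-valued $\mathcal F_t$-progressively measurable processes $u(\cdot,y)$ on $[0,T]$ with $\sup_{0\le t\le T}\mathbb E|u(t,y)|^i<\infty$ for $i=1,2,\dots$. For $u\in\mathcal A$ let $x(\cdot,y)$ solve $dx(t,y)=b(t,x(t,y),u(t,y),y)\,dt+\sigma(t,x(t,y),u(t,y),y)\,dB(t)$, $x(0,y)=x_0$, and set $$\widehat J(u(\cdot,y))=\mathbb E\Big[\int_0^T f(t,x(t,y),u(t,y),y)\,m_t(y)\,dt+g(x(T,y),y)\,m_T(y)\Big].$$ Hamiltonian (for the fixed $y$): $H(t,x,u,p,q)=f(t,x,u,y)\,m_t(y)+b(t,x,u,y)\,p+\sigma(t,x,u,y)\,q$. *)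

(* Defs.v *)
From HB Require Import structures.
From mathcomp Require Import all_boot all_order all_algebra.
From mathcomp Require Import all_classical all_reals all_analysis.
Set Implicit Arguments.
Unset Strict Implicit.
Unset Printing Implicit Defensive.
Import Order.TTheory GRing.Theory Num.Theory.
Import numFieldNormedType.Exports.
Local Open Scope classical_set_scope.
Local Open Scope ring_scope.

Definition concave_function (R : realType) (h : R -> R) : Prop :=
  convex_function ([set: R] : set (convex_lmodType R^o)) (fun x => - h x).

Definition is_maximum (R : realType) (A : set R) (a : R) : Prop :=
  A a /\ ubound A a.

Section stochastic_calculus.
Context {d : measure_display} {Omega : measurableType d} {R : realType}.
Variables (P : probability Omega R) (B : R -> Omega -> R).
Local Notation mu := (@lebesgue_measure R).

Definition past_events (t : R) : set (set Omega) :=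
  [set A | exists2 s, 0 <= s <= t &
             exists2 C : set R, measurable C & A = B s @^-1` C].

Record brownian_motion : Prop := BrownianMotion {
  bm_measurable : forall t, 0 <= t -> measurable_fun setT (B t) ;
  bm_start : {ae P, forall w, B 0 w = 0} ;
  bm_indep : forall s t, 0 <= s -> s < t ->
    forall (A : set Omega) (C : set R), <<s past_events s >> A -> measurable C ->
    P (A `&` (fun w => B t w - B s w)%R @^-1` C) =
    (P A * P ((fun w => B t w - B s w)%R @^-1` C))%E ;
  (* the second parameter of normal_prob is the standard deviation *)
  bm_gaussian : forall s t, 0 <= s -> s < t ->
    forall C : set R, measurable C ->
    P ((fun w => B t w - B s w)%R @^-1` C) = normal_prob 0 (Num.sqrt (t - s)) C ;
  bm_continuous :
    {ae P, forall w, {within `[0, +oo[, continuous (fun t => B t w)}} }.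

(* generators of the augmented filtration F_t of B *)
Definition filtration_events (t : R) : set (set Omega) :=
  past_events t `|` P.-negligible.

Local Notation Filt t := (g_sigma_algebraType (filtration_events t)).

Definition progressive (S : R) (h : R -> Omega -> R) : Prop :=
  forall t, 0 <= t <= S ->
    measurable_fun (`[0, t] `*` [set: Filt t])
      (fun z : R * Filt t => h z.1 z.2).

Definition continuous_paths (S : R) (h : R -> Omega -> R) : Prop :=
  {ae P, forall w, {within `[0, S], continuous (fun t => h t w)}}.

Definition sqnorm (S : R) (h : R -> Omega -> R) : \bar R :=
  (\int[P]_w \int[mu]_(s in `[0%R, S]) ((h s w) ^+ 2)%:E)%E.

Definition square_integrable (S : R) (h : R -> Omega -> R) : Prop :=
  progressive S h /\ (sqnorm S h < +oo)%E.

Record simple_process : Type := SimpleProcess {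
  sp_size : nat ;
  sp_time : nat -> R ;
  sp_coef : nat -> Omega -> R ;
  sp_time_ge0 : 0 <= sp_time 0%N ;
  sp_time_mono : {homo sp_time : i j / (i <= j)%N >-> i <= j} ;
  sp_adapted : forall i,
    measurable_fun setT (sp_coef i : Filt (sp_time i) -> R) ;
  sp_bounded : exists K : R, forall i w, `|sp_coef i w| <= K }.

Definition simple_value (s : simple_process) (t : R) (w : Omega) : R :=
  \sum_(i < sp_size s)
    sp_coef s i w * \1_(`]sp_time s i, sp_time s i.+1]) t.

Definition simple_integral (s : simple_process) (t : R) (w : Omega) : R :=
  \sum_(i < sp_size s)
    sp_coef s i w *
      (B (Num.min (sp_time s i.+1) t) w - B (Num.min (sp_time s i) t) w).

(* M is a version, with continuous paths, of t |-> \int_0^t h dB on [0, S] *)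
Definition ito_integral (S : R) (h M : R -> Omega -> R) : Prop :=
  [/\ square_integrable S h, progressive S M, continuous_paths S M &
      exists hn : nat -> simple_process,
        (sqnorm S (fun t w => simple_value (hn n) t w - h t w)
           @[n --> \oo] --> 0%E) /\
        (forall t, 0 <= t <= S ->
           (\int[P]_w ((simple_integral (hn n) t w - M t w) ^+ 2)%:E)%E
             @[n --> \oo] --> 0%E)].

End stochastic_calculus.

Section control_problem.
Context {d : measure_display} {Omega : measurableType d} {R : realType}.
Variables (P : probability Omega R) (B : R -> Omega -> R).
Local Notation mu := (@lebesgue_measure R).
Local Notation coefficient := (Omega -> R -> R -> R -> R -> R).
Variables (T T0 x0 : R) (U : set R).

Local Notation Filt t := (g_sigma_algebraType (filtration_events P B t)).

(* A coefficient c is applied as c w t x u y, the terminal gain as g w x y. *)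

Definition coef_dx (c : coefficient) : coefficient :=
  fun w t x u y => derive1 (fun x' => c w t x' u y) x.

Definition gain_dx (g : Omega -> R -> R -> R) : Omega -> R -> R -> R :=
  fun w x y => derive1 (fun x' => g w x' y) x.

Definition coef_adapted (c : coefficient) : Prop :=
  forall t x u y, 0 <= t <= T -> U u ->
    measurable_fun setT ((fun w => c w t x u y) : Filt t -> R).

Definition gain_measurable (g : Omega -> R -> R -> R) : Prop :=
  forall x y, measurable_fun setT ((fun w => g w x y) : Filt T -> R).

Definition coef_continuous (c : coefficient) : Prop :=
  forall w y,
    {within [set z : R * R * R | 0 <= z.1.1 <= T /\ U z.2],
      continuous (fun z : R * R * R => c w z.1.1 z.1.2 z.2 y)}.

Definition coef_bounded (c : coefficient) (L : R) : Prop :=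
  forall w t x u y, 0 <= t <= T -> U u -> `|c w t x u y| <= L.

Definition coef_growth (c : coefficient) (L : R) : Prop :=
  forall w t x u y, 0 <= t <= T -> U u ->
    `|c w t x u y| <= L * (1 + `|x| + `|u|).

Definition coef_C2 (c : coefficient) : Prop :=
  [/\ forall w t x u y, 0 <= t <= T -> U u ->
        derivable (fun x' => c w t x' u y) x 1 /\
        derivable (fun x' => coef_dx c w t x' u y) x 1,
      coef_continuous c, coef_continuous (coef_dx c) &
      coef_continuous (coef_dx (coef_dx c))].

Definition gain_C2 (g : Omega -> R -> R -> R) : Prop :=
  forall w y,
    [/\ forall x, derivable (fun x' => g w x' y) x 1 /\
                  derivable (fun x' => gain_dx g w x' y) x 1,
        continuous (fun x => g w x y), continuous (fun x => gain_dx g w x y) &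
        continuous (fun x => gain_dx (gain_dx g) w x y)].

Record regular_coefficients (b sigma f : coefficient)
    (g : Omega -> R -> R -> R) (L : R) : Prop := RegularCoefficients {
  reg_b : coef_C2 b ;
  reg_sigma : coef_C2 sigma ;
  reg_f : coef_C2 f ;
  reg_g : gain_C2 g ;
  reg_bx : coef_bounded (coef_dx b) L ;
  reg_bxx : coef_bounded (coef_dx (coef_dx b)) L ;
  reg_sigmax : coef_bounded (coef_dx sigma) L ;
  reg_sigmaxx : coef_bounded (coef_dx (coef_dx sigma)) L ;
  reg_fxx : coef_bounded (coef_dx (coef_dx f)) L ;
  reg_gxx : forall w x y, `|gain_dx (gain_dx g) w x y| <= L ;
  reg_b_growth : coef_growth b L ;
  reg_sigma_growth : coef_growth sigma L ;
  reg_fx_growth : coef_growth (coef_dx f) L ;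
  reg_gx_growth : forall w x y, `|gain_dx g w x y| <= L * (1 + `|x|) }.

Definition tail_sqnorm (phi : R -> R) (t : R) : R :=
  (\int[mu]_(s in `[t, T0]) (phi s ^+ 2))%R.

(* m_t(y) = E[delta_Y(y) | F_t] in its explicit Gaussian form; Yt is the
   process \int_0^t phi dB *)
Definition donsker_density (phi : R -> R) (Yt : R -> Omega -> R) (y t : R)
    (w : Omega) : R :=
  (Num.sqrt (2 * pi * tail_sqnorm phi t))^-1 *
  expR (- ((Yt t w - y) ^+ 2 / (2 * tail_sqnorm phi t))).

Definition admissible (u : R -> Omega -> R) : Prop :=
  [/\ forall t w, 0 <= t <= T -> U (u t w),
      progressive P B T u &
      forall i : nat, (0 < i)%N ->
        (ereal_sup [set \int[P]_w (`|u t w| ^+ i)%:E | t in `[0%R, T]]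
           < +oo)%E].

Definition state_equation (b sigma : coefficient) (y : R)
    (u x : R -> Omega -> R) : Prop :=
  [/\ square_integrable P B T x, continuous_paths P T x,
      {ae P, forall w, mu.-integrable `[0, T]
         (EFin \o (fun t => b w t (x t w) (u t w) y))} &
      exists2 M : R -> Omega -> R,
        ito_integral P B T (fun t w => sigma w t (x t w) (u t w) y) M &
        {ae P, forall w, forall t, 0 <= t <= T ->
           x t w = x0 + (\int[mu]_(s in `[0, t]) b w s (x s w) (u s w) y)%R
                   + M t w}].

Definition adjoint_driver (b sigma f : coefficient) (y : R)
    (m u x p q : R -> Omega -> R) (t : R) (w : Omega) : R :=
  coef_dx b w t (x t w) (u t w) y * p t w +
  coef_dx sigma w t (x t w) (u t w) y * q t w +
  coef_dx f w t (x t w) (u t w) y * m t w.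

Definition adjoint_equation (b sigma f : coefficient)
    (g : Omega -> R -> R -> R) (y : R)
    (m u x p q : R -> Omega -> R) : Prop :=
  [/\ square_integrable P B T p, continuous_paths P T p,
      {ae P, forall w, mu.-integrable `[0, T]
         (EFin \o (fun t => adjoint_driver b sigma f y m u x p q t w))} &
      exists2 M : R -> Omega -> R, ito_integral P B T q M &
        {ae P, forall w, forall t, 0 <= t <= T ->
           p t w = gain_dx g w (x T w) y * m T w
             + (\int[mu]_(s in `[t, T]) adjoint_driver b sigma f y m u x p q s w)%R
             - (M T w - M t w)}].

(* regular_coefficients bounds neither f nor g, so the functional is taken in
   \bar R, where the library's convention +oo - oo = -oo applies. *)
Definition performance (f : coefficient) (g : Omega -> R -> R -> R) (y : R)
    (m u x : R -> Omega -> R) : \bar R :=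
  (\int[P]_w (\int[mu]_(t in `[0%R, T]) (f w t (x t w) (u t w) y * m t w)%:E
              + (g w (x T w) y * m T w)%:E))%E.

Definition hamiltonian (b sigma f : coefficient) (y : R) (m : R -> Omega -> R)
    (w : Omega) (t x u p q : R) : R :=
  f w t x u y * m t w + b w t x u y * p + sigma w t x u y * q.

Definition hamiltonian_values (b sigma f : coefficient) (y : R)
    (m : R -> Omega -> R) (w : Omega) (t x p q : R) : set R :=
  [set hamiltonian b sigma f y m w t x u p q | u in U].

(* meaningful where the maximum exists, in which case it is the maximum *)
Definition max_hamiltonian (b sigma f : coefficient) (y : R)
    (m p q : R -> Omega -> R) (w : Omega) (t x : R) : R :=
  sup (hamiltonian_values b sigma f y m w t x (p t w) (q t w)).

End control_problem.

(* Main.v *)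
Require Import Defs.
From HB Require Import structures.
From mathcomp Require Import all_boot all_order all_algebra.
From mathcomp Require Import all_classical all_reals all_analysis.
From mathcomp Require Import measurable_realfun ring lra.
Import Order.TTheory GRing.Theory Num.Theory.
Import numFieldNormedType.Exports.
Local Open Scope classical_set_scope.
Local Open Scope ring_scope.
Set Implicit Arguments.
Unset Strict Implicit.
Unset Printing Implicit Defensive.

(** Write H for the Hamiltonian and Hhat for its maximum over controls.  The
    function H(t, ., ustar_t, p_t, q_t) lies below the concave function Hhat(t, .)
    and, ustar being a maximizer, meets it at xstar_t.  A concave function that
    meets a differentiable minorant at a point lies below the tangent of that
    minorant there ([concave_le_tangent]), and the slope of this tangent is the
    driver delta_t of the adjoint equation.  Evaluating at the state x of
    another control u gives, for each t and almost surely,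
      f m <= fstar m + p (bstar - b) + q (sigmastar - sigma)
               + (x - xstar) delta,
    where starred coefficients are taken along (xstar, ustar) and the others
    along (x, u).  Concavity of g gives in the same way
      g(x_T) m_T <= g(xstar_T) m_T + p_T (x_T - xstar_T).
    Optimality follows once the correction terms on the right have total
    expectation zero.

    This cancellation is the duality of the state and adjoint equations,
      E[p_T (x_T - x0)] = E int_0^T (p b + q sigma - (x - x0) delta) dt,
    applied to x and to xstar ([ito_product_expectation]).  It is the expectation
    of the product rule for p and x - x0.  Substituting the integrated form of
    both equations into the left-hand side leaves four kinds of terms.  Those
    with a future increment of a stochastic integral against an adapted
    process vanish by the martingale property
    ([ito_orthogonal]); the product of the two stochastic integrals is
    evaluated by the isometry ([ito_isometry]); the two double time integrals
    of b and delta agree because integration over [0, t] and integration over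
    [t, T] are adjoint ([volterra_adjoint]); the remaining terms are the ones in
    the formula.  The martingale property and the isometry are proved for
    simple processes, where they reduce to the independence and the first two
    moments of Gaussian increments, and pass to limits in mean square.

    Two points need care.  Neither f nor g is bounded by the hypotheses, so
    the performances may be infinite and the integrals of the gains need not be
    additive; the inequalities are therefore integrated through positive and
    negative parts, using that the correction terms are integrable
    ([le_integral_add_integrable]).  And the first inequality holds for each t
    outside a null set depending on t, whereas the performance integrates in
    time first; Fubini provides the exchange ([ae_swap_le]).  It requires joint
    measurability of the coefficients along the processes, which holds since
    they are measurable in the event and continuous in the other variables
    ([measurable_fun_caratheodory]). *)

(** * Square-integrable functions *)

Section L2.
Context {d : measure_display} {X : measurableType d} {R : realType}.
Variable nu : {measure set X -> \bar R}.
Implicit Types f g h : X -> R.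

Definition sq_integrable (f : X -> R) : Prop :=
  measurable_fun setT f /\ (\int[nu]_x ((f x) ^+ 2)%:E < +oo)%E.

Lemma integrableD_EFin f g : nu.-integrable setT (EFin \o f) ->
  nu.-integrable setT (EFin \o g) ->
  nu.-integrable setT (EFin \o (fun x => f x + g x)).
Proof. by move=> hf hg; exact: (integrableD _ hf hg). Qed.

Lemma integrableZl_EFin (k : R) f : nu.-integrable setT (EFin \o f) ->
  nu.-integrable setT (EFin \o (fun x => k * f x)).
Proof. by move=> hf; exact: (integrableZl _ k hf). Qed.

Lemma integrableB_EFin f g : nu.-integrable setT (EFin \o f) ->
  nu.-integrable setT (EFin \o g) ->
  nu.-integrable setT (EFin \o (fun x => f x - g x)).
Proof. by move=> hf hg; exact: (integrableB _ hf hg). Qed.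

Lemma sq_integrableX2 f : sq_integrable f ->
  nu.-integrable setT (EFin \o (fun x => (f x) ^+ 2)).
Proof.
move=> [mf fi]; apply/integrableP; split.
  by apply/measurable_EFinP; exact: measurable_funX.
under eq_integral do rewrite /= ger0_norm ?sqr_ge0//.
exact: fi.
Qed.

Lemma sq_integrable_ae_le f g : measurable_fun setT f -> sq_integrable g ->
  {ae nu, forall x, `|f x| <= `|g x|} -> sq_integrable f.
Proof.
move=> mf [mg gi] fg; split => //.
apply: le_lt_trans gi; apply: ae_ge0_le_integral => //=.
- by move=> x _; rewrite lee_fin sqr_ge0.
- by apply/measurable_EFinP; exact: measurable_funX.
- by move=> x _; rewrite lee_fin sqr_ge0.
- by apply/measurable_EFinP; exact: measurable_funX.
- apply: filterS fg => x fg _; rewrite lee_fin -(real_normK (num_real (f x)))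
    -(real_normK (num_real (g x))) lerXn2r ?nnegrE//.
Qed.

Lemma sq_integrable_le f g : measurable_fun setT f -> sq_integrable g ->
  (forall x, `|f x| <= `|g x|) -> sq_integrable f.
Proof. by move=> mf hg fg; apply: sq_integrable_ae_le hg _ => //; exact: aeW. Qed.

Lemma sq_integrable_ae_eq f g : measurable_fun setT f -> sq_integrable g ->
  {ae nu, forall x, f x = g x} -> sq_integrable f.
Proof.
move=> mf [mg gi] fg; split => //.
rewrite (_ : (\int[nu]_x _)%E = (\int[nu]_x ((g x) ^+ 2)%:E)%E)//.
apply: ae_eq_integral => //.
- by apply/measurable_EFinP; exact: measurable_funX.
- by apply/measurable_EFinP; exact: measurable_funX.
- by apply: filterS fg => x -> _.
Qed.

Lemma sq_integrableZ (k : R) f : sq_integrable f ->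
  sq_integrable (fun x => k * f x).
Proof.
move=> [mf fi]; split; first exact: measurable_funM.
under eq_integral do rewrite exprMn EFinM.
rewrite ge0_integralZl_EFin ?sqr_ge0//.
- by rewrite lte_mul_pinfty// lee_fin sqr_ge0.
- by move=> x _; rewrite lee_fin sqr_ge0.
- by apply/measurable_EFinP; exact: measurable_funX.
Qed.

Lemma sq_integrableN f : sq_integrable f -> sq_integrable (fun x => - f x).
Proof.
move=> /(sq_integrableZ (-1)).
by rewrite (_ : (fun x => - f x) = (fun x => -1 * f x))//; apply/funext => x;
  rewrite mulN1r.
Qed.

Lemma sq_integrableD f g : sq_integrable f -> sq_integrable g ->
  sq_integrable (fun x => f x + g x).
Proof.
move=> hf hg; have [mf _] := hf; have [mg _] := hg.
split; first exact: measurable_funD.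
apply: (@le_lt_trans _ _
    (\int[nu]_x (2 * (f x) ^+ 2 + 2 * (g x) ^+ 2)%:E)%E).
  apply: ge0_le_integral => //=.
  - by move=> x _; rewrite lee_fin sqr_ge0.
  - by apply/measurable_EFinP; apply: measurable_funX; exact: measurable_funD.
  - apply/measurable_EFinP.
    by apply: measurable_funD; apply: measurable_funM => //; exact: measurable_funX.
  - by move=> x _; rewrite lee_fin; have := sqr_ge0 (f x - g x); nra.
apply: integrable_lty => //.
by apply: integrableD_EFin; apply: integrableZl_EFin; exact: sq_integrableX2.
Qed.

Lemma sq_integrableB f g : sq_integrable f -> sq_integrable g ->
  sq_integrable (fun x => f x - g x).
Proof. by move=> hf hg; apply: sq_integrableD => //; exact: sq_integrableN. Qed.

Lemma sq_integrable_sum (n : nat) (f : 'I_n -> X -> R) :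
  (forall i, sq_integrable (f i)) ->
  sq_integrable (fun x => \sum_(i < n) f i x).
Proof.
elim: n f => [f _|n IH f hf].
  split; first by under eq_fun do rewrite big_ord0; exact: measurable_cst.
  by under eq_integral do rewrite big_ord0 expr0n; rewrite integral0 ltry.
rewrite (_ : (fun x => _) =
    (fun x => (\sum_(i < n) f (widen_ord (leqnSn n) i) x) + f ord_max x)).
  by apply: sq_integrableD => //; apply: IH => i; exact: hf.
by apply/funext => x; rewrite big_ord_recr.
Qed.

Lemma sq_integrableM_bounded (K : R) h f : measurable_fun setT h ->
  (forall x, `|h x| <= K) -> sq_integrable f ->
  sq_integrable (fun x => h x * f x).
Proof.
move=> mh hK hf; have [mf _] := hf.
apply: (sq_integrable_le _ (sq_integrableZ K hf)).
  exact: measurable_funM.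
move=> x; rewrite !normrM ler_wpM2r// (le_trans (hK x))// ler_norm//.
Qed.

Lemma sq_integrable_mul f g : sq_integrable f -> sq_integrable g ->
  nu.-integrable setT (EFin \o (fun x => f x * g x)).
Proof.
move=> hf hg; have [mf _] := hf; have [mg _] := hg.
apply: (@le_integrable _ _ _ nu setT _ _
  (fun x => ((f x) ^+ 2 + (g x) ^+ 2)%:E)) => //.
- by apply/measurable_EFinP; exact: measurable_funM.
- move=> x _; rewrite !abse_EFin lee_fin normrM.
  rewrite [leRHS]ger0_norm ?addr_ge0 ?sqr_ge0//.
  rewrite -(real_normK (num_real (f x))) -(real_normK (num_real (g x))).
  by have := sqr_ge0 (`|f x| - `|g x|); have := sqr_ge0 (`|f x| + `|g x|); nra.
- by apply: integrableD_EFin; exact: sq_integrableX2.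
Qed.

Lemma cauchy_schwarz_Rintegral f g : sq_integrable f -> sq_integrable g ->
  (\int[nu]_x (f x * g x))%R ^+ 2 <=
  (\int[nu]_x ((f x) ^+ 2))%R * (\int[nu]_x ((g x) ^+ 2))%R.
Proof.
move=> hf hg.
set A := (\int[nu]_x (f x ^+ 2))%R; set C := (\int[nu]_x (g x ^+ 2))%R.
set B := (\int[nu]_x (f x * g x))%R.
have if2 := sq_integrableX2 hf.
have ig2 := sq_integrableX2 hg.
have ifg := sq_integrable_mul hf hg.
(* the integral of (f + k g)^2 is a nonnegative quadratic polynomial in k, so its
   discriminant is at most 0 *)
have key k : 0 <= A + 2 * k * B + k ^+ 2 * C.
  rewrite -!RintegralZl// -!RintegralD//.
  - apply: Rintegral_ge0 => x _.
    by rewrite (_ : _ + _ = (f x + k * g x) ^+ 2) ?sqr_ge0//; ring.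
  - by apply: integrableD_EFin => //; exact: integrableZl_EFin.
  - exact: integrableZl_EFin.
  - exact: integrableZl_EFin.
have A0 : 0 <= A by apply: Rintegral_ge0 => x _; exact: sqr_ge0.
have C0 : 0 <= C by apply: Rintegral_ge0 => x _; exact: sqr_ge0.
have [C00|Cn0] := eqVneq C 0.
  have [->|Bn0] := eqVneq B 0; first by rewrite expr0n C00 mulr0.
  have := key (- (A + 1) / (2 * B)); rewrite C00 mulr0 addr0.
  rewrite (_ : _ + _ = -1); first lra.
  by field.
have Cp : 0 < C by rewrite lt_neqAle eq_sym Cn0.
have := key (- B / C).
rewrite (_ : _ + _ = (A * C - B ^+ 2) / C); last by field.
by rewrite ler_pdivlMr// mul0r subr_ge0.
Qed.

(** Cauchy-Schwarz bounds the difference of the integrals by the mean square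
    distance of [fn n] and [f] times the norm of [g]. *)
Lemma cvg_Rintegral_mul (fn : nat -> X -> R) f g :
  (forall n, sq_integrable (fn n)) -> sq_integrable f -> sq_integrable g ->
  (\int[nu]_x ((fn n x - f x) ^+ 2)%:E)%E @[n --> \oo] --> 0%E ->
  (\int[nu]_x (fn n x * g x))%R @[n --> \oo] --> (\int[nu]_x (f x * g x))%R.
Proof.
move=> hfn hf hg cv.
set C := (\int[nu]_x ((g x) ^+ 2))%R.
pose e n := (\int[nu]_x ((fn n x - f x) ^+ 2))%R.
have e0 : e n @[n --> \oo] --> 0.
  exact: (fine_cvg cv).
have C0 : 0 <= C by apply: Rintegral_ge0 => x _; exact: sqr_ge0.
have eC : Num.sqrt (e n * C) @[n --> \oo] --> 0.
  have -> : (0 : R) = Num.sqrt (0 * C) by rewrite mul0r sqrtr0.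
  apply: (@continuous_cvg _ _ _ _ _ _ (@Num.sqrt R)); first exact: sqrt_continuous.
  exact: cvgMl.
apply/cvgrPdist_le => eps eps0.
move/cvgr_dist_le : eC => /(_ _ eps0); apply: filterS => n.
rewrite sub0r normrN ger0_norm ?sqrtr_ge0//; apply: le_trans.
rewrite distrC -RintegralB//; [|exact: sq_integrable_mul..].
under eq_Rintegral do rewrite -mulrBl.
rewrite -(sqrtr_sqr (\int[nu]_x _)%R) ler_wsqrtr//.
by apply: cauchy_schwarz_Rintegral => //; exact: sq_integrableB.
Qed.

End L2.

(** * Comparison of integrals that may be infinite *)

Lemma maxr0B (R : realType) (r : R) : Num.max r 0 = r + Num.max (- r) 0.
Proof. by rewrite !maxEle oppr_le0; case: (leP r 0) => r0; case: (leP 0 r) => r0'; lra. Qed.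

Section extended_pointwise.
Context {R : realType}.
Local Open Scope ereal_scope.

Lemma maxeN_le (x x' : \bar R) (h : R) : x <= x' + h%:E ->
  maxe (- x') 0 <= maxe (- x) 0 + maxe h%:E 0.
Proof.
have h0 : 0 <= maxe h%:E 0 by rewrite le_max lexx orbT.
case: x x' => [r| |] [r'| |] //= le.
- rewrite -!EFin_max -EFinD lee_fin ge_max; move: le; rewrite lee_fin => le.
  have p1 : (- r <= Num.max (- r) 0)%R by rewrite le_max lexx.
  have p2 : (0 <= Num.max (- r) 0)%R by rewrite le_max lexx orbT.
  have p3 : (h <= Num.max h 0)%R by rewrite le_max lexx.
  have p4 : (0 <= Num.max h 0)%R by rewrite le_max lexx orbT.
  by apply/andP; split; lra.
- by rewrite maxNye adde_ge0// le_max lexx orbT.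
- by rewrite maxNye adde_ge0// le_max lexx orbT.
- by rewrite maxye -!EFin_max addye ?leey.
- by rewrite maxNye adde_ge0// le_max lexx orbT.
- by rewrite maxye -!EFin_max addye ?leey.
Qed.

Lemma maxe_add_le (x x' : \bar R) (h : R) : x <= x' + h%:E ->
  maxe x 0 + maxe (- x') 0 + maxe (- h%:E) 0 <=
  maxe x' 0 + maxe (- x) 0 + maxe h%:E 0.
Proof.
case: x x' => [r| |] [r'| |] //= le.
- rewrite -!EFin_max -!EFinD lee_fin; move: le; rewrite lee_fin => le.
  by rewrite (maxr0B r) (maxr0B r') (maxr0B h); lra.
all: rewrite ?maxye ?maxNye -!EFin_max ?addye ?addey ?leey//.
Qed.

Lemma lee_subDB (p n p' n' : \bar R) (hp hn : R) : 0 <= n -> 0 <= n' ->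
  n' <= n + hp%:E -> p + n' + hn%:E <= p' + n + hp%:E ->
  p - n <= p' - n' + (hp%:E - hn%:E).
Proof.
case: n => [n| |] // n0; last by rewrite addeNy leNye.
case: n' => [n'| |] // n'0; case: p' => [p'| |] //; case: p => [p| |] //=.
- by rewrite -!EFinD !lee_fin; lra.
- by move=> _ _; rewrite addNye leNye.
- by move=> _ _; rewrite !addye //= leey.
Qed.

End extended_pointwise.

Section extended.
Context {d : measure_display} {X : measurableType d} {R : realType}.
Variable nu : {measure set X -> \bar R}.
Implicit Types f g h : X -> R.
Local Open Scope ereal_scope.

(** [a] and [a'] need not be integrable, so [a'] + [h] cannot be integrated
    term by term.  The pointwise bound implies a'^- <= a^- + h^+ and
    a^+ + a'^- + h^- <= a'^+ + a^- + h^+ ([maxeN_le], [maxe_add_le]).  These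
    involve only sums of nonnegative functions and can be integrated;
    [lee_subDB] recombines them, the integrals of h^+ and h^- being finite. *)
Lemma le_integral_add_integrable (D : set X) (a a' : X -> \bar R) (h : X -> R) :
  measurable D ->
  measurable_fun D a -> measurable_fun D a' ->
  nu.-integrable D (EFin \o h) ->
  {ae nu, forall x, D x -> a x <= a' x + (h x)%:E} ->
  \int[nu]_(x in D) a x <=
  \int[nu]_(x in D) a' x + \int[nu]_(x in D) (h x)%:E.
Proof.
move=> mD ma ma' ih le.
have mh : measurable_fun D (EFin \o h) by apply: measurable_int ih.
have mhp := measurable_funepos mh; have mhn := measurable_funeneg mh.
have map := measurable_funepos ma; have man := measurable_funeneg ma.
have ma'p := measurable_funepos ma'; have ma'n := measurable_funeneg ma'.
pose I (k : X -> \bar R) := \int[nu]_(x in D) k x.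
have Ige0 k : (forall x, 0 <= k x) -> 0 <= I k by move=> k0; apply: integral_ge0.
have hn_fin : I (EFin \o h)^\- \is a fin_num by exact: integrable_neg_fin_num.
have hp_fin : I (EFin \o h)^\+ \is a fin_num by exact: integrable_pos_fin_num.
have neg_le : I a'^\- <= I a^\- + I (EFin \o h)^\+.
  rewrite -ge0_integralD//; apply: ae_ge0_le_integral => //.
  - by move=> x _; apply: adde_ge0.
  - exact: emeasurable_funD.
  apply: filterS le => x le Dx; move: (le Dx).
  by rewrite !funenegE funeposE; exact: maxeN_le.
have pos_le : I a^\+ + I a'^\- + I (EFin \o h)^\- <=
              I a'^\+ + I a^\- + I (EFin \o h)^\+.
  rewrite -!ge0_integralD//; last 4 first.
  - by move=> x _; apply: adde_ge0.
  - exact: emeasurable_funD.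
  - by move=> x _; apply: adde_ge0.
  - exact: emeasurable_funD.
  apply: ae_ge0_le_integral => //.
  - by move=> x _; rewrite !adde_ge0.
  - by do 2 apply: emeasurable_funD => //.
  - by move=> x _; rewrite !adde_ge0.
  - by do 2 apply: emeasurable_funD => //.
  apply: filterS le => x le Dx; move: (le Dx).
  by rewrite !funenegE !funeposE; exact: maxe_add_le.
rewrite (integralE nu D a) (integralE nu D a') (integralE nu D (fun x => (h x)%:E)).
have := @lee_subDB _ (I a^\+) (I a^\-) (I a'^\+) (I a'^\-)
  (fine (I (EFin \o h)^\+)) (fine (I (EFin \o h)^\-)).
by rewrite !fineK//; apply => //; exact: Ige0.
Qed.

End extended.

(** * Composition of Caratheodory functions with measurable functions *)

Section rounding.
Context {R : realType}.

(** Rounding is towards the base point [a]: an interval that contains [a] and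
    [v] then contains the rounded value too, which rounding down does not
    ensure. *)
Definition grid_index (n : nat) (a v : R) : int :=
  if a <= v then Num.floor (n.+1%:R * (v - a))
  else - Num.floor (n.+1%:R * (a - v)).

Definition grid_point (n : nat) (a : R) (k : int) : R := a + k%:~R / n.+1%:R.

Lemma grid_pointE n a v :
  (a <= v -> a <= grid_point n a (grid_index n a v) <= v /\
     v - n.+1%:R^-1 <= grid_point n a (grid_index n a v)) /\
  (v <= a -> v <= grid_point n a (grid_index n a v) <= a /\
     grid_point n a (grid_index n a v) <= v + n.+1%:R^-1).
Proof.
have n0 : (0 < n.+1%:R :> R) by rewrite ltr0n.
have gen (z : R) : 0 <= z ->
    [/\ 0 <= (Num.floor (n.+1%:R * z))%:~R / (n.+1%:R : R),
     (Num.floor (n.+1%:R * z))%:~R / n.+1%:R <= z &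
    z - n.+1%:R^-1 <= (Num.floor (n.+1%:R * z))%:~R / (n.+1%:R : R)].
  move=> z0; have nz : 0 <= n.+1%:R * z by rewrite mulr_ge0// ltW.
  split.
  - by rewrite divr_ge0// ler0z floor_ge0.
  - by rewrite ler_pdivrMr// mulrC; exact: floor_le.
  - rewrite lerBlDr -[X in _ <= _ + X]mul1r -mulrDl ler_pdivlMr// mulrC.
    by rewrite -(intrD _ _ 1) ltW// floorD1_gt.
rewrite /grid_point /grid_index; split => av.
- rewrite av; have [|h1 h2 h3] := gen (v - a); first by rewrite subr_ge0.
  move: (_%:~R / _) h1 h2 h3 => q h1 h2; move: (n.+1%:R^-1) => r h3.
  by split; first (apply/andP; split); lra.
- case: ifPn => [av'|_].
    have -> : v = a by apply/eqP; rewrite eq_le av av'.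
    rewrite subrr mulr0 floor0 mul0r addr0 lexx; split => //.
    by rewrite lerDl invr_ge0.
  have [|h1 h2 h3] := gen (a - v); first by rewrite subr_ge0.
  rewrite rmorphN mulNr.
  move: (_%:~R / _) h1 h2 h3 => q h1 h2; move: (n.+1%:R^-1) => r h3.
  by split; first (apply/andP; split); lra.
Qed.

Lemma grid_point_cvg a v :
  grid_point n a (grid_index n a v) @[n --> \oo] --> v.
Proof.
apply/cvgrPdist_le => e e0.
have := @cvg_harmonic R => /cvgrPdist_le /(_ _ e0); apply: filterS => n.
rewrite sub0r normrN /harmonic ger0_norm ?invr_ge0//; apply: le_trans => /=.
have [h1 h2] := grid_pointE n a v; have n0 : 0 <= (n.+1%:R^-1 : R) by [].
move: (grid_point _ _ _) (n.+1%:R^-1) h1 h2 n0 => w r h1 h2 r0.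
have [av|/ltW va] := leP a v.
- by have [/andP[? ?] ?] := h1 av; rewrite ler_norml; apply/andP; split; lra.
- by have [/andP[? ?] ?] := h2 va; rewrite ler_norml; apply/andP; split; lra.
Qed.

Lemma measurable_grid_index n a (k : int) :
  measurable [set v : R | grid_index n a v = k].
Proof.
pose F (v : R) : R := n.+1%:R * (v - a); pose G (v : R) : R := n.+1%:R * (a - v).
have mF : measurable_fun setT F.
  by apply: measurable_funM => //; exact: measurable_funB.
have mG : measurable_fun setT G.
  by apply: measurable_funM => //; exact: measurable_funB.
rewrite (_ : [set v | _] =
  (`[a, +oo[ `&` F @^-1` `[k%:~R, (k + 1)%:~R[) `|`
  (`]-oo, a[ `&` G @^-1` `[(- k)%:~R, (- k + 1)%:~R[)).
  apply: measurableU; apply: measurableI => //.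
  - by rewrite -[X in measurable X]setTI; exact: mF.
  - by rewrite -[X in measurable X]setTI; exact: mG.
rewrite /grid_index; apply/seteqP; split => v /=; rewrite !in_itv/= ?andbT.
- have [av /eqP|va /eqP] := leP a v.
    by rewrite floor_eq => h; left.
  by rewrite eqr_oppLR floor_eq => h; right.
- case=> -[h1]; first by rewrite h1 -floor_eq => /eqP.
  by rewrite (leNgt a v) h1 /= -floor_eq -eqr_oppLR => /eqP.
Qed.

End rounding.

Lemma within_continuous_seq (V W : topologicalType) (A : set V) (f : V -> W)
    (s : nat -> V) (l : V) : {within A, continuous f} -> A l ->
  (forall n, A (s n)) -> s n @[n --> \oo] --> l ->
  f (s n) @[n --> \oo] --> f l.
Proof.
move=> /subspace_continuousP cf Al As sl.
apply: (@cvg_comp _ _ _ s f _ (within A (nbhs l))); last exact: cf.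
move=> B BA; have := sl _ BA; rewrite /nbhs /=; apply: (@filterS _ (nbhs \oo)) => n /= h; exact: (h (As n)).
Qed.

Section caratheodory.
Context {d : measure_display} {X : measurableType d} {R : realType}.

(** Replacing [z] by its rounding to a grid gives a function that is measurable
    because it coincides with one of countably many [c ^~ v] on each of countably
    many measurable sets; continuity in the second variable passes to the limit. *)
Lemma measurable_fun_caratheodory (D : set X) (I : set R) (c : X -> R -> R)
    (z : X -> R) (a : R) :
  measurable D -> is_interval I -> I a ->
  (forall v, I v -> measurable_fun D (c ^~ v)) ->
  (forall x (s : R^nat), D x -> (forall n, I (s n)) ->
     s n @[n --> \oo] --> z x -> c x (s n) @[n --> \oo] --> c x (z x)) ->
  measurable_fun D z -> (forall x, D x -> I (z x)) ->
  measurable_fun D (fun x => c x (z x)).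
Proof.
move=> mD itvI Ia mc cc mz zI.
pose zn n x := grid_point n a (grid_index n a (z x)).
have znI n x : D x -> I (zn n x).
  move=> Dx; have [h1 h2] := grid_pointE n a (z x).
  have [az|/ltW za] := leP a (z x).
  - by apply: (itvI _ _ Ia (zI _ Dx)); have [] := h1 az.
  - by apply: (itvI _ _ (zI _ Dx) Ia); have [] := h2 za.
apply: (measurable_fun_cvg (h := fun n x => c x (zn n x))); last first.
  move=> x Dx; apply: cc => // [n|]; first exact: znI.
  exact: grid_point_cvg.
move=> n _ C mC.
rewrite (_ : _ `&` _ = \bigcup_(k in [set: int])
  ((D `&` z @^-1` [set v | grid_index n a v = k]) `&`
   (if pselect (I (grid_point n a k)) then
     D `&` c ^~ (grid_point n a k) @^-1` C else set0))).
  apply: countable_bigcupT_measurable => [|k]; first exact: countableP.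
  apply: measurableI; first by apply: mz => //; exact: measurable_grid_index.
  by case: pselect => [Ik|nIk]; [exact: (mc _ Ik mD C mC)|exact: measurable0].
apply/seteqP; split => [x [Dx /= Cx]|x [k _ [[Dx /= <-]]]].
  exists (grid_index n a (z x)) => //; split => //.
  by case: pselect => // -[]; exact: znI.
by case: pselect => // _ [].
Qed.

End caratheodory.

(** * Coefficients along measurable processes *)

Lemma derive1_quotient_cvg (R : realType) (f : R -> R) (a : R) :
  derivable f a 1 ->
  n.+1%:R * (f (a + n.+1%:R^-1) - f a) @[n --> \oo] --> derive1 f a.
Proof.
move=> df; rewrite derive1E.
have h0 : (n.+1%:R^-1 : R) @[n --> \oo] --> 0^'.
  move=> A [e /= e0 eA].
  have /cvgrPdist_lt /(_ _ e0) := @cvg_harmonic R.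
  apply: (@filterS _ (nbhs \oo)) => n he; apply: eA; first exact: he.
  by rewrite /= invr_eq0 pnatr_eq0.
have := @cvg_comp _ _ _ _ _ _ _ _ h0 df.
apply: cvg_trans; apply: near_eq_cvg; near=> n.
by rewrite /= invrK /GRing.scale /= mulr1 (addrC a).
Unshelve. all: by end_near. Qed.

Lemma convex_set_is_interval (R : realType) (U : set R) :
  convex_set (U : set (convex_lmodType R^o)) -> is_interval U.
Proof.
move=> cU x y Ux Uy z /andP[xz zy].
have [xy|yx] := ltP x y; last first.
  by have -> : z = x by apply/eqP; rewrite eq_le xz (le_trans zy).
pose l := (y - z) / (y - x).
have yx0 : 0 < y - x by rewrite subr_gt0.
have l0 : 0 <= l by rewrite divr_ge0 ?subr_ge0// ltW.
have l1 : l <= 1 by rewrite ler_pdivrMr// mul1r; lra.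
have : U (l * x + (1 - l) * y).
  by have := cU x y (Itv01 l0 l1); rewrite !inE; apply.
rewrite (_ : _ + _ = z)//; rewrite /l.
by field; rewrite gt_eqF.
Qed.

Lemma cvg_seq_pair (V W : topologicalType) (f : nat -> V) (g : nat -> W) (a : V) (b : W) :
  f n @[n --> \oo] --> a -> g n @[n --> \oo] --> b ->
  (f n, g n) @[n --> \oo] --> (a, b).
Proof. by move=> fa gb; exact: (@cvg_pair _ _ _ _ (nbhs a) (nbhs b)). Qed.

Section coefficients.
Context {d dX : measure_display} {Omega : measurableType d}
  {X : measurableType dX} {R : realType}.
Variables (T : R) (U : set R) (u0 : R).
Hypotheses (itvU : is_interval U) (Uu0 : U u0).
Variables (c : Omega -> R -> R -> R -> R -> R) (y : R).
Hypothesis cc : coef_continuous T U c.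
Variables (D : set X) (om : X -> Omega) (tt xx uu : X -> R).
Hypotheses (mD : measurable D) (ttT : forall z, D z -> 0 <= tt z <= T)
  (uuU : forall z, D z -> U (uu z)).
Hypotheses (mtt : measurable_fun D tt) (mxx : measurable_fun D xx)
  (muu : measurable_fun D uu).

Let coef_cvg w (s : nat -> R * R * R) l :
  0 <= l.1.1 <= T /\ U l.2 -> (forall n, 0 <= (s n).1.1 <= T /\ U (s n).2) ->
  s n @[n --> \oo] --> l ->
  c w (s n).1.1 (s n).1.2 (s n).2 y @[n --> \oo] --> c w l.1.1 l.1.2 l.2 y.
Proof. by move=> hl hs; apply: (within_continuous_seq (@cc w y)). Qed.

Lemma measurable_coef_pathT :
  (forall t x u, 0 <= t <= T -> U u -> measurable_fun D (fun z => c (om z) t x u y)) ->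
  forall x u, U u -> measurable_fun D (fun z => c (om z) (tt z) x u y).
Proof.
move=> mc x u Uu.
have [[z0 Dz0]|D0] := pselect (exists z, D z); last first.
  rewrite (_ : D = set0); first exact: measurable_fun_set0.
  by apply/seteqP; split => // z Dz; apply: D0; exists z.
apply: (measurable_fun_caratheodory (I := `[0, T]) (a := tt z0)
  (c := fun z t => c (om z) t x u y)) => //.
- exact: interval_is_interval.
- by rewrite /= in_itv; exact: ttT.
- by move=> t; rewrite /= in_itv => tT; exact: mc.
- move=> z s Dz sT sz.
  apply: (@coef_cvg (om z) (fun n => (s n, x, u)) (tt z, x, u)).
  + by split => //; exact: ttT.
  + by move=> n; split => //; have := sT n; rewrite /= in_itv.
  + by apply: cvg_seq_pair (cvg_cst _); apply: cvg_seq_pair => //; exact: cvg_cst.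
Qed.

(** Two compositions, one for the state and one for the control, since the
    rounding argument treats one real variable at a time. *)
Lemma measurable_coef_path :
  (forall x u, U u -> measurable_fun D (fun z => c (om z) (tt z) x u y)) ->
  measurable_fun D (fun z => c (om z) (tt z) (xx z) (uu z) y).
Proof.
move=> mc.
apply: (measurable_fun_caratheodory (I := U) (a := u0)
  (c := fun z u => c (om z) (tt z) (xx z) u y)) => //.
- move=> u Uu; apply: (measurable_fun_caratheodory (I := setT) (a := 0)
    (c := fun z x => c (om z) (tt z) x u y)) => //.
  + by move=> x _; exact: mc.
  + move=> z s Dz _ sz.
    apply: (@coef_cvg (om z) (fun n => (tt z, s n, u)) (tt z, xx z, u)).
    * by split => //; exact: ttT.
    * by move=> n; split => //; exact: ttT.
    * by apply: cvg_seq_pair (cvg_cst _); apply: cvg_seq_pair => //; exact: cvg_cst.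
- move=> z s Dz sU sz.
  apply: (@coef_cvg (om z) (fun n => (tt z, xx z, s n)) (tt z, xx z, uu z)).
  + by split; [exact: ttT|exact: uuU].
  + by move=> n; split; [exact: ttT|exact: sU].
  + by apply: cvg_seq_pair => //; exact: cvg_cst.
Qed.

End coefficients.

(** * The augmented Brownian filtration *)

Section filtration.
Context {d : measure_display} {Omega : measurableType d} {R : realType}.
Variables (P : probability Omega R) (B : R -> Omega -> R).
Hypotheses (hP : measure_is_complete P) (hB : brownian_motion P B).
Local Notation Filt t := (g_sigma_algebraType (filtration_events P B t)).

(** Completeness of [P] makes the added null sets measurable. *)
Lemma filtration_sub_measurable (t : R) (A : set Omega) :
  <<s filtration_events P B t >> A -> measurable A.
Proof.
apply: smallest_sub; first exact: sigma_algebra_measurable.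
move=> C [[s /andP[s0 _] [E mE ->]]|]; last exact: hP.
by rewrite -[X in measurable X]setTI; exact: (bm_measurable hB s0).
Qed.

Lemma filtration_mono (s t : R) (A : set Omega) : s <= t ->
  <<s filtration_events P B s >> A -> <<s filtration_events P B t >> A.
Proof.
move=> st; apply: smallest_sub; first exact: smallest_sigma_algebra.
move=> C [[r /andP[r0 rs] [E mE ->]]|NC]; apply: sub_sigma_algebra.
  by left; exists r; [rewrite r0 (le_trans rs)|exists E].
by right.
Qed.

Lemma filtration_measurable_fun (t : R) (f : Omega -> R) :
  measurable_fun setT (f : Filt t -> R) -> measurable_fun setT f.
Proof. by move=> mf _ C mC; apply: (@filtration_sub_measurable t); exact: mf. Qed.

Lemma filtration_measurable_funW (s t : R) (f : Omega -> R) : s <= t ->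
  measurable_fun setT (f : Filt s -> R) -> measurable_fun setT (f : Filt t -> R).
Proof. by move=> st mf _ C mC; apply: (filtration_mono st); exact: mf. Qed.

Lemma measurable_filtration_id (t : R) :
  measurable_fun setT (fun w : Omega => w : Filt t).
Proof. by move=> _ C mC; rewrite setTI; exact: (@filtration_sub_measurable t). Qed.

Lemma brownian_adapted (s t : R) : 0 <= s <= t ->
  measurable_fun setT (B s : Filt t -> R).
Proof.
move=> st _ C mC; rewrite setTI; apply: sub_sigma_algebra; left.
by exists s => //; exists C.
Qed.

Lemma progressive_adapted (S : R) (h : R -> Omega -> R) (t : R) :
  progressive P B S h -> 0 <= t <= S ->
  measurable_fun setT (h t : Filt t -> R).
Proof.
move=> ph tS; have := ph t tS => mh.
apply: (measurable_comp (F := `[0, t] `*` [set: Filt t])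
  (f := fun z : R * Filt t => h z.1 z.2) (g := pair t)) => //.
- by apply: measurableX.
- by move=> _ [w _ <-]; split => //=; rewrite in_itv/= lexx andbT; case/andP: tS.
Qed.

Lemma progressive_measurable (S : R) (h : R -> Omega -> R) : 0 <= S ->
  progressive P B S h ->
  measurable_fun (`[0, S] `*` [set: Omega]) (fun z : R * Omega => h z.1 z.2).
Proof.
move=> S0 /(_ S); rewrite S0 lexx => /(_ isT) mh.
apply: (measurable_comp (F := `[0, S] `*` [set: Filt S])
  (f := fun z : R * Filt S => h z.1 z.2)
  (g := fun z : R * Omega => (z.1, z.2 : Filt S))) => //.
- by apply: measurableX.
- by move=> _ [w [? ?] <-]; split.
- apply: measurable_funTS; apply: measurable_fun_pair => //.
  exact: (measurableT_comp (@measurable_filtration_id S) measurable_snd).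
Qed.

End filtration.

(** * Moments of centred Gaussian laws *)

Section gaussian.
Context {R : realType}.
Local Notation mu := (@lebesgue_measure R).

(** The Radon-Nikodym density of the normal law agrees almost everywhere with
    the Gaussian density, as both have the same integral over each set. *)
Lemma ge0_integral_normal_prob (m s : R) (f : R -> \bar R) :
  measurable_fun setT f -> (forall x, 0 <= f x)%E ->
  (\int[normal_prob m s]_x f x = \int[mu]_x (f x * (normal_pdf m s x)%:E))%E.
Proof.
move=> mf f0; pose dom := normal_prob_dominates m s.
rewrite -(Radon_Nikodym_SigmaFinite.change_of_variables dom)//.
have fi := Radon_Nikodym_SigmaFinite.f_integrable dom.
apply: ae_eq_integral => //.
- by apply: emeasurable_funM => //; exact: measurable_int fi.
- apply: emeasurable_funM => //; apply/measurable_EFinP.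
  exact: measurable_normal_pdf.
- apply: ae_eqe_mul2l; apply: integral_ae_eq => //.
  + by apply/measurable_EFinP; exact: measurable_normal_pdf.
  + by move=> E _ mE; rewrite -Radon_Nikodym_SigmaFinite.f_integral.
Qed.

Lemma integral_expR_sqr (a : R) : 0 < a ->
  (\int[mu]_x (expR (- a * x ^+ 2))%:E)%E = (Num.sqrt (pi / a))%:E.
Proof.
move=> a0; pose s : R := Num.sqrt ((2 * a)^-1).
have s2 : s ^+ 2 = (2 * a)^-1 by rewrite sqr_sqrtr// invr_ge0 mulr_ge0// ltW.
have s0 : 0 < s by rewrite sqrtr_gt0 invr_gt0 mulr_gt0.
have pk : s ^+ 2 * pi *+ 2 = pi / a.
  by rewrite s2 -mulr_natr; field; rewrite gt_eqF.
have pdfE x : normal_pdf 0 s x = (Num.sqrt (pi / a))^-1 * expR (- a * x ^+ 2).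
  rewrite normal_pdfE ?gt_eqF// /normal_peak /normal_fun pk subr0 s2.
  congr (_ * expR _); rewrite -mulr_natr.
  by field; rewrite gt_eqF.
have q0 : 0 < Num.sqrt (pi / a) by rewrite sqrtr_gt0 divr_gt0// pi_gt0.
have mexp : measurable_fun setT (fun x : R => expR (- a * x ^+ 2)).
  by apply: measurableT_comp => //; apply: measurable_funM => //; exact: measurable_funX.
have := integral_normal_pdf (0 : R) s.
under eq_integral do rewrite pdfE EFinM.
rewrite ge0_integralZl_EFin ?invr_ge0 ?(ltW q0)//; last exact/measurable_EFinP.
move=> /(congr1 (fun z => (Num.sqrt (pi / a))%:E * z)%E).
by rewrite muleA -EFinM divff ?gt_eqF// mul1e mule1.
Qed.

Lemma integrable_expR_sqr (a : R) : 0 < a ->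
  mu.-integrable setT (EFin \o (fun x : R => expR (- a * x ^+ 2))).
Proof.
move=> a0; apply/integrableP; split.
  by apply/measurable_EFinP; apply: measurableT_comp => //;
     apply: measurable_funM => //; exact: measurable_funX.
under eq_integral do rewrite /= ger0_norm ?expR_ge0//.
by rewrite integral_expR_sqr// ltry.
Qed.

Lemma is_derive_quotient_cvg (f : R -> R) (a l : R) : is_derive a 1 f l ->
  n.+1%:R * (f (a + n.+1%:R^-1) - f a) @[n --> \oo] --> l.
Proof.
move=> [df <-]; rewrite -derive1E; exact: derive1_quotient_cvg.
Qed.

(** Differentiation of \int exp (- a x^2) dx = sqrt (pi / a) in [a] under the
    integral sign.  The difference quotients [g n] are dominated because
    x^2 exp (- a x^2) <= (2 / a) exp (- (a / 2) x^2). *)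
Lemma integral_sqr_expR (a : R) : 0 < a ->
  (\int[mu]_x (x ^+ 2 * expR (- a * x ^+ 2))%:E)%E =
  (Num.sqrt (pi / a) / (2 * a))%:E.
Proof.
move=> a0.
pose e (h x : R) := expR (- (a + h) * x ^+ 2).
pose g (n : nat) (x : R) := n.+1%:R * (e 0 x - e n.+1%:R^-1 x).
have mexp h : measurable_fun setT (fun x : R => expR (h * x ^+ 2)).
  by apply: measurableT_comp => //; apply: measurable_funM => //; exact: measurable_funX.
have mg n : measurable_fun setT (g n).
  by apply: measurable_funM => //; apply: measurable_funB; exact: mexp.
have gcvg x : g n x @[n --> \oo] --> x ^+ 2 * expR (- a * x ^+ 2).
  have D : is_derive (0 : R) 1 (fun h => - e h x) (x ^+ 2 * expR (- a * x ^+ 2)).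
    rewrite /e; apply: is_derive_eq.
    rewrite /GRing.scale /= addr0; ring.
  apply: cvg_trans (is_derive_quotient_cvg D).
  by apply: near_eq_cvg; near=> n; rewrite /g /= add0r opprK addrC.
have gbnd n x : `|g n x| <= 2 / a * expR (- (a / 2) * x ^+ 2).
  rewrite /g /e addr0.
  have u0 : 0 <= n.+1%:R^-1 * x ^+ 2 by rewrite mulr_ge0// sqr_ge0.
  have -> : - (a + n.+1%:R^-1) * x ^+ 2 = - a * x ^+ 2 + - (n.+1%:R^-1 * x ^+ 2) by ring.
  rewrite expRD -[X in X - _]mulr1 -mulrBr.
  have h1 := expR_ge1Dx (- (n.+1%:R^-1 * x ^+ 2)).
  have h2 : expR (- (n.+1%:R^-1 * x ^+ 2)) <= 1 by rewrite expR_le1 oppr_le0.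
  have h3 := expR_ge0 (- a * x ^+ 2).
  rewrite ger0_norm; last by rewrite !mulr_ge0// subr_ge0.
  apply: (@le_trans _ _ (expR (- a * x ^+ 2) * x ^+ 2)).
    rewrite mulrCA ler_wpM2l//.
    rewrite -[leRHS](@mulVKf _ n.+1%:R) ?pnatr_eq0// ler_wpM2l//.
    by rewrite lerBlDr -lerBlDl.
  have -> : - a * x ^+ 2 = - (a / 2) * x ^+ 2 + - (a / 2 * x ^+ 2) by field.
  rewrite expRD -mulrA [leRHS]mulrC ler_wpM2l ?expR_ge0//.
  rewrite expRN mulrC ler_pdivrMr ?expR_gt0//.
  have := expR_ge1Dx (a / 2 * x ^+ 2) => h4.
  have -> : x ^+ 2 = 2 / a * (a / 2 * x ^+ 2) by field; rewrite gt_eqF.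
  rewrite ler_wpM2l ?divr_ge0 ?(ltW a0)//.
  have -> : a / 2 * (2 / a * (a / 2 * x ^+ 2)) = a / 2 * x ^+ 2.
    by field; rewrite gt_eqF.
  by apply: le_trans h4; rewrite lerDr.
have [_ _] := @dominated_convergence _ _ _ mu setT measurableT
  (fun n x => (g n x)%:E) (fun x => (x ^+ 2 * expR (- a * x ^+ 2))%:E)
  (fun x => (2 / a * expR (- (a / 2) * x ^+ 2))%:E)
  (fun n => (measurable_EFinP _ _).2 (mg n))
  ltac:(by apply/measurable_EFinP; apply: measurable_funM; [exact: measurable_funX|exact: mexp])
  ltac:(by apply: aeW => x _; apply/cvg_EFin => //; [exact: nearW|exact: gcvg])
  ltac:(by apply: integrableZl_EFin; apply: integrable_expR_sqr; rewrite divr_gt0)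
  ltac:(by apply: aeW => x n _; rewrite lee_fin; exact: gbnd).
move=> cv; rewrite -(cvg_lim _ cv)//; apply/cvg_lim => //.
pose G (h : R) := - Num.sqrt (pi / (a + h)).
have D : is_derive (0 : R) 1 G (Num.sqrt (pi / a) / (2 * a)).
  have q0 : 0 < pi / (a + 0) :> R by rewrite addr0 divr_gt0// pi_gt0.
  have Dq : is_derive (0 : R) 1 (fun h : R => pi / (a + h)) (- pi / a ^+ 2).
    have Da : is_derive (0 : R) (1 : R) (fun h : R => a + h) 1.
      apply: (@is_derive_eq _ _ _ _ _ _ _ _
        (is_deriveD (is_derive_cst a (0 : R) (1 : R)) (is_derive_id (0 : R) (1 : R)))).
      by rewrite add0r.
    have az : a + 0 != 0 :> R by rewrite addr0 gt_eqF.
    apply: (@is_derive_eq _ _ _ _ _ _ _ _ (is_deriveZ pi (is_deriveV az Da))).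
    rewrite /GRing.scale /= addr0.
    by field; rewrite gt_eqF.
  have := is_deriveN (@is_derive1_comp R Num.sqrt (fun h : R => pi / (a + h)) 0 _ _
    (is_derive1_sqrt q0) Dq).
  rewrite (_ : - _ = Num.sqrt (pi / a) / (2 * a))// addr0.
  have s0 : Num.sqrt (pi / a) != 0 :> R by rewrite gt_eqF// sqrtr_gt0 divr_gt0// pi_gt0.
  rewrite mulNr; have -> : pi / a ^+ 2 = Num.sqrt (pi / a) ^+ 2 / a :> R.
    by rewrite sqr_sqrtr ?divr_ge0 ?pi_ge0 ?ltW//; field; rewrite gt_eqF.
  by field; rewrite s0 gt_eqF.
have -> : [sequence (\int[mu]_x (g n x)%:E)%E]_n =
    EFin \o (fun n => n.+1%:R * (G (0 + n.+1%:R^-1) - G 0)).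
  apply/funext => n /=.
  rewrite /g; under eq_integral do rewrite EFinM EFinB.
  have i1 : mu.-integrable setT (EFin \o e 0).
    by apply: integrable_expR_sqr; rewrite addr0.
  have i2 : mu.-integrable setT (EFin \o e n.+1%:R^-1).
    by apply: integrable_expR_sqr; rewrite addr_gt0.
  rewrite integralZl//; last exact: integrableB.
  rewrite integralB_EFin// /e addr0 !integral_expR_sqr ?addr_gt0//.
  by rewrite /G add0r addr0 opprK [in RHS]addrC.
by apply: cvg_EFin; [exact: nearW|exact: is_derive_quotient_cvg].
Unshelve. all: by end_near. Qed.

Lemma normal_pdf_expR (s x : R) : 0 < s ->
  normal_pdf 0 s x =
  (Num.sqrt (pi / (2 * s ^+ 2)^-1))^-1 * expR (- (2 * s ^+ 2)^-1 * x ^+ 2).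
Proof.
move=> s0; rewrite normal_pdfE ?gt_eqF// /normal_peak /normal_fun subr0.
congr ((Num.sqrt _)^-1 * expR _); first by rewrite invrK -mulr_natr; ring.
by rewrite -mulr_natr; field; rewrite gt_eqF.
Qed.

Lemma integral_normal_prob_sqr (s : R) : 0 < s ->
  (\int[normal_prob 0 s]_x (x ^+ 2)%:E)%E = (s ^+ 2)%:E.
Proof.
move=> s0; rewrite ge0_integral_normal_prob; last 2 first.
- by apply/measurable_EFinP; exact: measurable_funX.
- by move=> x; rewrite lee_fin sqr_ge0.
set a := (2 * s ^+ 2)^-1.
have a0 : 0 < a by rewrite invr_gt0 mulr_gt0// exprn_gt0.
have q0 : 0 < Num.sqrt (pi / a) by rewrite sqrtr_gt0 divr_gt0// pi_gt0.
under eq_integral do rewrite normal_pdf_expR// -EFinM mulrCA EFinM.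
rewrite ge0_integralZl_EFin ?invr_ge0 ?(ltW q0)//.
- rewrite integral_sqr_expR// -EFinM mulrA mulVf ?gt_eqF// mul1r /a.
  by congr EFin; field; rewrite gt_eqF.
- by move=> x _; rewrite lee_fin mulr_ge0 ?sqr_ge0 ?expR_ge0.
- apply/measurable_EFinP; apply: measurable_funM; first exact: measurable_funX.
  by apply: measurableT_comp => //; apply: measurable_funM => //; exact: measurable_funX.
Qed.

Lemma ge0_integral_oppr (f : R -> \bar R) :
  measurable_fun setT f -> (forall x, 0 <= f x)%E ->
  (\int[mu]_x f x = \int[mu]_x f (- x)%R)%E.
Proof.
move=> mf f0.
transitivity (\int[pushforward mu (-%R : R -> measurableTypeR R)]_x f x)%E.
  by apply: eq_measure_integral => A mA _; (exact/esym/lebesgue_measureN || exact: lebesgue_measureN).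
by rewrite ge0_integral_pushforward//.
Qed.

(** Integrals against the law are known for nonnegative functions only, so the
    vanishing mean is stated as equality of the integrals of x^+ and x^-, which
    the reflection x -> - x exchanges. *)
Lemma normal_prob_odd (s : R) : 0 < s ->
  (\int[normal_prob 0 s]_x (EFin^\+ x) = \int[normal_prob 0 s]_x (EFin^\- x))%E.
Proof.
move=> s0; rewrite !ge0_integral_normal_prob//; last 2 first.
- by apply: measurable_funeneg; exact/measurable_EFinP.
- by apply: measurable_funepos; exact/measurable_EFinP.
rewrite ge0_integral_oppr; last 2 first.
- apply: emeasurable_funM; first by apply: measurable_funepos; exact/measurable_EFinP.
  by apply/measurable_EFinP; exact: measurable_normal_pdf.
- by move=> x; rewrite mule_ge0// lee_fin normal_pdf_ge0.
by apply: eq_integral => x _; rewrite funenegE funeposE !normal_pdf_expR// sqrrN.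
Qed.

End gaussian.

Section gaussian_variable.
Context {d : measure_display} {Omega : measurableType d} {R : realType}.
Variables (P : probability Omega R) (W : Omega -> R) (s : R).
Hypotheses (s0 : 0 < s) (mW : measurable_fun setT W)
  (lawW : forall C, measurable C -> P (W @^-1` C) = normal_prob 0 s C).

Lemma ge0_expectation_gaussian (f : R -> \bar R) :
  measurable_fun setT f -> (forall x, 0 <= f x)%E ->
  (\int[P]_w f (W w) = \int[normal_prob 0 s]_x f x)%E.
Proof.
move=> mf f0.
transitivity (\int[pushforward P (W : Omega -> measurableTypeR R)]_x f x)%E.
  by rewrite ge0_integral_pushforward.
by apply: eq_measure_integral => A mA _; exact: lawW.
Qed.

Lemma expectation_gaussian_sqr : (\int[P]_w ((W w) ^+ 2)%:E)%E = (s ^+ 2)%:E.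
Proof.
rewrite (ge0_expectation_gaussian (f := fun x => (x ^+ 2)%:E)).
- exact: integral_normal_prob_sqr.
- by apply/measurable_EFinP; exact: measurable_funX.
- by move=> x; rewrite lee_fin sqr_ge0.
Qed.

Lemma sq_integrable_gaussian : sq_integrable P W.
Proof. by split => //; rewrite expectation_gaussian_sqr ltry. Qed.

Lemma expectation_gaussian : (\int[P]_w (W w))%R = 0.
Proof.
have mp : measurable_fun setT (@EFin R)^\+%E by apply: measurable_funepos; exact/measurable_EFinP.
have mn : measurable_fun setT (@EFin R)^\-%E by apply: measurable_funeneg; exact/measurable_EFinP.
rewrite /Rintegral integralE.
rewrite (_ : (\int[P]_w _)%E = (\int[P]_w ((@EFin R)^\+ (W w)))%E); last first.
  by apply: eq_integral => w _; rewrite !funeposE.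
rewrite [X in (_ - X)%E](_ : _ = (\int[P]_w ((@EFin R)^\- (W w)))%E); last first.
  by apply: eq_integral => w _; rewrite !funenegE.
rewrite (ge0_expectation_gaussian mp (funepos_ge0 _)).
rewrite (ge0_expectation_gaussian mn (funeneg_ge0 _)) normal_prob_odd//.
by case: (\int[normal_prob 0 s]_x _)%E => //= r; rewrite subrr.
Qed.

End gaussian_variable.

(** * Independence of Brownian increments *)

Section independent_pair.
Context {d : measure_display} {Omega : measurableType d} {R : realType}.
Variables (P : probability Omega R) (Z W : Omega -> R).
Hypotheses (mZ : measurable_fun setT Z) (mW : measurable_fun setT W).
Hypothesis indep : forall A C : set R, measurable A -> measurable C ->
  P (Z @^-1` A `&` W @^-1` C) = (P (Z @^-1` A) * P (W @^-1` C))%E.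

Let X : {mfun Omega >-> R} := mfun_Sub (mem_set mZ).
Let Y : {mfun Omega >-> R} := mfun_Sub (mem_set mW).
Let mXY : measurable_fun setT (fun w => (X w, Y w)).
Proof. exact: measurable_fun_pair. Qed.
Let XY : {mfun Omega >-> (R * R)%type} := mfun_Sub (mem_set mXY).

Let joint_law (C : set (R * R)) : measurable C ->
  (distribution P X \x distribution P Y)%E C = distribution P XY C.
Proof.
apply: product_measure_unique => A A' mA mA'.
by rewrite /distribution /pushforward -indep.
Qed.

Lemma ge0_expectation_mul_indep (f h : R -> \bar R) :
  measurable_fun setT f -> measurable_fun setT h ->
  (forall x, 0 <= f x)%E -> (forall x, 0 <= h x)%E ->
  (\int[P]_w (f (Z w) * h (W w)) =
   \int[P]_w f (Z w) * \int[P]_w h (W w))%E.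
Proof.
move=> mf mh f0 h0.
pose F (z : R * R) := (f z.1 * h z.2)%E.
have mF : measurable_fun setT F.
  by apply: emeasurable_funM; [exact: measurableT_comp|exact: measurableT_comp].
have F0 z : (0 <= F z)%E by rewrite mule_ge0.
have -> : (\int[P]_w (f (Z w) * h (W w)) = \int[distribution P XY]_z F z)%E.
  by rewrite ge0_integral_distribution.
have -> : (\int[distribution P XY]_z F z =
    \int[(distribution P X \x distribution P Y)%E]_z F z)%E.
  by apply: eq_measure_integral => C mC _; (exact: joint_law || exact: esym (joint_law mC)).
rewrite fubini_tonelli1// /fubini_F /F /=.
under eq_integral do rewrite ge0_integralZl//.
rewrite ge0_integralZr ?integral_ge0//.
by rewrite !ge0_integral_distribution.
Qed.

Hypotheses (iZ : P.-integrable setT (EFin \o Z)) (iW : P.-integrable setT (EFin \o W)).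

Lemma integrable_mul_indep : P.-integrable setT (EFin \o (fun w => Z w * W w)).
Proof.
have mabs : measurable_fun setT (fun x : R => (`|x|)%:E).
  by apply/measurable_EFinP; exact: normr_measurable.
apply/integrableP; split; first by apply/measurable_EFinP; exact: measurable_funM.
under eq_integral do rewrite /= normrM EFinM.
rewrite (ge0_expectation_mul_indep mabs mabs)//.
have [_ fZ] := integrableP _ _ _ iZ; have [_ fW] := integrableP _ _ _ iW.
by rewrite lte_mul_pinfty ?integral_ge0 ?ge0_fin_numE ?integral_ge0//.
Qed.

(** By independence the law of the pair is the product of the laws, so Fubini
    separates the factors. *)
Lemma Rintegral_mul_indep :
  (\int[P]_w (Z w * W w))%R = (\int[P]_w (Z w))%R * (\int[P]_w (W w))%R.
Proof.
pose F (z : R * R) := (z.1 * z.2)%:E.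
have mF : measurable_fun setT F.
  by apply/measurable_EFinP; exact: measurable_funM.
have iF : (distribution P X \x distribution P Y)%E.-integrable setT F.
  apply/integrableP; split => //.
  have -> : (\int[(distribution P X \x distribution P Y)%E]_z `|F z| =
      \int[distribution P XY]_z `|F z|)%E.
    by apply: eq_measure_integral => C mC _; (exact: joint_law || exact: esym (joint_law mC)).
  rewrite ge0_integral_distribution//; last exact: measurableT_comp.
  by have [] := integrableP _ _ _ integrable_mul_indep.
have e1 : (\int[P]_w (Z w * W w)%:E = \int[distribution P XY]_z F z)%E.
  by rewrite integral_distribution//; exact: integrable_mul_indep.
have e2 : (\int[distribution P XY]_z F z =
    \int[(distribution P X \x distribution P Y)%E]_z F z)%E.
  by apply: eq_measure_integral => C mC _; (exact: joint_law || exact: esym (joint_law mC)).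
have iX : (distribution P X).-integrable setT (fun x : R => x%:E).
  by apply: integrable_pushforward => //; exact/measurable_EFinP.
have iY : (distribution P Y).-integrable setT (fun x : R => x%:E).
  by apply: integrable_pushforward => //; exact/measurable_EFinP.
have eX : (\int[distribution P X]_x x%:E = \int[P]_w (Z w)%:E)%E.
  by rewrite integral_distribution.
have eY : (\int[distribution P Y]_x x%:E = \int[P]_w (W w)%:E)%E.
  by rewrite integral_distribution.
have fY : (\int[distribution P Y]_y y%:E)%E \is a fin_num by exact: integrable_fin_num.
rewrite /Rintegral e1 e2 -integral12_prod_meas1// /fubini_F /F /=.
under eq_integral => x _.
  under eq_integral do rewrite EFinM.
  rewrite integralZl// -(fineK fY).
  over.
rewrite integralZr// fineK//; rewrite eX eY; apply: fineM.
- exact: integrable_fin_num.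
- exact: integrable_fin_num.
Qed.

End independent_pair.

Section increments.
Context {d : measure_display} {Omega : measurableType d} {R : realType}.
Variables (P : probability Omega R) (B : R -> Omega -> R).
Hypotheses (hP : measure_is_complete P) (hB : brownian_motion P B).
Local Notation Filt t := (g_sigma_algebraType (filtration_events P B t)).

(** Independence of increments is given for the raw filtration.  It extends to the
    augmented one because the events that differ by a null set from a raw event
    form a sigma-algebra containing the null sets. *)
Lemma augmentation_ae (t : R) (A : set Omega) :
  <<s filtration_events P B t >> A ->
  exists2 A', <<s past_events B t >> A' &
    P.-negligible ((A `\` A') `|` (A' `\` A)).
Proof.
pose S := [set A | exists2 A', <<s past_events B t >> A' &
    P.-negligible ((A `\` A') `|` (A' `\` A))].
suff : <<s filtration_events P B t >> `<=` S by apply.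
apply: smallest_sub.
- have [s0 sC sU] := smallest_sigma_algebra setT (past_events B t).
  split.
  + by exists set0 => //; rewrite !setDv setU0; exact: negligible_set0.
  + move=> C [C' sC' nC']; exists (setT `\` C'); first exact: sC.
    apply: negligibleS nC'; rewrite !setTD => w /= [[nC /contrapT C'w]|[nC' /contrapT Cw]].
      by right.
    by left.
  + move=> F hF.
    have [G hG] := choice (fun n => let: ex_intro2 a b c := hF n in ex_intro _ a (conj b c)).
    exists (\bigcup_i G i); first by apply: sU => i; exact: (hG i).1.
    apply: negligibleS (negligible_bigcup (fun i => (hG i).2)).
    move=> w [[[i _ Fw] nG]|[[i _ Gw] nF]]; exists i => //.
      by left; split => // Gw; apply: nG; exists i.
    by right; split => // Fw; apply: nF; exists i.
- move=> C [pC|nC].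
    by exists C; [exact: sub_sigma_algebra|rewrite !setDv setU0; exact: negligible_set0].
  exists set0; first by case: (smallest_sigma_algebra setT (past_events B t)).
  by rewrite setD0 set0D setU0.
Qed.

Lemma measure_setI_ae (A A' D : set Omega) : measurable A -> measurable A' ->
  measurable D -> P.-negligible ((A `\` A') `|` (A' `\` A)) ->
  P (A `&` D) = P (A' `&` D).
Proof.
move=> mA mA' mD [N [mN N0 sub]].
have half E E' : measurable E -> measurable E' ->
    (E `\` E') `<=` N -> (P (E `&` D) <= P (E' `&` D))%E.
  move=> mE mE' EN.
  have : E `&` D `<=` (E' `&` D) `|` N.
    move=> w [Ew Dw]; have [E'w|nE'] := pselect (E' w); first by left.
    by right; apply: EN.
  move=> sub'; apply: (@le_trans _ _ (P ((E' `&` D) `|` N))).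
    apply: le_measure => //; rewrite inE; first exact: measurableI.
    by apply: measurableU => //; exact: measurableI.
  apply: (@le_trans _ _ (P (E' `&` D) + P N)%E).
    by apply: measureU2 => //; exact: measurableI.
  by rewrite [X in (_ + X)%E]N0 adde0.
by apply/eqP; rewrite eq_le !half//= => w h; apply: sub; [right|left].
Qed.

Lemma increment_indep (s t : R) (A : set Omega) (C : set R) : 0 <= s -> s < t ->
  <<s filtration_events P B s >> A -> measurable C ->
  P (A `&` (fun w => B t w - B s w) @^-1` C) =
  (P A * P ((fun w => (B t w - B s w)%R) @^-1` C))%E.
Proof.
move=> s0 st FA mC; have [A' FA' nA] := augmentation_ae FA.
have t0 : 0 <= t by rewrite (le_trans s0)// ltW.
have mA : measurable A := filtration_sub_measurable hP hB FA.
have mA' : measurable A'.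
  apply: (filtration_sub_measurable hP hB (t := s)).
  apply: (smallest_sub _ _ FA'); first exact: smallest_sigma_algebra.
  by move=> E hE; apply: sub_sigma_algebra; left.
have mD : measurable ((fun w => B t w - B s w) @^-1` C).
  rewrite -[X in measurable X]setTI; apply: measurable_funB => //;
    exact: (bm_measurable hB).
rewrite (measure_setI_ae mA mA' mD nA) (bm_indep hB)//.
congr (_ * _)%E; have := measure_setI_ae mA mA' measurableT nA.
by rewrite !setIT.
Qed.

Lemma measurable_increment (s t : R) : 0 <= s -> 0 <= t ->
  measurable_fun setT (fun w => B t w - B s w).
Proof. by move=> s0 t0; apply: measurable_funB; exact: (bm_measurable hB). Qed.

Lemma sq_integrable_increment (s t : R) : 0 <= s -> s <= t ->
  sq_integrable P (fun w => B t w - B s w).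
Proof.
move=> s0; rewrite le_eqVlt => /predU1P[<-|st].
  under eq_fun do rewrite subrr.
  by split => //; under eq_integral do rewrite expr0n; rewrite integral0 ltry.
apply: (@sq_integrable_gaussian _ _ _ P _ (Num.sqrt (t - s))).
- by rewrite sqrtr_gt0 subr_gt0.
- by apply: measurable_increment => //; rewrite (le_trans s0)// ltW.
- exact: (bm_gaussian hB).
Qed.

End increments.

(** * Expectations of products of increments *)

Section probability_L2.
Context {d : measure_display} {Omega : measurableType d} {R : realType}.
Variable P : probability Omega R.
Implicit Types f g h : Omega -> R.

Lemma sq_integrable_bounded (K : R) f : measurable_fun setT f ->
  (forall w, `|f w| <= K) -> sq_integrable P f.
Proof.
move=> mf fK; split => //.
have K0 : 0 <= K by apply: le_trans (fK point).
apply: (@le_lt_trans _ _ (\int[P]_w (K ^+ 2)%:E)%E).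
  apply: ge0_le_integral => //=.
  - by move=> w _; rewrite lee_fin sqr_ge0.
  - by apply/measurable_EFinP; exact: measurable_funX.
  - by move=> w _; rewrite lee_fin -(real_normK (num_real (f w))) lerXn2r ?nnegrE.
by rewrite integral_cst// [X in (_ * X)%E]probability_setT mule1 ltry.
Qed.

Lemma sq_integrable_cst (k : R) : sq_integrable P (fun _ => k).
Proof. exact: (@sq_integrable_bounded `|k|). Qed.

Lemma sq_integrable_integrable f : sq_integrable P f ->
  P.-integrable setT (EFin \o f).
Proof.
move=> hf; have := sq_integrable_mul hf (sq_integrable_cst 1).
by rewrite (_ : (fun x => _) = f)//; apply/funext => w; rewrite mulr1.
Qed.

End probability_L2.

Section Rintegral_big.
Context {d : measure_display} {X : measurableType d} {R : realType}.
Variable nu : {measure set X -> \bar R}.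

Lemma Rintegral_sum (n : nat) (f : 'I_n -> X -> R) :
  (forall i, nu.-integrable setT (EFin \o f i)) ->
  nu.-integrable setT (EFin \o (fun x => \sum_(i < n) f i x)) /\
  (\int[nu]_x (\sum_(i < n) f i x))%R = \sum_(i < n) (\int[nu]_x f i x)%R.
Proof.
elim: n f => [f _|n IH f hf].
  under [X in _.-integrable _ (_ \o X)]eq_fun do rewrite big_ord0.
  under eq_Rintegral do rewrite big_ord0.
  split; first exact: integrable0.
  by rewrite big_ord0 /Rintegral integral0.
have [h1 h2] := IH (fun i => f (widen_ord (leqnSn n) i)) (fun i => hf _).
have eq : (fun x => \sum_(i < n.+1) f i x) =
    (fun x => \sum_(i < n) f (widen_ord (leqnSn n) i) x + f ord_max x).
  by apply/funext => x; rewrite big_ord_recr.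
rewrite eq; split; first exact: integrableD_EFin.
by rewrite RintegralD// h2 big_ord_recr.
Qed.

End Rintegral_big.

Section brownian_expectations.
Context {d : measure_display} {Omega : measurableType d} {R : realType}.
Variables (P : probability Omega R) (B : R -> Omega -> R).
Hypotheses (hP : measure_is_complete P) (hB : brownian_motion P B).
Local Notation Filt t := (g_sigma_algebraType (filtration_events P B t)).

Local Notation incr s t := (fun w => B t w - B s w).

Let adapted_mul (s : R) (a c : Omega -> R) :
  measurable_fun setT (a : Filt s -> R) -> measurable_fun setT (c : Filt s -> R) ->
  measurable_fun setT ((fun w => a w * c w) : Filt s -> R).
Proof. by move=> ma mc; exact: (@measurable_funM _ (Filt s)). Qed.

Lemma measurable_increment_filtration (s t u : R) : 0 <= s <= u -> 0 <= t <= u ->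
  measurable_fun setT (incr s t : Filt u -> R).
Proof.
move=> su tu; apply: (@measurable_funB _ (Filt u)).
- exact: brownian_adapted.
- exact: brownian_adapted.
Qed.

Lemma expectation_mul_increment (s t : R) (Z : Omega -> R) : 0 <= s -> s <= t ->
  sq_integrable P Z -> measurable_fun setT (Z : Filt s -> R) ->
  (\int[P]_w (Z w * (B t w - B s w)))%R = 0.
Proof.
move=> s0; rewrite le_eqVlt => /predU1P[<-|st] hZ mZ.
  by under eq_Rintegral do rewrite subrr mulr0; rewrite /Rintegral integral0.
have t0 : 0 <= t by rewrite (le_trans s0)// ltW.
have sqI := sq_integrable_increment hB s0 (ltW st).
rewrite (Rintegral_mul_indep (Z := Z) (W := incr s t)) => //.
- suff -> : (\int[P]_w (B t w - B s w))%R = 0 by rewrite mulr0.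
  apply: (@expectation_gaussian _ _ _ P _ (Num.sqrt (t - s))).
  + by rewrite sqrtr_gt0 subr_gt0.
  + by case: sqI.
  + exact: (bm_gaussian hB).
- by case: hZ.
- by case: sqI.
- move=> A C mA mC; apply: increment_indep => //.
  by rewrite -[X in <<s _ >> X]setTI; exact: mZ.
- exact: sq_integrable_integrable.
- exact: sq_integrable_integrable.
Qed.

Lemma expectation_mul_increment_sqr (s t K : R) (e : Omega -> R) :
  0 <= s -> s <= t -> measurable_fun setT (e : Filt s -> R) ->
  (forall w, `|e w| <= K) ->
  (\int[P]_w (e w * (B t w - B s w) ^+ 2))%R = (\int[P]_w (e w))%R * (t - s).
Proof.
move=> s0; rewrite le_eqVlt => /predU1P[<-|st] me eK.
  rewrite subrr mulr0.
  by under eq_Rintegral do rewrite subrr expr0n mulr0; rewrite /Rintegral integral0.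
have t0 : 0 <= t by rewrite (le_trans s0)// ltW.
have sqI := sq_integrable_increment hB s0 (ltW st).
have mI : measurable_fun setT (incr s t) by case: sqI.
have me' := filtration_measurable_fun hP hB me.
rewrite (Rintegral_mul_indep (Z := e) (W := fun w => (B t w - B s w) ^+ 2)) => //.
- congr (_ * _); rewrite /Rintegral.
  have -> : (\int[P]_w ((B t w - B s w) ^+ 2)%:E = ((Num.sqrt (t - s)) ^+ 2)%:E)%E.
    apply: (@expectation_gaussian_sqr _ _ _ P _ (Num.sqrt (t - s))) => //.
    + by rewrite sqrtr_gt0 subr_gt0.
    + exact: (bm_gaussian hB).
  by rewrite /= sqr_sqrtr// subr_ge0 ltW.
- exact: measurable_funX.
- move=> A C mA mC.
  rewrite (_ : (fun w => (B t w - B s w) ^+ 2) @^-1` C =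
    incr s t @^-1` ((fun x => x ^+ 2) @^-1` C))//.
  apply: increment_indep => //.
    by rewrite -[X in <<s _ >> X]setTI; exact: me.
  by rewrite -[X in measurable X]setTI; exact: measurable_funX.
- by apply: sq_integrable_integrable; exact: sq_integrable_bounded eK.
- exact: sq_integrableX2.
Qed.

(** The longer increment is split at the end of the shorter one: the part beyond
    it has mean zero given what precedes, which leaves the square of the shorter
    increment. *)
Lemma expectation_increments_same_start (s t t' K : R) (e : Omega -> R) :
  0 <= s -> s <= t -> s <= t' -> measurable_fun setT (e : Filt s -> R) ->
  (forall w, `|e w| <= K) ->
  (\int[P]_w (e w * (B t w - B s w) * (B t' w - B s w)))%R =
  (\int[P]_w (e w))%R * (Num.min t t' - s).
Proof.
move=> s0 st st' me eK.
wlog tt' : t t' st st' / t <= t'.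
  move=> H; have /orP[tt'|t't] := le_total t t'; first exact: H.
  by rewrite minC -H//; apply: eq_Rintegral => w _; rewrite mulrAC.
have me' := filtration_measurable_fun hP hB me.
have sqe : sq_integrable P (fun w => e w * (B t w - B s w)).
  by apply: (sq_integrableM_bounded me' eK); exact: sq_integrable_increment.
have t0 : 0 <= t by rewrite (le_trans s0).
under eq_Rintegral => w _.
  rewrite (_ : _ * _ = e w * (B t w - B s w) * (B t w - B s w) +
    e w * (B t w - B s w) * (B t' w - B t w)); last by ring.
  over.
rewrite RintegralD//; last 2 first.
- by apply: sq_integrable_mul => //; exact: sq_integrable_increment.
- by apply: sq_integrable_mul => //; exact: sq_integrable_increment.
rewrite [X in _ + X]expectation_mul_increment//; last first.
  apply: adapted_mul; first exact: filtration_measurable_funW me.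
  by apply: measurable_increment_filtration; rewrite ?s0 ?t0/=.
rewrite addr0 (min_idPl tt') -(expectation_mul_increment_sqr s0 st me eK).
by apply: eq_Rintegral => w _; rewrite expr2 mulrA.
Qed.

(** The increment that starts first is split at the start [s'] of the other one.
    What comes before [s'] is known at time [s'] and is multiplied by a centred
    independent increment; the rest is the case of a common start. *)
Lemma expectation_increments (s t s' t' K K' : R) (a c : Omega -> R) :
  0 <= s -> s <= t -> 0 <= s' -> s' <= t' ->
  measurable_fun setT (a : Filt s -> R) -> (forall w, `|a w| <= K) ->
  measurable_fun setT (c : Filt s' -> R) -> (forall w, `|c w| <= K') ->
  (\int[P]_w (a w * (B t w - B s w) * (c w * (B t' w - B s' w))))%R =
  (\int[P]_w (a w * c w))%R * Num.max 0 (Num.min t t' - Num.max s s').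
Proof.
wlog ss' : s t s' t' K K' a c / s <= s'.
  move=> H s0 st s'0 st' ma aK mc cK; have /orP[ss'|s's] := le_total s s'.
    exact: (H s t s' t' K K').
  rewrite (maxC s s') (minC t t').
  under [in RHS]eq_Rintegral do rewrite mulrC.
  rewrite -(H s' t' s t K' K)//; apply: eq_Rintegral => w _; exact: mulrC.
move=> s0 st s'0 st' ma aK mc cK; rewrite (max_idPr ss').
have mac : measurable_fun setT ((fun w => a w * c w) : Filt s' -> R).
  by apply: adapted_mul => //; exact: filtration_measurable_funW ma.
have acK w : `|a w * c w| <= K * K' by rewrite normrM ler_pM.
have mac' := filtration_measurable_fun hP hB mac.
have sqac u v : 0 <= u -> u <= v -> sq_integrable P (fun w => a w * c w * (B v w - B u w)).
  move=> u0 uv; apply: (sq_integrableM_bounded mac' acK).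
  exact: sq_integrable_increment.
have madap u v : 0 <= u -> u <= v -> v <= s' ->
    measurable_fun setT ((fun w => a w * c w * (B v w - B u w)) : Filt s' -> R).
  move=> u0 uv vs; apply: adapted_mul => //; apply: measurable_increment_filtration.
    by rewrite u0 (le_trans uv).
  by rewrite (le_trans u0 uv).
have /orP[ts'|s't] := le_total t s'.
  rewrite (max_idPl _) ?mulr0; last first.
    by rewrite subr_le0 (le_trans _ ts')// ge_min lexx.
  rewrite -[RHS](@expectation_mul_increment s' t'
    (fun w => a w * c w * (B t w - B s w)))//.
  - by apply: eq_Rintegral => w _; ring.
  - exact: sqac.
  - exact: madap.
rewrite (max_idPr _); last by rewrite subr_ge0 le_min s't.
rewrite -(@expectation_increments_same_start s' t t' (K * K'))//.
under eq_Rintegral => w _.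
  rewrite (_ : _ * _ = a w * c w * (B s' w - B s w) * (B t' w - B s' w) +
    a w * c w * (B t w - B s' w) * (B t' w - B s' w)); last by ring.
  over.
rewrite RintegralD//; last 2 first.
- by apply: sq_integrable_mul; [exact: sqac|exact: sq_integrable_increment].
- by apply: sq_integrable_mul; [exact: sqac|exact: sq_integrable_increment].
rewrite [X in X + _]expectation_mul_increment ?add0r//.
- exact: sqac.
- exact: madap.
Qed.

End brownian_expectations.

(** * Processes as functions on the product of time and events *)

Section product_integral.
Context {d1 d2 : measure_display} {X : measurableType d1} {Y : measurableType d2}
  {R : realType}.
Variables (m1 : {sigma_finite_measure set X -> \bar R})
  (m2 : {sigma_finite_measure set Y -> \bar R}).

Lemma Rintegral_prod_mul (f : X -> R) (k : Y -> R) :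
  m1.-integrable setT (EFin \o f) -> m2.-integrable setT (EFin \o k) ->
  (m1 \x m2)%E.-integrable setT (EFin \o (fun z => f z.1 * k z.2)) /\
  (\int[(m1 \x m2)%E]_z (f z.1 * k z.2))%R =
  (\int[m1]_x f x)%R * (\int[m2]_y k y)%R.
Proof.
move=> fi ki.
have mf : measurable_fun setT f by apply/measurable_EFinP; exact: measurable_int fi.
have mk : measurable_fun setT k by apply/measurable_EFinP; exact: measurable_int ki.
have mfk : measurable_fun setT (fun z : X * Y => f z.1 * k z.2).
  by apply: measurable_funM; exact: measurableT_comp.
have ifk : (m1 \x m2)%E.-integrable setT (EFin \o (fun z => f z.1 * k z.2)).
  apply/integrable12ltyP; first exact/measurable_EFinP.
  have mak : measurable_fun setT (fun y => (`|k y|)%:E).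
    by apply/measurable_EFinP; exact: measurableT_comp.
  have e x : (\int[m2]_y `|(EFin \o (fun z => (f z.1 * k z.2)%R)) (x, y)| =
      (`|f x|)%:E * \int[m2]_y (`|k y|)%:E)%E.
    rewrite -ge0_integralZl_EFin//; apply: eq_integral => y _.
    by rewrite /= normrM EFinM.
  under eq_integral do rewrite e.
  rewrite ge0_integralZr//; last 2 first.
  - by apply/measurable_EFinP; exact: measurableT_comp.
  - by apply: integral_ge0 => y _; rewrite lee_fin.
  have [_ fZ] := integrableP _ _ _ fi; have [_ fW] := integrableP _ _ _ ki.
  by rewrite lte_mul_pinfty ?integral_ge0 ?ge0_fin_numE ?integral_ge0//.
split => //; rewrite /Rintegral -integral12_prod_meas1// /fubini_F /=.
have fk : (\int[m2]_y (k y)%:E)%E \is a fin_num by exact: integrable_fin_num.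
under eq_integral => x _.
  under eq_integral do rewrite EFinM.
  rewrite integralZl// -(fineK fk).
  over.
rewrite integralZr// fineK//; apply: fineM => //.
exact: integrable_fin_num.
Qed.

End product_integral.

Section cutoff.
Context {d : measure_display} {Omega : measurableType d} {R : realType}.
Variables (P : probability Omega R).
Local Notation mu := (@lebesgue_measure R).

(** Extension by zero outside [0, T]: norms and inner products of processes
    on [0, T] become those of functions on the whole product space. *)
Definition cutoff (T : R) (h : R -> Omega -> R) (z : R * Omega) : R :=
  \1_`[0, T] z.1 * h z.1 z.2.

Lemma cutoffE (T : R) (h : R -> Omega -> R) t w : cutoff T h (t, w) = if 0 <= t <= T then h t w else 0.
Proof.
rewrite /cutoff /= indicE; case: ifPn => tT.
  by rewrite mem_set ?mul1r//= in_itv.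
by rewrite memNset ?mul0r//= in_itv; exact/negP.
Qed.

Lemma measurable_cutoff (T : R) (h : R -> Omega -> R) :
  measurable_fun (`[0, T] `*` [set: Omega]) (fun z : R * Omega => h z.1 z.2) ->
  measurable_fun setT (cutoff T h).
Proof.
move=> mh.
have mD : measurable (`[0, T] `*` [set: Omega]) by apply: measurableX.
rewrite (_ : cutoff T h = (fun z : R * Omega => h z.1 z.2) \_ (`[0, T] `*` [set: Omega])).
  by apply/(measurable_restrictT _ mD).
apply/funext => -[t w]; rewrite cutoffE /patch; case: ifPn => tT.
  by rewrite mem_set.
by rewrite memNset//= in_itv /= => -[/= tT']; rewrite tT' in tT.
Qed.

Lemma fubini_cutoff (T : R) (h : R -> Omega -> R) (f : R -> R) : f 0 = 0 ->
  (forall x, 0 <= f x) -> measurable_fun setT f ->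
  measurable_fun setT (cutoff T h) ->
  (\int[P]_w \int[mu]_(s in `[0%R, T]) (f (h s w))%:E =
   \int[(mu \x P)%E]_z (f (cutoff T h z))%:E)%E.
Proof.
move=> f0 fge0 mf mh.
have mF : measurable_fun setT (fun z => (f (cutoff T h z))%:E).
  by apply/measurable_EFinP; exact: measurableT_comp.
rewrite fubini_tonelli1//; last by move=> z; rewrite lee_fin.
rewrite fubini_tonelli//; last by move=> z; rewrite lee_fin.
apply: eq_integral => w _; rewrite integral_mkcond.
apply: eq_integral => t _; rewrite cutoffE /patch.
case: ifPn => [|nt].
  by rewrite inE /= in_itv /= => ->.
rewrite ifF ?f0//; apply/negP => tT; move/negP: nt; apply.
by rewrite inE /= in_itv.
Qed.

Lemma sqnorm_cutoff (T : R) (h : R -> Omega -> R) : measurable_fun setT (cutoff T h) ->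
  sqnorm P T h = (\int[(mu \x P)%E]_z ((cutoff T h z) ^+ 2)%:E)%E.
Proof.
move=> mh; rewrite /sqnorm (fubini_cutoff (f := fun x => x ^+ 2))//.
- by rewrite expr0n.
- by move=> x; exact: sqr_ge0.
Qed.

End cutoff.

(** * Stochastic integrals of simple processes *)

Section simple_processes.
Context {d : measure_display} {Omega : measurableType d} {R : realType}.
Variables (P : probability Omega R) (B : R -> Omega -> R).
Hypotheses (hP : measure_is_complete P) (hB : brownian_motion P B).
Local Notation Filt t := (g_sigma_algebraType (filtration_events P B t)).
Local Notation mu := (@lebesgue_measure R).
Variable T : R.
Hypothesis T0 : 0 <= T.
Implicit Types s k : simple_process P B.

Definition trunc_time s i : R := Num.min (sp_time s i) T.

(** A step that starts after [T] is set to zero since its coefficient need not be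
    known at the truncated starting time [T]. *)
Definition trunc_coef s i (w : Omega) : R :=
  if sp_time s i <= T then sp_coef s i w else 0.

Lemma sp_time_ge0i s i : 0 <= sp_time s i.
Proof. by apply: le_trans (sp_time_ge0 s) _; exact: (@sp_time_mono _ _ _ _ _ s 0 i). Qed.

Lemma trunc_time_ge0 s i : 0 <= trunc_time s i.
Proof. by rewrite /trunc_time le_min sp_time_ge0i. Qed.

Lemma trunc_time_mono s i : trunc_time s i <= trunc_time s i.+1.
Proof.
rewrite /trunc_time le_min !ge_min lexx orbT andbT.
by rewrite (@sp_time_mono _ _ _ _ _ s i i.+1).
Qed.

Lemma trunc_coef_adapted s i :
  measurable_fun setT (trunc_coef s i : Filt (trunc_time s i) -> R).
Proof.
have [tT|tT] := boolP (sp_time s i <= T).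
  rewrite /trunc_time (min_idPl tT) (_ : trunc_coef s i = sp_coef s i).
    exact: sp_adapted.
  by apply/funext => w; rewrite /trunc_coef tT.
rewrite (_ : trunc_coef s i = cst 0); first exact: measurable_cst.
by apply/funext => w; rewrite /trunc_coef (negbTE tT).
Qed.

Lemma trunc_coef_bounded s : exists K, forall i w, `|trunc_coef s i w| <= K.
Proof.
have [K hK] := sp_bounded s; exists K => i w.
have K0 : 0 <= K by apply: le_trans (hK i w).
by rewrite /trunc_coef; case: ifPn => // _; rewrite normr0.
Qed.

Lemma measurable_trunc_coef s i : measurable_fun setT (trunc_coef s i).
Proof. exact: (filtration_measurable_fun hP hB (@trunc_coef_adapted s i)). Qed.

Lemma simple_integral_trunc s w : simple_integral s T w =
  \sum_(i < sp_size s) trunc_coef s i w *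
    (B (trunc_time s i.+1) w - B (trunc_time s i) w).
Proof.
apply: eq_bigr => i _; rewrite /trunc_coef /trunc_time; case: ifPn => // /negP tT.
have tT' : T <= sp_time s i by case/orP: (le_total (sp_time s i) T).
rewrite mul0r (min_idPr tT') (min_idPr _) ?subrr ?mulr0//.
by apply: le_trans tT' _; exact: (@sp_time_mono _ _ _ _ _ s i i.+1).
Qed.

Lemma simple_value_trunc s z : cutoff T (simple_value s) z =
  \sum_(i < sp_size s) \1_(`]trunc_time s i, trunc_time s i.+1]) z.1 * trunc_coef s i z.2.
Proof.
case: z => t w; rewrite /cutoff /= /simple_value mulr_sumr.
apply: eq_bigr => i _; rewrite mulrCA mulrC [in RHS]mulrC /trunc_coef.
have ti0 := sp_time_ge0i s i; rewrite /trunc_time.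
rewrite !indicE.
have -> : (t \in `[0, T]%classic) = (0 <= t <= T).
  by apply/idP/idP; rewrite inE /= in_itv.
have inE' (a b : R) : (t \in `]a, b]%classic) = (a < t <= b).
  by apply/idP/idP; rewrite inE /= in_itv.
rewrite !inE'.
case: (boolP (0 <= t <= T)) => [/andP[t0 tT]|]; rewrite ?mul1r ?mul0r.
  have [Tt|Tt] := boolP (sp_time s i <= T).
    by rewrite (min_idPl Tt) le_min tT andbT mulrC.
  rewrite mul0r (_ : (sp_time s i < t) = false) /= ?mul0r//.
  by apply/negbTE; rewrite -leNgt (le_trans tT)// ltW// ltNge.
rewrite negb_and -!ltNge => /orP[t0|tT].
  rewrite (_ : (_ < t) = false) ?mulr0//=; last first.
  by apply/negbTE; rewrite -leNgt (le_trans (ltW t0))// le_min ti0.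
by rewrite [X in _ && X]le_min (leNgt t T) tT /= !andbF mulr0.
Qed.

End simple_processes.

Section product_L2.
Context {d1 d2 : measure_display} {X : measurableType d1} {Y : measurableType d2}
  {R : realType}.
Variables (m1 : {sigma_finite_measure set X -> \bar R})
  (m2 : {sigma_finite_measure set Y -> \bar R}).

Lemma sq_integrable_prod (f : X -> R) (k : Y -> R) :
  sq_integrable m1 f -> sq_integrable m2 k ->
  sq_integrable (m1 \x m2)%E (fun z => f z.1 * k z.2).
Proof.
move=> hf hk; have [mf _] := hf; have [mk _] := hk; split.
  by apply: measurable_funM; exact: measurableT_comp.
have [ifk _] := Rintegral_prod_mul (sq_integrableX2 hf) (sq_integrableX2 hk).
under eq_integral do rewrite exprMn.
exact: integrable_lty.
Qed.

End product_L2.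

Lemma sq_integrable_indic_itv (R : realType) (a b : R) (b0 b1 : bool) :
  sq_integrable (@lebesgue_measure R) (\1_[set` Interval (BSide b0 a) (BSide b1 b)] : R -> R).
Proof.
split; first exact: measurable_indic.
under eq_integral => x _.
  rewrite (_ : _ ^+ 2 = \1_[set` Interval (BSide b0 a) (BSide b1 b)] x); last first.
    by rewrite indicE; case: (_ \in _); rewrite ?expr1n ?expr0n.
  over.
have h := @integrable_indic_itv R a b b0 b1.
exact: (integrable_lty _ h).
Qed.

Lemma Rintegral_indic_setI_itv (R : realType) (s t s' t' : R) :
  (\int[@lebesgue_measure R]_x (\1_(`]s, t]) x * \1_(`]s', t']) x))%R =
  Num.max 0 (Num.min t t' - Num.max s s').
Proof.
under eq_Rintegral => x _.
  rewrite (_ : _ * _ = \1_(`]Num.max s s', Num.min t t']) x); last first.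
    rewrite -[LHS]/((\1_(`]s, t]) \* \1_(`]s', t'])) x) -indicI.
    congr (\1__ x); apply/seteqP; split => z /=; rewrite !in_itv/= gt_max le_min.
      by move=> [/andP[-> ->] /andP[-> ->]].
    by move=> /andP[/andP[-> ->] /andP[-> ->]].
  over.
rewrite /Rintegral integral_indic// setIT.
have := lebesgue_measure_itv `](Num.max s s'), (Num.min t t')]%R.
rewrite /= lte_fin => ->.
have [h|h] := ltP (Num.max s s') (Num.min t t').
  have h0 : 0 <= Num.min t t' - Num.max s s' by rewrite subr_ge0 ltW.
  by rewrite -EFinB /= (max_idPr h0).
have h0 : Num.min t t' - Num.max s s' <= 0 by rewrite subr_le0.
by rewrite /= (max_idPl h0).
Qed.

Section simple_isometry.
Context {d : measure_display} {Omega : measurableType d} {R : realType}.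
Variables (P : probability Omega R) (B : R -> Omega -> R).
Hypotheses (hP : measure_is_complete P) (hB : brownian_motion P B).
Local Notation Filt t := (g_sigma_algebraType (filtration_events P B t)).
Local Notation mu := (@lebesgue_measure R).
Implicit Types s k : simple_process P B.

Lemma sq_integrable_trunc_coef (T : R) s i : sq_integrable P (trunc_coef T s i).
Proof.
have [K hK] := trunc_coef_bounded T s.
apply: (@sq_integrable_bounded _ _ _ _ K _ _ (hK i)).
exact: (@measurable_trunc_coef _ _ _ _ _ hP hB T s i).
Qed.

Let sqv (T : R) s i : sq_integrable (mu \x P)%E
  (fun z => \1_(`]trunc_time T s i, trunc_time T s i.+1]) z.1 * trunc_coef T s i z.2).
Proof.
apply: sq_integrable_prod; first exact: sq_integrable_indic_itv.
exact: sq_integrable_trunc_coef.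
Qed.

Let sqt (T : R) s i : 0 <= T -> sq_integrable P
  (fun w => trunc_coef T s i w * (B (trunc_time T s i.+1) w - B (trunc_time T s i) w)).
Proof.
move=> T0; have [K hK] := trunc_coef_bounded T s.
apply: (sq_integrableM_bounded (@measurable_trunc_coef _ _ _ _ _ hP hB T s i) (hK i)).
by apply: (sq_integrable_increment hB); [exact: trunc_time_ge0|exact: trunc_time_mono].
Qed.

Lemma sq_integrable_simple_value (T : R) s : 0 <= T ->
  sq_integrable (mu \x P)%E (cutoff T (simple_value s)).
Proof.
move=> T0; rewrite (funext (simple_value_trunc T0 s)).
by apply: sq_integrable_sum => i; exact: sqv.
Qed.

Lemma sq_integrable_simple_integral (T : R) s : 0 <= T ->
  sq_integrable P (simple_integral s T).
Proof.
move=> T0; rewrite (funext (simple_integral_trunc T s)).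
by apply: sq_integrable_sum => i; exact: sqt.
Qed.

(** Expanding both sides into double sums, each term is the expectation of the
    product of two coefficients times the length of the overlap of two steps. *)
Lemma simple_isometry (T : R) s k : 0 <= T ->
  (\int[P]_w (simple_integral s T w * simple_integral k T w))%R =
  (\int[(mu \x P)%E]_z (cutoff T (simple_value s) z * cutoff T (simple_value k) z))%R.
Proof.
move=> T0; have [K hK] := trunc_coef_bounded T s; have [K' hK'] := trunc_coef_bounded T k.
under eq_Rintegral do rewrite (simple_integral_trunc T s) (simple_integral_trunc T k) mulr_suml.
rewrite (Rintegral_sum _).2; last first.
  move=> i; apply: sq_integrable_mul; first exact: sqt.
  by apply: sq_integrable_sum => j; exact: sqt.
under [in RHS]eq_Rintegral do rewrite !simple_value_trunc// mulr_suml.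
rewrite [in RHS](Rintegral_sum _).2; last first.
  move=> i; apply: sq_integrable_mul; first exact: sqv.
  by apply: sq_integrable_sum => j; exact: sqv.
apply: eq_bigr => i _.
under eq_Rintegral do rewrite mulr_sumr.
rewrite (Rintegral_sum _).2; last by move=> j; apply: sq_integrable_mul; exact: sqt.
under [in RHS]eq_Rintegral do rewrite mulr_sumr.
rewrite [in RHS](Rintegral_sum _).2; last by move=> j; apply: sq_integrable_mul; exact: sqv.
apply: eq_bigr => j _.
rewrite (expectation_increments hP hB _ _ _ _ (@trunc_coef_adapted _ _ _ _ _ T s i) (hK i)
  (@trunc_coef_adapted _ _ _ _ _ T k j) (hK' j)); last 4 first.
- exact: trunc_time_ge0.
- exact: trunc_time_mono.
- exact: trunc_time_ge0.
- exact: trunc_time_mono.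
rewrite -Rintegral_indic_setI_itv mulrC.
rewrite -(Rintegral_prod_mul _ _).2; last 2 first.
- by apply: sq_integrable_mul; exact: sq_integrable_indic_itv.
- by apply: sq_integrable_mul; exact: sq_integrable_trunc_coef.
by apply: eq_Rintegral => z _; ring.
Qed.

(** Of each step only the part between max (t, t_i) and min (t_{i+1}, T)
    contributes to the difference.  Its coefficient and [Z] are both known
    at its left end, so the increment is independent of them and centred. *)
Lemma simple_martingale (t T : R) s (Z : Omega -> R) : 0 <= t <= T ->
  sq_integrable P Z -> measurable_fun setT (Z : Filt t -> R) ->
  (\int[P]_w (simple_integral s T w * Z w))%R =
  (\int[P]_w (simple_integral s t w * Z w))%R.
Proof.
move=> /andP[t0 tT] hZ mZ; have T0 : 0 <= T by apply: le_trans tT.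
apply/eqP; rewrite -subr_eq0 -RintegralB//; last 2 first.
- by apply: sq_integrable_mul => //; exact: sq_integrable_simple_integral.
- by apply: sq_integrable_mul => //; exact: sq_integrable_simple_integral.
pose I r i w := B (Num.min (sp_time s i.+1) r) w - B (Num.min (sp_time s i) r) w.
under eq_Rintegral => w _.
  rewrite (_ : _ - _ = \sum_(i < sp_size s) (Z w * sp_coef s i w) * (I T i w - I t i w)); last first.
    rewrite -mulrBl /simple_integral -sumrB mulr_suml.
    by apply: eq_bigr => i _; rewrite /I; ring.
  over.
have [K hK] := sp_bounded s.
have st0 i : 0 <= sp_time s i by exact: sp_time_ge0i.
have stm i : sp_time s i <= sp_time s i.+1 by exact: (@sp_time_mono _ _ _ _ _ s i i.+1).
have mc i : measurable_fun setT (sp_coef s i).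
  by apply: (filtration_measurable_fun hP hB); exact: sp_adapted.
have sqI r i : 0 <= r -> sq_integrable P (I r i).
  move=> r0; apply: (sq_integrable_increment hB); first by rewrite le_min st0.
  by rewrite le_min !ge_min lexx orbT andbT stm.
have sqZ i : sq_integrable P (fun w => Z w * sp_coef s i w).
  under eq_fun do rewrite mulrC.
  exact: (sq_integrableM_bounded (mc i) (hK i)).
rewrite (Rintegral_sum _).2; last first.
  by move=> i; apply: sq_integrable_mul => //; apply: sq_integrableB; exact: sqI.
apply/eqP; apply: big1 => i _.
have zero : (forall w, I T i w = I t i w) ->
    (\int[P]_w (Z w * sp_coef s i w * (I T i w - I t i w)))%R = 0.
  move=> e; under eq_Rintegral do rewrite e subrr mulr0.
  by rewrite /Rintegral integral0.
have mZc u : t <= u -> sp_time s i <= u ->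
    measurable_fun setT ((fun w => Z w * sp_coef s i w) : Filt u -> R).
  move=> tu su; apply: (@measurable_funM _ (Filt u)).
    exact: filtration_measurable_funW mZ.
  by apply: (filtration_measurable_funW su); exact: sp_adapted.
have [sit|tsi] := boolP (sp_time s i.+1 <= t).
  have sit' := le_trans (stm i) sit.
  apply: zero => w; rewrite /I (min_idPl sit) (min_idPl sit').
  by rewrite (min_idPl (le_trans sit tT)) (min_idPl (le_trans sit' tT)).
rewrite -ltNge in tsi.
have [siT|Tsi] := boolP (sp_time s i <= T); last first.
  rewrite -ltNge in Tsi.
  apply: zero => w; have siT' := ltW Tsi.
  have siT2 := le_trans siT' (stm i).
  rewrite /I (min_idPr siT') (min_idPr siT2) (min_idPr (le_trans tT siT')).
  by rewrite (min_idPr (le_trans tT siT2)) !subrr.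
pose u := Num.max t (sp_time s i); pose v := Num.min (sp_time s i.+1) T.
have mZu : measurable_fun setT ((fun w => Z w * sp_coef s i w) : Filt u -> R).
  by apply: mZc; rewrite /u le_max lexx ?orbT.
have u0 : 0 <= u by rewrite le_max t0.
have uv : u <= v by rewrite /u /v ge_max !le_min (ltW tsi) tT stm siT.
rewrite -[RHS](expectation_mul_increment hP hB u0 uv (sqZ i) mZu).
apply: eq_Rintegral => w _; congr (_ * _).
rewrite /I /v /u (min_idPl siT) (min_idPr (ltW tsi)).
have /orP[h|h] := le_total t (sp_time s i).
  by rewrite (max_idPr h) (min_idPr h); ring.
by rewrite (max_idPl h) (min_idPl h); ring.
Qed.

End simple_isometry.

(** * Martingale property and isometry of the Ito integral *)

Section ito_integral_theory.
Context {d : measure_display} {Omega : measurableType d} {R : realType}.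
Variables (P : probability Omega R) (B : R -> Omega -> R).
Hypotheses (hP : measure_is_complete P) (hB : brownian_motion P B).
Local Notation Filt t := (g_sigma_algebraType (filtration_events P B t)).
Local Notation mu := (@lebesgue_measure R).
Variable S : R.
Hypothesis S0 : 0 <= S.
Implicit Types (h k M N : R -> Omega -> R).

Lemma progressive_measurable_cutoff h : progressive P B S h ->
  measurable_fun setT (cutoff S h).
Proof. by move=> /(progressive_measurable hP hB S0); exact: measurable_cutoff. Qed.

Lemma square_integrable_cutoff h : square_integrable P B S h ->
  sq_integrable (mu \x P)%E (cutoff S h).
Proof.
move=> [ph hh]; have mh := progressive_measurable_cutoff ph.
by split => //; rewrite -sqnorm_cutoff.
Qed.

Lemma ito_integrand_sq_integrable h M : ito_integral P B S h M ->
  sq_integrable (mu \x P)%E (cutoff S h).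
Proof. by case=> + _ _ _; exact: square_integrable_cutoff. Qed.

Lemma ito_measurable h M t : ito_integral P B S h M -> 0 <= t <= S ->
  measurable_fun setT (M t).
Proof.
move=> [_ pM _ _] tS; apply: (filtration_measurable_fun hP hB (t := t)).
exact: progressive_adapted pM tS.
Qed.

Lemma ito_sq_integrable h M t : ito_integral P B S h M -> 0 <= t <= S ->
  sq_integrable P (M t).
Proof.
move=> itoM tS; have mM := ito_measurable itoM tS.
have [_ _ _ [hn [_ /(_ _ tS) cv]]] := itoM.
have [n _ fin] : exists2 n, (n >= 0)%N &
    (\int[P]_w ((simple_integral (hn n) t w - M t w) ^+ 2)%:E)%E \is a fin_num.
  have [N _ hN] := fcvg_is_fine cv.
  by exists N => //; apply: (hN N) => /=.
have t0 : 0 <= t by case/andP: tS.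
have sqI := sq_integrable_simple_integral hP hB (hn n) t0.
rewrite (_ : M t = fun w => simple_integral (hn n) t w - (simple_integral (hn n) t w - M t w)).
  apply: sq_integrableB => //; split; first by apply: measurable_funB => //; case: sqI.
  by rewrite ltey_eq fin.
by apply/funext => w; rewrite opprB addrC subrK.
Qed.

(** Mean square convergence is weakened to convergence against each fixed
    square-integrable function, a form in which both the isometry and the
    martingale property pass to the limit. *)
Lemma ito_approx h M : ito_integral P B S h M ->
  exists hn : nat -> simple_process P B,
   (forall g, sq_integrable (mu \x P)%E g ->
     (\int[(mu \x P)%E]_z (cutoff S (simple_value (hn n)) z * g z))%R
       @[n --> \oo] --> (\int[(mu \x P)%E]_z (cutoff S h z * g z))%R) /\
   (forall t, 0 <= t <= S -> forall Z, sq_integrable P Z ->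
     (\int[P]_w (simple_integral (hn n) t w * Z w))%R
       @[n --> \oo] --> (\int[P]_w (M t w * Z w))%R).
Proof.
move=> itoM; have sqh := ito_integrand_sq_integrable itoM.
have [_ _ _ [hn [cvh cvM]]] := itoM; exists hn; split.
- move=> g hg; apply: cvg_Rintegral_mul => //.
    by move=> n; exact: sq_integrable_simple_value.
  apply: cvg_trans cvh; apply: near_eq_cvg; near=> n.
  have sqn := sq_integrable_simple_value hP hB (hn n) S0.
  have e z : cutoff S (simple_value (hn n)) z - cutoff S h z =
      cutoff S (fun t w => simple_value (hn n) t w - h t w) z.
    by rewrite /cutoff mulrBr.
  rewrite sqnorm_cutoff; last first.
    rewrite -(funext e); apply: measurable_funB; first by case: sqn.
    by case: sqh.
  by apply: eq_integral => z _; rewrite e.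
- move=> t tS Z hZ; have t0 : 0 <= t by case/andP: tS.
  apply: cvg_Rintegral_mul => //.
  + by move=> n; exact: sq_integrable_simple_integral.
  + exact: ito_sq_integrable itoM tS.
  + exact: cvM.
Unshelve. all: by end_near. Qed.

Lemma ito_martingale h M t (Z : Omega -> R) : ito_integral P B S h M ->
  0 <= t <= S -> sq_integrable P Z -> measurable_fun setT (Z : Filt t -> R) ->
  (\int[P]_w (M S w * Z w))%R = (\int[P]_w (M t w * Z w))%R.
Proof.
move=> itoM tS hZ mZ; have [hn [_ cv]] := ito_approx itoM.
have cvS := cv S _ Z hZ; rewrite S0 lexx in cvS; have {}cvS := cvS isT.
have := cv t tS Z hZ.
under eq_fun do rewrite -(simple_martingale hP hB (hn _) tS hZ mZ).
by move=> cvt; rewrite -(cvg_lim _ cvS)// -(cvg_lim _ cvt).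
Qed.

(** The limit is taken in one factor at a time, so that weak convergence is
    enough. *)
Lemma ito_isometry h M k N : ito_integral P B S h M -> ito_integral P B S k N ->
  (\int[P]_w (M S w * N S w))%R =
  (\int[(mu \x P)%E]_z (cutoff S h z * cutoff S k z))%R.
Proof.
move=> itoM itoN; have SS : 0 <= S <= S by rewrite S0 lexx.
have [hn [cvh cvM]] := ito_approx itoM; have [kn [cvk cvN]] := ito_approx itoN.
have half n : (\int[P]_w (M S w * simple_integral (kn n) S w))%R =
    (\int[(mu \x P)%E]_z (cutoff S h z * cutoff S (simple_value (kn n)) z))%R.
  have c1 := cvM S SS _ (sq_integrable_simple_integral hP hB (kn n) S0).
  have c2 := cvh _ (sq_integrable_simple_value hP hB (kn n) S0).
  move: c1; under eq_fun do rewrite simple_isometry//.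
  by move=> c1; rewrite -(cvg_lim _ c1)// -(cvg_lim _ c2).
have c1 := cvN S SS _ (ito_sq_integrable itoM SS).
have c2 := cvk _ (ito_integrand_sq_integrable itoM).
under eq_Rintegral do rewrite mulrC.
under [in RHS]eq_Rintegral do rewrite mulrC.
rewrite -(cvg_lim _ c1)// -(cvg_lim _ c2)//; congr (limn _).
apply/funext => n; under eq_Rintegral do rewrite mulrC.
by rewrite half; apply: eq_Rintegral => z _; rewrite mulrC.
Qed.

(** Simple integrals vanish at time 0; the limit is determined up to null sets
    only, hence the formulation against a test variable. *)
Lemma ito_start h M (Z : Omega -> R) : ito_integral P B S h M ->
  sq_integrable P Z -> (\int[P]_w (M 0 w * Z w))%R = 0.
Proof.
move=> itoM hZ; have [hn [_ cv]] := ito_approx itoM.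
have S00 : 0 <= (0 : R) <= S by rewrite lexx S0.
have c1 := cv 0 S00 Z hZ; rewrite -(cvg_lim _ c1)//.
have -> : (fun n => (\int[P]_w (simple_integral (hn n) 0 w * Z w))%R) = cst 0.
  apply/funext => n; rewrite -[RHS](_ : (\int[P]_w (0 : R))%R = 0); last first.
    by rewrite /Rintegral integral0.
  apply: eq_Rintegral => w _.
  rewrite /simple_integral big1 ?mul0r// => i _.
  by rewrite !(min_idPr (sp_time_ge0i _ _)) subrr mulr0.
exact: lim_cst.
Qed.

End ito_integral_theory.

(** * Fubini for real-valued integrals *)

Lemma ae_eq_integrable {d : measure_display} {X : measurableType d} {R : realType}
    (nu : {measure set X -> \bar R}) (f g : X -> \bar R) :
  nu.-integrable setT f -> measurable_fun setT g ->
  {ae nu, forall x, f x = g x} -> nu.-integrable setT g.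
Proof.
move=> fi mg fg; have mf := measurable_int _ fi; have [_ fi'] := integrableP _ _ _ fi.
apply/integrableP; split => //; rewrite (_ : (\int[nu]_x _ = \int[nu]_x `|f x|)%E)//.
apply: ae_eq_integral => //; try exact: measurableT_comp.
by apply: filterS fg => x -> _.
Qed.

Lemma ae_product2 {d1 d2 : measure_display} {X : measurableType d1}
    {Y : measurableType d2} {R : realType}
    (m1 : {sigma_finite_measure set X -> \bar R})
    (m2 : {sigma_finite_measure set Y -> \bar R}) (Q : Y -> Prop) :
  {ae m2, forall y, Q y} -> {ae (m1 \x m2)%E, forall z, Q z.2}.
Proof.
move=> [N [mN N0 sub]]; exists (setT `*` N); split.
- exact: measurableX.
- by rewrite /= product_measure1E// N0 mule0.
- by move=> z /= nQ; split => //; exact: sub.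
Qed.

Lemma ae_eq_Rintegral {d : measure_display} {X : measurableType d} {R : realType}
    (nu : {measure set X -> \bar R}) (f g : X -> R) :
  nu.-integrable setT (EFin \o f) -> nu.-integrable setT (EFin \o g) ->
  {ae nu, forall x, f x = g x} ->
  (\int[nu]_x f x)%R = (\int[nu]_x g x)%R.
Proof.
move=> fi gi fg; congr fine; apply: ae_eq_integral => //.
- exact: measurable_int fi.
- exact: measurable_int gi.
- by apply: filterS fg => x -> _.
Qed.

Section Rintegral_fubini.
Context {d1 d2 : measure_display} {X : measurableType d1} {Y : measurableType d2}
  {R : realType}.
Variables (m1 : {sigma_finite_measure set X -> \bar R})
  (m2 : {sigma_finite_measure set Y -> \bar R}).
Implicit Types f g : X * Y -> R.

Lemma measurable_Rintegral2 f : measurable_fun setT f ->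
  measurable_fun setT (fun x => (\int[m2]_y f (x, y))%R).
Proof.
move=> mf; apply: measurableT_comp; first exact: fine_measurable.
have mf' : measurable_fun setT (EFin \o f) by exact/measurable_EFinP.
rewrite (_ : (fun x => _) = (fun x => \int[m2]_y (EFin \o f)^\+ (x, y) -
    \int[m2]_y (EFin \o f)^\- (x, y))%E).
  apply: emeasurable_funB.
  - apply: measurable_fun_fubini_tonelli_F => //; exact: measurable_funepos.
  - apply: measurable_fun_fubini_tonelli_F => //; exact: measurable_funeneg.
apply/funext => x; rewrite integralE; congr (_ - _)%E.
- by apply: eq_integral => y _; rewrite !funeposE.
- by apply: eq_integral => y _; rewrite !funenegE.
Qed.

Lemma measurable_integral1 f : measurable_fun setT f ->
  measurable_fun setT (fun y => \int[m1]_x (f (x, y))%:E)%E.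
Proof.
move=> mf; have mf' : measurable_fun setT (EFin \o f) by exact/measurable_EFinP.
rewrite (_ : (fun y => _) = (fun y => \int[m1]_x (EFin \o f)^\+ (x, y) -
    \int[m1]_x (EFin \o f)^\- (x, y))%E).
  apply: emeasurable_funB.
  - apply: measurable_fun_fubini_tonelli_G => //; exact: measurable_funepos.
  - apply: measurable_fun_fubini_tonelli_G => //; exact: measurable_funeneg.
apply/funext => y; rewrite integralE; congr (_ - _)%E.
- by apply: eq_integral => x _; rewrite !funeposE.
- by apply: eq_integral => x _; rewrite !funenegE.
Qed.

Lemma measurable_Rintegral1 f : measurable_fun setT f ->
  measurable_fun setT (fun y => (\int[m1]_x f (x, y))%R).
Proof.
move=> mf; apply: measurableT_comp; first exact: fine_measurable.
exact: measurable_integral1.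
Qed.

(** By Tonelli the set where the bound fails is null for the product measure,
    because its sections at fixed [x] are null; so almost all its sections at
    fixed [y] are null. *)
Lemma ae_swap_le f g : measurable_fun setT f -> measurable_fun setT g ->
  (forall x, {ae m2, forall y, f (x, y) <= g (x, y)}) ->
  {ae m2, forall y, {ae m1, forall x, f (x, y) <= g (x, y)}}.
Proof.
move=> mf mg fg; pose N := [set z | g z < f z].
have mN : measurable N.
  rewrite (_ : N = setT `&` (fun z => g z < f z) @^-1` [set true]).
    exact: (measurable_fun_ltr mg mf).
  by rewrite setTI; apply/seteqP; split.
have m1N : measurable_fun setT (fun z => (\1_N z : R)%:E).
  by apply/measurable_EFinP; exact: measurable_indic.
have N0 z : (0 <= (\1_N z : R)%:E)%E by rewrite lee_fin indicE.
have zero : (\int[m2]_y \int[m1]_x (\1_N (x, y) : R)%:E = 0)%E.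
  rewrite -(fubini_tonelli (fun z => (\1_N z : R)%:E))//.
  rewrite integral0_eq// => x _; rewrite /fubini_F.
  rewrite -[RHS](integral0 m2 setT).
  apply: ae_eq_integral => //.
  - exact: (measurableT_comp m1N (pair1_measurable x)).
  - apply: filterS (fg x) => y le _; rewrite indicE memNset//= => lt.
    by move: lt; rewrite /N /= ltNge le.
have mG := measurable_fun_fubini_tonelli_G _ m1N N0 (m1 := m1).
have : ae_eq m2 setT (fun y => \int[m1]_x (\1_N (x, y) : R)%:E)%E (cst 0%E).
  apply/(ae_eq_integral_abs m2 measurableT mG).
  by under eq_integral do rewrite gee0_abs ?integral_ge0//.
apply: filterS => y /(_ I) /= y0.
have my : measurable_fun setT (fun x => (\1_N (x, y) : R)%:E).
  exact: (measurableT_comp m1N (pair2_measurable y)).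
have : ae_eq m1 setT (fun x => (\1_N (x, y) : R)%:E)%E (cst 0%E).
  apply/(ae_eq_integral_abs m1 measurableT my).
  by under eq_integral do rewrite gee0_abs//.
apply: filterS => x /(_ I) [] /=; rewrite indicE leNgt.
case: (boolP (_ < _)) => // lt.
by rewrite mem_set// => /eqP; rewrite oner_eq0.
Qed.

Lemma Rintegral12 f : (m1 \x m2)%E.-integrable setT (EFin \o f) ->
  m1.-integrable setT (EFin \o (fun x => (\int[m2]_y f (x, y))%R)) /\
  (\int[(m1 \x m2)%E]_z f z)%R = (\int[m1]_x (\int[m2]_y f (x, y))%R)%R.
Proof.
move=> fi.
have mf : measurable_fun setT f by apply/measurable_EFinP; exact: measurable_int fi.
have iF := integrable_fubini_F fi.
have ae : {ae m1, forall x, fubini_F m2 (EFin \o f) x =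
    ((\int[m2]_y f (x, y))%R)%:E}.
  apply: filterS (ae_integrable1 fi) => x ix.
  by rewrite /Rintegral fineK//; exact: integrable_fin_num.
have iR : m1.-integrable setT (EFin \o (fun x => (\int[m2]_y f (x, y))%R)).
  apply: ae_eq_integrable iF _ ae; apply/measurable_EFinP.
  exact: measurable_Rintegral2.
split => //; rewrite {1 2}/Rintegral -(integral12_prod_meas1 fi); congr fine.
apply: ae_eq_integral => //; [exact: measurable_int iF|exact: measurable_int iR|].
by apply: filterS ae => x -> _.
Qed.

Lemma Rintegral21 f : (m1 \x m2)%E.-integrable setT (EFin \o f) ->
  m2.-integrable setT (EFin \o (fun y => (\int[m1]_x f (x, y))%R)) /\
  (\int[(m1 \x m2)%E]_z f z)%R = (\int[m2]_y (\int[m1]_x f (x, y))%R)%R.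
Proof.
move=> fi.
have mf : measurable_fun setT f by apply/measurable_EFinP; exact: measurable_int fi.
have fi' : (m2 \x m1)%E.-integrable setT (EFin \o (fun z : Y * X => f (z.2, z.1))).
  apply/integrable12ltyP; last exact: (integrable21ltyP m1 m2 (measurable_int _ fi)).1 fi.
  by apply/measurable_EFinP; apply: measurableT_comp => //; exact: measurable_fun_pair.
have iG := integrable_fubini_F fi'.
have ae : {ae m2, forall y, fubini_G m1 (EFin \o f) y =
    ((\int[m1]_x f (x, y))%R)%:E}.
  apply: filterS (ae_integrable2 fi) => y iy.
  by rewrite /Rintegral fineK//; exact: integrable_fin_num.
have iR : m2.-integrable setT (EFin \o (fun y => (\int[m1]_x f (x, y))%R)).
  apply: ae_eq_integrable iG _ ae; apply/measurable_EFinP.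
  exact: measurable_Rintegral1.
split => //; rewrite {1 2}/Rintegral -(integral21_prod_meas1 fi); congr fine.
apply: ae_eq_integral => //; [exact: measurable_int iG|exact: measurable_int iR|].
by apply: filterS ae => x -> _.
Qed.

Lemma ae_sq_integrable1 f : sq_integrable (m1 \x m2)%E f ->
  {ae m2, forall y, sq_integrable m1 (fun x => f (x, y))}.
Proof.
move=> hf; have [mf _] := hf.
apply: filterS (ae_integrable2 (sq_integrableX2 hf)) => y iy; split.
  by apply: measurableT_comp => //; exact: pair2_measurable.
exact: integrable_lty iy.
Qed.

Lemma ae_sq_integrable2 f : sq_integrable (m1 \x m2)%E f ->
  {ae m1, forall x, sq_integrable m2 (fun y => f (x, y))}.
Proof.
move=> hf; have [mf _] := hf.
apply: filterS (ae_integrable1 (sq_integrableX2 hf)) => x ix; split.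
  by apply: measurableT_comp => //; exact: pair1_measurable.
exact: integrable_lty ix.
Qed.

(** Cauchy-Schwarz at fixed [y], then integration in [y]. *)
Lemma sq_integrable_Rintegral1 (e : X -> R) f :
  sq_integrable m1 e -> sq_integrable (m1 \x m2)%E f ->
  sq_integrable m2 (fun y => (\int[m1]_x (e x * f (x, y)))%R).
Proof.
move=> he hf; have [me _] := he; have [mf _] := hf.
have mF : measurable_fun setT (fun y => (\int[m1]_x (e x * f (x, y)))%R).
  apply: (@measurable_Rintegral1 (fun z => e z.1 * f z)).
  by apply: measurable_funM => //; exact: measurableT_comp.
split => //; have [iQ _] := Rintegral21 (sq_integrableX2 hf).
pose c := (\int[m1]_x (e x ^+ 2))%R.
have c0 : 0 <= c by apply: Rintegral_ge0 => x _; exact: sqr_ge0.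
apply: (@le_lt_trans _ _ (\int[m2]_y (c * (\int[m1]_x (f (x, y) ^+ 2))%R)%:E)%E).
  have [_ mQ] := (integrableZl_EFin c iQ, measurable_int _ (integrableZl_EFin c iQ)).
  apply: ae_ge0_le_integral => //.
  - by move=> y _; rewrite lee_fin sqr_ge0.
  - by apply/measurable_EFinP; exact: measurable_funX.
  - move=> y _; rewrite lee_fin mulr_ge0//.
    by apply: Rintegral_ge0 => x _; exact: sqr_ge0.
  apply: filterS (ae_sq_integrable1 hf) => y hy _; rewrite lee_fin.
  exact: cauchy_schwarz_Rintegral.
exact: (integrable_lty _ (integrableZl_EFin c iQ)).
Qed.

End Rintegral_fubini.

(** * Volterra operators in time *)

Section volterra.
Context {d2 : measure_display} {Y : measurableType d2} {R : realType}.
Local Notation mu := (@lebesgue_measure R).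
Variables (m2 : {sigma_finite_measure set Y -> \bar R}) (T : R).
Variable kappa : R * R -> R.
Hypotheses (mkappa : measurable_fun setT kappa)
  (kappa_le : forall t s, `|kappa (t, s)| <= \1_`[0, T] t * \1_`[0, T] s).

(** The integral operator with kernel [k] in time, applied for each fixed value
    of the second variable. *)
Definition volterra (k : R * R -> R) (g : R * Y -> R) (z : R * Y) : R :=
  (\int[mu]_s (k (z.1, s) * g (s, z.2)))%R.

Lemma measurable_volterra g : measurable_fun setT g ->
  measurable_fun setT (volterra kappa g).
Proof.
move=> mg.
apply: (@measurable_Rintegral2 _ _ (R * Y)%type _ _ mu
  (fun z : (R * Y) * R => kappa (z.1.1, z.2) * g (z.2, z.1.2))).
apply: measurable_funM; apply: measurableT_comp => //; apply: measurable_fun_pair => //.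
  by apply: measurableT_comp => //; exact: measurable_fst.
by apply: measurableT_comp => //; exact: measurable_snd.
Qed.

Let one2 : sq_integrable mu (\1_`[0, T] : R -> R).
Proof. exact: sq_integrable_indic_itv. Qed.

Let kappa1 t s : `|kappa (t, s)| <= \1_`[0, T] s.
Proof.
apply: le_trans (kappa_le t s) _; rewrite !indicE.
by case: (_ \in _); rewrite ?mul1r ?mul0r.
Qed.

Lemma volterra_section t : sq_integrable mu (fun s => kappa (t, s)).
Proof.
apply: (sq_integrable_le _ one2) => [|s].
  by apply: measurableT_comp => //; exact: pair1_measurable.
by rewrite [leRHS]ger0_norm ?kappa1// indicE.
Qed.

(** The value at (t, w) is at most the indicator of [0, T] at t times the integral
    of |g (s, w)| over s in [0, T], a product of two square-integrable functions
    of separate variables. *)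
Lemma sq_integrable_volterra g : sq_integrable (mu \x m2)%E g ->
  sq_integrable (mu \x m2)%E (volterra kappa g).
Proof.
move=> hg; have [mg _] := hg.
have hng : sq_integrable (mu \x m2)%E (fun z => `|g z|).
  by apply: (sq_integrable_le _ hg) => [|z]; [exact: measurableT_comp|rewrite normr_id].
have hgb := sq_integrable_Rintegral1 one2 hng.
apply: (sq_integrable_ae_le _ (sq_integrable_prod one2 hgb)).
  exact: measurable_volterra.
apply: filterS (ae_product2 _ (ae_sq_integrable1 hg)) => -[t w] /= hgw.
have hgw' : sq_integrable mu (fun s => `|g (s, w)|).
  by apply: (sq_integrable_le _ hgw) => [|z]; [apply: measurableT_comp => //; case: hgw|rewrite normr_id].
have i1 := sq_integrable_mul (volterra_section t) hgw.
have i2 := sq_integrable_mul one2 hgw'.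
have i3 := sq_integrable_mul (volterra_section t) hgw'.
rewrite /volterra /=; apply: (le_trans (le_normr_Rintegral _ i1)) => //.
apply: le_trans (ler_norm _); rewrite -RintegralZl//.
apply: le_Rintegral => //.
- exact: integrable_norm.
- exact: integrableZl_EFin.
- move=> s _; rewrite normrM mulrA ler_wpM2r//.
Qed.

End volterra.

Section adjoint.
Context {R : realType}.
Local Notation mu := (@lebesgue_measure R).

(** For almost every fixed value of the second variable, this is Fubini for the
    two time variables. *)
Lemma volterra_adjoint {d2 : measure_display} {Y : measurableType d2}
    (m2 : {sigma_finite_measure set Y -> \bar R}) (T : R) (kappa kappa' : R * R -> R)
    (f g : R * Y -> R) :
  measurable_fun setT kappa ->
  (forall t s, `|kappa (t, s)| <= \1_`[0, T] t * \1_`[0, T] s) ->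
  (forall t s, kappa' (s, t) = kappa (t, s)) ->
  sq_integrable (@lebesgue_measure R \x m2)%E f ->
  sq_integrable (@lebesgue_measure R \x m2)%E g ->
  (\int[(@lebesgue_measure R \x m2)%E]_z (f z * volterra kappa g z))%R =
  (\int[(@lebesgue_measure R \x m2)%E]_z (g z * volterra kappa' f z))%R.
Proof.
move=> mk kle kk hf hg.
have mk' : measurable_fun setT kappa'.
  rewrite (_ : kappa' = kappa \o (fun z => (z.2, z.1))).
    by apply: measurableT_comp => //; exact: measurable_fun_pair.
  by apply/funext => -[s t]; rewrite /= kk.
have kle' s t : `|kappa' (s, t)| <= \1_`[0, T] s * \1_`[0, T] t.
  by rewrite kk mulrC.
have [iL ->] := Rintegral21 (sq_integrable_mul hf (sq_integrable_volterra mk kle hg)).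
have [iR ->] := Rintegral21 (sq_integrable_mul hg (sq_integrable_volterra mk' kle' hf)).
apply: ae_eq_Rintegral iL iR _.
have one2 : sq_integrable mu (\1_`[0, T] : R -> R) by exact: sq_integrable_indic_itv.
apply: filterS2 (ae_sq_integrable1 hf) (ae_sq_integrable1 hg) => w hfw hgw.
have [mfw _] := hfw; have [mgw _] := hgw.
have i1 := sq_integrable_mul one2 hfw; have i2 := sq_integrable_mul one2 hgw.
pose h (z : R * R) := f (z.1, w) * (kappa z * g (z.2, w)).
have mh : measurable_fun setT h.
  apply: measurable_funM; first exact: (measurableT_comp mfw measurable_fst).
  by apply: measurable_funM => //; exact: (measurableT_comp mgw measurable_snd).
have ih : (mu \x mu)%E.-integrable setT (EFin \o h).
  have [ip _] := Rintegral_prod_mul (integrable_norm i1) (integrable_norm i2).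
  apply: (le_integrable _ _ _ ip) => //; first exact/measurable_EFinP.
  move=> -[t s] _; rewrite /= lee_fin !normrM !normr_id /h /=.
  rewrite mulrCA mulrACA ler_wpM2r ?mulr_ge0//.
  by apply: le_trans (kle t s) _; rewrite -normrM ler_norm.
transitivity (\int[(mu \x mu)%E]_z h z)%R.
  rewrite (Rintegral12 ih).2; apply: eq_Rintegral => t _.
  rewrite /volterra /= -RintegralZl//.
  exact: (sq_integrable_mul (volterra_section mk kle t) hgw).
rewrite (Rintegral21 ih).2; apply: eq_Rintegral => s _.
rewrite /volterra /= -RintegralZl//; last first.
  exact: (sq_integrable_mul (volterra_section mk' kle' s) hfw).
by apply: eq_Rintegral => t _; rewrite /h kk /=; ring.
Qed.

End adjoint.

Lemma mem_itv_cc {R : realType} (a b t : R) : (t \in `[a, b]%classic) = (a <= t <= b).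
Proof.
apply/idP/idP => [/set_mem|tab]; first by rewrite /= in_itv.
by apply: mem_set; rewrite /= in_itv.
Qed.

Section time_kernels.
Context {R : realType}.
Local Notation mu := (@lebesgue_measure R).

(** The associated operators integrate over [0, t] and over [t, T]; the two kernels
    are transposes of each other. *)
Definition past_kernel (T : R) (z : R * R) : R :=
  \1_`[0, T] z.1 * \1_`[0, T] z.2 * \1_[set z : R * R | z.2 <= z.1] z.

Definition future_kernel (T : R) (z : R * R) : R :=
  \1_`[0, T] z.1 * \1_`[0, T] z.2 * \1_[set z : R * R | z.1 <= z.2] z.

Lemma measurable_past_kernel (T : R) : measurable_fun setT (past_kernel T).
Proof.
have m1 (f : R -> R) (g : R * R -> R) : measurable_fun setT f -> measurable_fun setT g ->
  measurable_fun setT (f \o g) by move=> *; exact: measurableT_comp.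
have mI : measurable_fun setT (\1_`[0, T] : R -> R) by exact: measurable_indic.
apply: measurable_funM; first by apply: measurable_funM; exact: m1.
apply: measurable_indic.
rewrite (_ : [set z | _] = setT `&` (fun z : R * R => z.2 <= z.1) @^-1` [set true]).
  by apply: (measurable_fun_ler measurable_snd measurable_fst).
by rewrite setTI; apply/seteqP; split.
Qed.

Lemma past_kernel_le (T t s : R) :
  `|past_kernel T (t, s)| <= \1_`[0, T] t * \1_`[0, T] s.
Proof.
rewrite /past_kernel /= !indicE.
do 3 (case: (_ \in _)); rewrite ?mul1r ?mul0r ?normr0 ?normr1 ?ler01//.
Qed.

Lemma future_past_kernel (T t s : R) : future_kernel T (s, t) = past_kernel T (t, s).
Proof. by rewrite /future_kernel /past_kernel /= [\1__ s * _]mulrC !indicE. Qed.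

Context {d : measure_display} {Omega : measurableType d}.
Variables (T : R) (h : R -> Omega -> R).

Lemma volterra_past t w : 0 <= t <= T ->
  volterra (past_kernel T) (cutoff T h) (t, w) = (\int[mu]_(s in `[0, t]) h s w)%R.
Proof.
move=> /andP[t0 tT]; rewrite /volterra [RHS]Rintegral_mkcond; apply: eq_Rintegral => s _.
rewrite cutoffE /past_kernel /patch !indicE /=.
have -> : (t \in `[0, T]%classic) = true by apply: mem_set; rewrite /= in_itv /= t0 tT.
have -> : (s \in `[0, T]%classic) = (0 <= s <= T) by exact: mem_itv_cc.
have -> : (s \in `[0, t]%classic) = (0 <= s <= t) by exact: mem_itv_cc.
have -> : ((t, s) \in [set z : R * R | z.2 <= z.1]) = (s <= t) by apply/idP/idP => [/set_mem|?] //; exact: mem_set.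
rewrite mul1r; have [s0|s0] := boolP (0 <= s) => /=; last by rewrite mulr0.
have [st|st] := boolP (s <= t); last by rewrite mulr0 mul0r.
by rewrite (le_trans st tT) !mul1r.
Qed.

Lemma volterra_future t w : 0 <= t <= T ->
  volterra (future_kernel T) (cutoff T h) (t, w) = (\int[mu]_(s in `[t, T]) h s w)%R.
Proof.
move=> /andP[t0 tT]; rewrite /volterra [RHS]Rintegral_mkcond; apply: eq_Rintegral => s _.
rewrite cutoffE /future_kernel /patch !indicE /=.
have -> : (t \in `[0, T]%classic) = true by apply: mem_set; rewrite /= in_itv /= t0 tT.
have -> : (s \in `[0, T]%classic) = (0 <= s <= T) by exact: mem_itv_cc.
have -> : (s \in `[t, T]%classic) = (t <= s <= T) by exact: mem_itv_cc.
have -> : ((t, s) \in [set z : R * R | z.1 <= z.2]) = (t <= s) by apply/idP/idP => [/set_mem|?] //; exact: mem_set.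
rewrite mul1r; have [ts|ts] := boolP (t <= s); last by rewrite mulr0 mul0r.
by rewrite (le_trans t0 ts) /=; case: ifP; rewrite ?mul1r ?mulr0.
Qed.

End time_kernels.

(** * Duality of forward and backward equations *)

Section duality.
Context {d : measure_display} {Omega : measurableType d} {R : realType}.
Variables (P : probability Omega R) (B : R -> Omega -> R).
Hypotheses (hP : measure_is_complete P) (hB : brownian_motion P B).
Local Notation Filt t := (g_sigma_algebraType (filtration_events P B t)).
Local Notation mu := (@lebesgue_measure R).
Variable T : R.
Hypothesis T0 : 0 <= T.
Local Notation cut := (cutoff T).

Definition adapted (h : R -> Omega -> R) : Prop :=
  forall t, 0 <= t <= T -> measurable_fun setT (h t : Filt t -> R).

Lemma cutoff_in (h : R -> Omega -> R) t w : 0 <= t <= T -> cut h (t, w) = h t w.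
Proof. by move=> tT; rewrite cutoffE tT. Qed.

Lemma cutoff_out (h : R -> Omega -> R) t w : ~~ (0 <= t <= T) -> cut h (t, w) = 0.
Proof. by move=> tT; rewrite cutoffE (negbTE tT). Qed.

(** A future increment of a stochastic integral is orthogonal to what is known at
    the present time.  The function [r] stands for the product
    (M_T - M_t) gam_t: in the applications its joint integrability comes from
    another expression, equal to this product at each time almost surely. *)
Lemma ito_orthogonal (h M gam : R -> Omega -> R) (r : R * Omega -> R) :
  ito_integral P B T h M -> adapted gam -> sq_integrable (mu \x P)%E (cut gam) ->
  (mu \x P)%E.-integrable setT (EFin \o r) ->
  (forall t w, ~~ (0 <= t <= T) -> r (t, w) = 0) ->
  (forall t, 0 <= t <= T -> {ae P, forall w, r (t, w) = (M T w - M t w) * gam t w}) ->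
  (\int[(mu \x P)%E]_z r z)%R = 0.
Proof.
move=> itoM agam hgam ir rout rin.
rewrite (Rintegral12 ir).2.
rewrite (_ : 0 = (\int[mu]_x (0 : R))%R); last by rewrite /Rintegral integral0.
apply: ae_eq_Rintegral => //; first exact: (Rintegral12 ir).1.
  exact: integrable0.
apply: filterS2 (ae_sq_integrable2 hgam) (ae_integrable1 ir) => t gt irt.
have [tT|tT] := boolP (0 <= t <= T); last first.
  under eq_Rintegral do rewrite rout//.
  by rewrite /Rintegral integral0.
have {}gt : sq_integrable P (gam t).
  by move: gt; under eq_fun do rewrite cutoff_in//.
have TT : 0 <= T <= T by rewrite T0 lexx.
have i1 := sq_integrable_mul (ito_sq_integrable hP hB itoM TT) gt.
have i2 := sq_integrable_mul (ito_sq_integrable hP hB itoM tT) gt.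
transitivity (\int[P]_w (M T w * gam t w - M t w * gam t w))%R.
  apply: ae_eq_Rintegral => //; first exact: integrableB_EFin.
  by apply: filterS (rin t tT) => w ->; rewrite mulrBl.
rewrite RintegralB// (ito_martingale hP hB T0 itoM tT gt (agam t tT)) subrr//.
Qed.

Lemma Rintegral_terminal (Z : Omega -> R) (h : R -> Omega -> R) :
  sq_integrable P Z -> sq_integrable (mu \x P)%E (cut h) ->
  (mu \x P)%E.-integrable setT (EFin \o (fun z => Z z.2 * cut h z)) /\
  (\int[P]_w (Z w * (\int[mu]_(s in `[0, T]) h s w)%R))%R =
  (\int[(mu \x P)%E]_z (Z z.2 * cut h z))%R.
Proof.
move=> hZ hh.
have one2 : sq_integrable mu (\1_`[0, T] : R -> R) by exact: sq_integrable_indic_itv.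
have eq z : Z z.2 * cut h z = \1_`[0, T] z.1 * Z z.2 * cut h z.
  case: z => t w /=; have [tT|tT] := boolP (0 <= t <= T); last first.
    by rewrite cutoff_out// !mulr0.
  by rewrite indicE mem_set ?mul1r//= in_itv.
have i : (mu \x P)%E.-integrable setT (EFin \o (fun z => Z z.2 * cut h z)).
  rewrite (funext eq).
  exact: (sq_integrable_mul (sq_integrable_prod one2 hZ) hh).
split => //; rewrite (Rintegral21 i).2.
have [iW _] := Rintegral21 i.
have TT : 0 <= T <= T by rewrite T0 lexx.
have hV : sq_integrable P (fun w => volterra (past_kernel T) (cut h) (T, w)).
  rewrite /volterra /=.
  apply: (sq_integrable_Rintegral1 (m1 := mu)) hh.
  exact: (volterra_section (@measurable_past_kernel _ T) (@past_kernel_le _ T)).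
apply: ae_eq_Rintegral => //.
  have := sq_integrable_mul hZ hV.
  by under eq_fun do rewrite volterra_past//.
apply: filterS (ae_sq_integrable1 hh) => w hw /=.
rewrite RintegralZl//; last first.
  have := sq_integrable_mul one2 hw; congr (_.-integrable _ _).
  apply/funext => t; congr EFin => /=.
  have [tT|tT] := boolP (0 <= t <= T); last by rewrite cutoff_out// mulr0.
  by rewrite indicE mem_set ?mul1r//= in_itv.
congr (_ * _); rewrite [LHS]Rintegral_mkcond; apply: (@eq_Rintegral _ _ _ mu setT) => t _.
rewrite cutoffE /patch.
by have -> : (t \in `[0, T]%classic) = (0 <= t <= T) by exact: mem_itv_cc.
Qed.

Let zeroT : 0 <= (0 : R) <= T. Proof. by rewrite lexx. Qed.
Let TT : 0 <= T <= T. Proof. by rewrite T0 lexx. Qed.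

Lemma sq_integrable_time_integral (h : R -> Omega -> R) :
  sq_integrable (mu \x P)%E (cut h) ->
  sq_integrable P (fun w => (\int[mu]_(s in `[0, T]) h s w)%R).
Proof.
move=> hh; under eq_fun do rewrite -(@volterra_past _ _ _ T)//.
rewrite /volterra /=; apply: (sq_integrable_Rintegral1 (m1 := mu)) hh.
exact: (volterra_section (@measurable_past_kernel _ T) (@past_kernel_le _ T)).
Qed.

Lemma measurable_future_kernel : measurable_fun setT (@future_kernel R T).
Proof.
rewrite (_ : future_kernel T = @past_kernel R T \o (fun z => (z.2, z.1))).
  by apply: measurableT_comp; [exact: measurable_past_kernel|exact: measurable_fun_pair].
by apply/funext => -[s t]; rewrite future_past_kernel.
Qed.

Lemma future_kernel_le (t s : R) :
  `|future_kernel T (t, s)| <= \1_`[0, T] t * \1_`[0, T] s.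
Proof. by rewrite future_past_kernel mulrC past_kernel_le. Qed.

(** The expectation of the product rule for d xi = beta dt + eta dN and
    dp = - delta dt + q dB, for [xi] starting at zero.  Expanding [p T * xi T] along
    the drift and the martingale part of [xi], the double time integrals of
    [beta] and [delta] occur with opposite signs and cancel by adjointness. *)
Theorem ito_product_expectation (xi p beta delta eta q N M : R -> Omega -> R) :
  sq_integrable (mu \x P)%E (cut beta) -> adapted beta ->
  sq_integrable (mu \x P)%E (cut delta) -> adapted delta ->
  ito_integral P B T eta N -> ito_integral P B T q M ->
  sq_integrable (mu \x P)%E (cut xi) -> measurable_fun setT (xi T) ->
  sq_integrable (mu \x P)%E (cut p) -> adapted p -> sq_integrable P (p T) ->
  (forall t, 0 <= t <= T -> {ae P, forall w,
     xi t w = (\int[mu]_(s in `[0, t]) beta s w)%R + N t w}) ->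
  (forall t, 0 <= t <= T -> {ae P, forall w,
     p t w = p T w + (\int[mu]_(s in `[t, T]) delta s w)%R - (M T w - M t w)}) ->
  sq_integrable P (xi T) /\
  (\int[P]_w (p T w * xi T w))%R =
    (\int[(mu \x P)%E]_z (cut p z * cut beta z))%R
    + (\int[(mu \x P)%E]_z (cut eta z * cut q z))%R
    - (\int[(mu \x P)%E]_z (cut xi z * cut delta z))%R.
Proof.
move=> hbeta abeta hdelta adelta itoN itoM hxi mxi hp ap hpT exi ep.
have hMT := ito_sq_integrable hP hB itoM TT; have hM0 := ito_sq_integrable hP hB itoM zeroT.
have hNT := ito_sq_integrable hP hB itoN TT.
have hIb := sq_integrable_time_integral hbeta; have hId := sq_integrable_time_integral hdelta.
have hC := sq_integrable_volterra (@measurable_past_kernel R T) (@past_kernel_le R T) hbeta.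
have hA := sq_integrable_volterra measurable_future_kernel future_kernel_le hdelta.
set C := volterra _ _ in hC; set A := volterra _ _ in hA.
have hxiT : sq_integrable P (xi T).
  by apply: sq_integrable_ae_eq (sq_integrableD hIb hNT) (exi T TT).
split => //.
have hp0 : sq_integrable P (p 0).
  have h := sq_integrableB (sq_integrableD hpT hId) (sq_integrableB hMT hM0).
  apply: sq_integrable_ae_eq h (ep 0 zeroT).
  exact: (filtration_measurable_fun hP hB (ap 0 zeroT)).
(* p_T = p_t - \int_t^T delta + (M_T - M_t), where the last increment is
   orthogonal to beta_t, which is known at time t *)
have [i1 e1] := Rintegral_terminal hpT hbeta.
have ipb := sq_integrable_mul hp hbeta; have iAb := sq_integrable_mul hbeta hA.
have drift : (\int[P]_w (p T w * (\int[mu]_(s in `[0, T]) beta s w)%R))%R =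
    (\int[(mu \x P)%E]_z (cut p z * cut beta z))%R -
    (\int[(mu \x P)%E]_z (cut beta z * A z))%R.
  rewrite e1; apply/eqP; rewrite -subr_eq0; apply/eqP.
  have i2 := integrableB_EFin ipb iAb; have i3 := integrableB_EFin i1 i2.
  rewrite -RintegralB// -RintegralB//.
  apply: (ito_orthogonal itoM abeta hbeta i3).
    by move=> t w tT; rewrite !cutoff_out// !(mulr0, mul0r) !subrr.
  move=> t tT; apply: filterS (ep t tT) => w pE.
  by rewrite !cutoff_in//= /A volterra_future// pE; ring.
(* likewise N_T = xi_t - \int_0^t beta + (N_T - N_t), against delta_t *)
have [i4 e4] := Rintegral_terminal hNT hdelta.
have ixd := sq_integrable_mul hxi hdelta; have iCd := sq_integrable_mul hdelta hC.
have driver : (\int[P]_w (N T w * (\int[mu]_(s in `[0, T]) delta s w)%R))%R =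
    (\int[(mu \x P)%E]_z (cut xi z * cut delta z))%R -
    (\int[(mu \x P)%E]_z (cut delta z * C z))%R.
  rewrite e4; apply/eqP; rewrite -subr_eq0; apply/eqP.
  have i2 := integrableB_EFin ixd iCd; have i3 := integrableB_EFin i4 i2.
  rewrite -RintegralB// -RintegralB//.
  apply: (ito_orthogonal itoN adelta hdelta i3).
    by move=> t w tT; rewrite !cutoff_out// !(mulr0, mul0r) !subrr.
  move=> t tT; apply: filterS (exi t tT) => w xE.
  by rewrite !cutoff_in//= /C volterra_past// xE; ring.
have iN0 := sq_integrable_mul hNT hp0; have iNd := sq_integrable_mul hNT hId.
have iMN := sq_integrable_mul hMT hNT; have iM0N := sq_integrable_mul hM0 hNT.
(* p_T expressed from time 0: p_0 is known at time 0, hence orthogonal to N_T *)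
have martingale : (\int[P]_w (p T w * N T w))%R =
    (\int[(mu \x P)%E]_z (cut eta z * cut q z))%R -
    (\int[P]_w (N T w * (\int[mu]_(s in `[0, T]) delta s w)%R))%R.
  transitivity (\int[P]_w (N T w * p 0 w - N T w * (\int[mu]_(s in `[0, T]) delta s w)%R
      + (M T w * N T w - M 0 w * N T w)))%R.
    apply: ae_eq_Rintegral.
    - exact: sq_integrable_mul hpT hNT.
    - by apply: integrableD_EFin; apply: integrableB_EFin.
    - by apply: filterS (ep 0 zeroT) => w ->; ring.
  rewrite RintegralD//; [|exact: integrableB_EFin|exact: integrableB_EFin].
  rewrite RintegralB// RintegralB//.
  rewrite (ito_martingale hP hB T0 itoN zeroT hp0 (ap 0 zeroT)).
  rewrite (ito_start hP hB T0 itoN hp0) (ito_start hP hB T0 itoM hNT).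
  rewrite (ito_isometry hP hB T0 itoM itoN) subr0 sub0r addrC.
  by congr (_ - _); apply: eq_Rintegral => z _; rewrite mulrC.
have adj : (\int[(mu \x P)%E]_z (cut beta z * A z))%R =
    (\int[(mu \x P)%E]_z (cut delta z * C z))%R.
  apply: (volterra_adjoint measurable_future_kernel future_kernel_le) hbeta hdelta.
  by move=> t s; rewrite future_past_kernel.
transitivity (\int[P]_w (p T w * (\int[mu]_(s in `[0, T]) beta s w)%R + p T w * N T w))%R.
  apply: ae_eq_Rintegral.
  - exact: sq_integrable_mul.
  - by apply: integrableD_EFin; exact: sq_integrable_mul.
  - by apply: filterS (exi T TT) => w ->; rewrite mulrDr.
rewrite RintegralD//; [|exact: sq_integrable_mul|exact: sq_integrable_mul].
by rewrite drift martingale driver adj; ring.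
Qed.

End duality.

(** * Adaptedness and measurability of coefficient processes *)

Section coefficient_processes.
Context {d : measure_display} {Omega : measurableType d} {R : realType}.
Variables (P : probability Omega R) (B : R -> Omega -> R).
Hypotheses (hP : measure_is_complete P) (hB : brownian_motion P B).
Local Notation Filt t := (g_sigma_algebraType (filtration_events P B t)).
Local Notation coefficient := (Omega -> R -> R -> R -> R -> R).
Variables (T : R) (U : set R) (u0 : R).
Hypotheses (T0 : 0 <= T) (itvU : is_interval U) (Uu0 : U u0).

(** The derivative is a limit of difference quotients, which are adapted. *)
Lemma coef_dx_adapted (c : coefficient) :
  (forall w t x u y, 0 <= t <= T -> U u -> derivable (fun x' => c w t x' u y) x 1) ->
  coef_adapted P B T U c -> coef_adapted P B T U (coef_dx c).
Proof.
move=> dc ac t x u y tT Uu.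
apply: (@measurable_fun_cvg _ (Filt t) R setT
  (fun n w => n.+1%:R * (c w t (x + n.+1%:R^-1) u y - c w t x u y))).
- move=> n; apply: (@measurable_funM _ (Filt t)); first exact: measurable_cst.
  by apply: (@measurable_funB _ (Filt t)); exact: ac.
- by move=> w _; apply: derive1_quotient_cvg; exact: dc.
Qed.

Variables (c : coefficient) (y : R) (x u : R -> Omega -> R).
Hypotheses (cc : coef_continuous T U c) (ac : coef_adapted P B T U c).
Hypotheses (px : progressive P B T x) (pu : progressive P B T u)
  (uU : forall t w, 0 <= t <= T -> U (u t w)).

Lemma coef_process_adapted :
  adapted P B T (fun t w => c w t (x t w) (u t w) y).
Proof.
move=> t tT.
apply: (@measurable_coef_path _ _ Omega (Filt t) R T U u0 itvU Uu0 c y cc setT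
  (fun w => w) (fun _ => t) (x t) (u t)) => //.
- by move=> w _; exact: uU.
- exact: progressive_adapted px tT.
- exact: progressive_adapted pu tT.
- by move=> x' u' Uu'; exact: ac.
Qed.

Lemma coef_process_measurable :
  measurable_fun setT (cutoff T (fun t w => c w t (x t w) (u t w) y)).
Proof.
apply: measurable_cutoff.
have mD : measurable (`[0, T] `*` [set: Omega]) by exact: measurableX.
have inD (z : R * Omega) : (`[0, T] `*` [set: Omega]) z -> 0 <= z.1 <= T.
  by case=> + _; rewrite /= in_itv.
apply: (@measurable_coef_path _ _ Omega (R * Omega)%type R T U u0 itvU Uu0 c y cc
  (`[0, T] `*` [set: Omega]) snd fst (fun z => x z.1 z.2) (fun z => u z.1 z.2)) => //.
- by move=> z /inD; exact: uU.
- exact: (progressive_measurable hP hB T0 px).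
- exact: (progressive_measurable hP hB T0 pu).
- apply: (@measurable_coef_pathT _ _ Omega (R * Omega)%type R T U c y cc) => //; first exact: measurable_funTS.
  move=> t x' u' tT Uu'; apply: measurable_funTS.
  have mc : measurable_fun setT (fun w => c w t x' u' y).
    by apply: (filtration_measurable_fun hP hB (t := t)); exact: ac.
  exact: (measurableT_comp mc measurable_snd).
Qed.

End coefficient_processes.

(** * Concave functions and tangents *)

Section concavity.
Context {R : realType}.

Lemma concave_functionP (h : R -> R) : concave_function h ->
  forall x y l, 0 <= l <= 1 -> l * h x + (1 - l) * h y <= h (l * x + (1 - l) * y).
Proof.
move=> ch x y l /andP[l0 l1].
have c1 : - h (l * x + (1 - l) * y) <= l * (- h x) + (1 - l) * (- h y).
  by have := ch (Itv01 l0 l1) x y; rewrite !inE; apply.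
by move: c1; rewrite !mulrN -opprD lerN2.
Qed.

(** Concavity of [H] at a, between x and the point z = a - l (x - a) on the other
    side, gives l H x + H z <= (1 + l) H a.  With h z <= H z and h a = H a this
    bounds H x - h a by the difference quotient (h a - h z) / l, whose limit as l
    tends to 0 is the slope of [h] times x - a. *)
Lemma concave_le_tangent (H h : R -> R) (a : R) : concave_function H ->
  (forall x, h x <= H x) -> h a = H a -> derivable h a 1 ->
  forall x, H x <= h a + derive1 h a * (x - a).
Proof.
move=> cH hH ha dh x.
pose F (l : R) := - h (a - l * (x - a)).
have DF : is_derive (0 : R) 1 F (derive1 h a * (x - a)).
  have D1 : is_derive (a - 0 * (x - a)) 1 h (derive1 h a).
    by rewrite mul0r subr0 derive1E; exact: DeriveDef.
  have D2 : is_derive (0 : R) 1 (fun l : R => a - l * (x - a)) (- (x - a)).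
    apply: is_derive_eq; rewrite /GRing.scale /=; ring.
  have := is_deriveN (@is_derive1_comp R h (fun l : R => a - l * (x - a)) 0 _ _ D1 D2).
  by rewrite mulrN opprK.
have cF := is_derive_quotient_cvg DF.
rewrite -lerBlDl; apply: (cvgr_to_ge cF); near=> n.
rewrite /F add0r mul0r subr0 opprK.
set l := n.+1%:R^-1; have l0 : 0 < l by rewrite invr_gt0.
have n0 : n.+1%:R = l^-1 :> R by rewrite invrK.
have l1 : 0 < 1 + l by rewrite addr_gt0.
set z := a - l * (x - a).
have lk : 0 <= l / (1 + l) <= 1.
  by rewrite divr_ge0 ?(ltW l0) ?(ltW l1)//= ler_pdivrMr// mul1r lerDr.
have := concave_functionP cH x z lk.
have -> : l / (1 + l) * x + (1 - l / (1 + l)) * z = a.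
  by rewrite /z; field; rewrite gt_eqF.
have -> : l / (1 + l) * H x + (1 - l / (1 + l)) * H z = (l * H x + H z) / (1 + l).
  by field; rewrite gt_eqF.
rewrite ler_pdivrMr// n0 -ha => le1; have le2 := hH z.
rewrite [leRHS]mulrC ler_pdivlMr//.
by nra.
Unshelve. all: by end_near. Qed.

End concavity.

(** * Square integrability of coefficient processes *)

Section cutoff_algebra.
Context {d : measure_display} {Omega : measurableType d} {R : realType}.
Variable T : R.
Implicit Types h k : R -> Omega -> R.

Lemma cutoffD h k z :
  cutoff T (fun t w => h t w + k t w) z = cutoff T h z + cutoff T k z.
Proof. by rewrite /cutoff mulrDr. Qed.

Lemma cutoffM h k z :
  cutoff T (fun t w => h t w * k t w) z = cutoff T h z * cutoff T k z.
Proof.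
by case: z => t w; rewrite !cutoffE; case: ifP => // _; rewrite mulr0.
Qed.

End cutoff_algebra.

Section square_integrable_coefficients.
Context {d : measure_display} {Omega : measurableType d} {R : realType}.
Variables (P : probability Omega R) (T : R).
Local Notation mu := (@lebesgue_measure R).
Local Notation cut := (cutoff T).
Implicit Types x u h k : R -> Omega -> R.

(** The second moments are bounded uniformly in time, and the time interval is
    bounded. *)
Lemma sq_integrable_moment u : 0 <= T -> measurable_fun setT (cut u) ->
  (ereal_sup [set \int[P]_w (`|u t w| ^+ 2)%:E | t in `[0%R, T]] < +oo)%E ->
  sq_integrable (mu \x P)%E (cut u).
Proof.
move=> T0 mu_ sup_lt; split => //.
set s := ereal_sup _ in sup_lt.
have les t : 0 <= t <= T -> (\int[P]_w (`|u t w| ^+ 2)%:E <= s)%E.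
  by move=> tT; apply: ereal_sup_ubound; exists t => //=; rewrite in_itv.
have s0 : (0 <= s)%E.
  apply: le_trans (les 0 _); last by rewrite lexx.
  by apply: integral_ge0 => w _; rewrite lee_fin exprn_ge0.
have fs : s \is a fin_num by rewrite ge0_fin_numE.
have mu2 : measurable_fun setT (fun z => ((cut u z) ^+ 2)%:E).
  by apply/measurable_EFinP; exact: measurable_funX.
rewrite fubini_tonelli1//; last by move=> z; rewrite lee_fin sqr_ge0.
apply: (@le_lt_trans _ _ (\int[mu]_t (fine s * \1_`[0, T] t)%:E)%E).
  apply: ge0_le_integral => //.
  - by move=> t _; apply: integral_ge0 => w _; rewrite lee_fin sqr_ge0.
  - apply: measurable_fun_fubini_tonelli_F => //.
    by move=> z; rewrite lee_fin sqr_ge0.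
  - apply/measurable_EFinP; apply: measurable_funM => //; exact: measurable_indic.
  move=> t _; rewrite /fubini_F.
  have [tT|tT] := boolP (0 <= t <= T).
    rewrite indicE mem_itv_cc tT mulr1 fineK//.
    apply: le_trans (les t tT); rewrite le_eqVlt; apply/orP; left; apply/eqP.
    by apply: eq_integral => w _; rewrite cutoff_in// real_normK// num_real.
  rewrite indicE mem_itv_cc (negbTE tT) mulr0.
  by under eq_integral do rewrite cutoff_out// expr0n; rewrite integral0.
apply: integrable_lty => //.
apply: integrableZl_EFin; exact: integrable_indic_itv.
Qed.

Lemma sq_integrable_growth (L : R) h x u : 0 < L -> measurable_fun setT (cut h) ->
  sq_integrable (mu \x P)%E (cut x) -> sq_integrable (mu \x P)%E (cut u) ->
  (forall t w, 0 <= t <= T -> `|h t w| <= L * (1 + `|x t w| + `|u t w|)) ->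
  sq_integrable (mu \x P)%E (cut h).
Proof.
move=> L0 mh hx hu hL; have [mx _] := hx; have [mu_ _] := hu.
have one2 : sq_integrable mu (\1_`[0, T] : R -> R) by exact: sq_integrable_indic_itv.
have h1 := sq_integrable_prod one2 (sq_integrable_cst P 1).
have nrm (k : R * Omega -> R) : sq_integrable (mu \x P)%E k ->
    sq_integrable (mu \x P)%E (fun z => `|k z|).
  move=> hk; have [mk _] := hk.
  by apply: (sq_integrable_le _ hk) => [|z]; [exact: measurableT_comp|rewrite normr_id].
have hR := sq_integrableZ L (sq_integrableD (sq_integrableD h1 (nrm _ hx)) (nrm _ hu)).
apply: (sq_integrable_le _ hR) => // -[t w] /=.
have [tT|tT] := boolP (0 <= t <= T); last by rewrite cutoff_out// normr0.
rewrite !cutoff_in// indicE mem_itv_cc tT mulr1.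
by apply: le_trans (hL t w tT) _; rewrite ler_norm.
Qed.

Lemma sq_integrable_bounded_process (K : R) h k : measurable_fun setT (cut h) ->
  (forall t w, 0 <= t <= T -> `|h t w| <= K) ->
  sq_integrable (mu \x P)%E (cut k) ->
  sq_integrable (mu \x P)%E (cut (fun t w => h t w * k t w)).
Proof.
move=> mh hK hk; have [mk _] := hk.
apply: (sq_integrable_le _ (sq_integrableZ K hk)).
  by rewrite (funext (cutoffM T h k)); exact: measurable_funM.
move=> -[t w]; have [tT|tT] := boolP (0 <= t <= T); last by rewrite cutoff_out// normr0.
rewrite !cutoff_in// !normrM ler_wpM2r//.
by apply: le_trans (hK t w tT) _; rewrite ler_norm.
Qed.

End square_integrable_coefficients.

(** * The Donsker density *)

Section donsker.
Context {d : measure_display} {Omega : measurableType d} {R : realType}.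
Variables (P : probability Omega R) (B : R -> Omega -> R).
Hypotheses (hP : measure_is_complete P) (hB : brownian_motion P B).
Local Notation Filt t := (g_sigma_algebraType (filtration_events P B t)).
Local Notation mu := (@lebesgue_measure R).
Variables (T T0 y : R) (phi : R -> R) (Yt : R -> Omega -> R).
Hypotheses (hT : 0 < T) (hT0 : T < T0) (hphi : measurable_fun `[0, T0] phi)
  (hphi2 : (\int[mu]_(s in `[0%R, T0]) (phi s ^+ 2)%:E < +oo)%E)
  (hphi_pos : forall t, 0 <= t <= T -> 0 < tail_sqnorm T0 phi t)
  (pY : progressive P B T0 Yt).
Local Notation m := (donsker_density T0 phi Yt y).

Lemma tail_sqnorm_nonincreasing s t : 0 <= s -> s <= t ->
  tail_sqnorm T0 phi t <= tail_sqnorm T0 phi s.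
Proof.
move=> s0 st.
have mphi : measurable_fun `[0, T0] (fun s => phi s ^+ 2) by exact: measurable_funX.
have sub a : 0 <= a -> `[a, T0] `<=` `[0, T0].
  by move=> a0 r /=; rewrite !in_itv/= => /andP[ar ->]; rewrite (le_trans a0).
have mphia a : 0 <= a -> measurable_fun `[a, T0] (EFin \o (fun s => phi s ^+ 2)).
  by move=> a0; apply/measurable_EFinP; exact: measurable_funS (sub a a0) mphi.
have fin a : 0 <= a -> (\int[mu]_(s in `[a, T0]) (phi s ^+ 2)%:E)%E \is a fin_num.
  move=> a0; rewrite ge0_fin_numE; last by apply: integral_ge0 => r _; rewrite lee_fin sqr_ge0.
  apply: le_lt_trans hphi2; apply: ge0_subset_integral => //.
  - exact/measurable_EFinP.
  - by move=> r _; rewrite lee_fin sqr_ge0.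
  - exact: sub.
apply: fine_le; [exact: fin (le_trans s0 st)|exact: fin|].
apply: ge0_subset_integral => //.
- exact: mphia.
- by move=> r _; rewrite lee_fin sqr_ge0.
- by move=> r /=; rewrite !in_itv/= => /andP[tr ->]; rewrite (le_trans st).
Qed.

(** The squared norm of the tail is positive, finite and monotone for times in
    [0, T].  Freezing it outside makes the two time-dependent factors of the
    density monotone on the whole line, hence measurable. *)
Let clamp (t : R) : R := Num.max 0 (Num.min t T).

Let clampT t : 0 <= clamp t <= T.
Proof. by rewrite /clamp le_max lexx /= ge_max (ltW hT) ge_min lexx orbT. Qed.

Let clamp_id t : 0 <= t <= T -> clamp t = t.
Proof. by move=> /andP[t0 tT]; rewrite /clamp (min_idPl tT) (max_idPr t0). Qed.

Let tail_clamp s t : s <= t -> tail_sqnorm T0 phi (clamp t) <= tail_sqnorm T0 phi (clamp s).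
Proof.
move=> st; apply: tail_sqnorm_nonincreasing; first by have /andP[] := clampT s.
rewrite /clamp ge_max le_max lexx /= le_max; apply/orP; right.
by rewrite le_min !ge_min st lexx orbT.
Qed.

Let tail_clamp_gt0 t : 0 < tail_sqnorm T0 phi (clamp t).
Proof. exact: hphi_pos. Qed.

Let pi2 : 0 < 2 * pi :> R. Proof. by rewrite mulr_gt0// pi_gt0. Qed.

Let k1 t : R := (Num.sqrt (2 * pi * tail_sqnorm T0 phi (clamp t)))^-1.
Let k2 t : R := (2 * tail_sqnorm T0 phi (clamp t))^-1.

Let mk1 : measurable_fun setT k1.
Proof.
apply: nondecreasing_measurable => // s t st; rewrite /k1.
rewrite lef_pV2 ?posrE ?sqrtr_gt0 ?(mulr_gt0 pi2 (tail_clamp_gt0 _))//.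
by rewrite ler_wsqrtr// ler_wpM2l ?(ltW pi2)// tail_clamp.
Qed.

Let mk2 : measurable_fun setT k2.
Proof.
apply: nondecreasing_measurable => // s t st; rewrite /k2.
by rewrite lef_pV2 ?posrE ?mulr_gt0 ?tail_clamp_gt0// ler_wpM2l// tail_clamp.
Qed.

Lemma donsker_density_gt0 t w : 0 <= t <= T -> 0 < m t w.
Proof.
move=> tT; rewrite /donsker_density mulr_gt0 ?expR_gt0// invr_gt0 sqrtr_gt0.
by rewrite mulr_gt0// hphi_pos.
Qed.

Lemma donsker_density_le t w : 0 <= t <= T ->
  m t w <= (Num.sqrt (2 * pi * tail_sqnorm T0 phi T))^-1.
Proof.
move=> tT; have /andP[t0 tT'] := tT.
have TT : 0 <= T <= T by rewrite lexx ltW.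
rewrite /donsker_density -[leRHS]mulr1 ler_pM ?expR_ge0 ?invr_ge0//.
- rewrite lef_pV2 ?posrE ?sqrtr_gt0 ?(mulr_gt0 pi2) ?hphi_pos//.
  by rewrite ler_wsqrtr// ler_wpM2l ?(ltW pi2)// tail_sqnorm_nonincreasing.
- by rewrite expR_le1 oppr_le0 mulr_ge0 ?sqr_ge0// invr_ge0 mulr_ge0// ltW// hphi_pos.
Qed.

Lemma donsker_density_adapted : adapted P B T m.
Proof.
move=> t /andP[t0 tT]; rewrite /donsker_density.
have mY : measurable_fun setT (Yt t : Filt t -> R).
  by apply: progressive_adapted pY _; rewrite t0 (le_trans tT)// ltW.
apply: (@measurable_funM _ (Filt t)); first exact: measurable_cst.
apply: measurableT_comp => //.
apply: (measurableT_comp (f := fun v : R => - ((v - y) ^+ 2 / (2 * tail_sqnorm T0 phi t)))) => //.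
apply: measurable_funN; apply: measurable_funM => //; apply: measurable_funX.
exact: measurable_funB.
Qed.

Lemma measurable_donsker_density : measurable_fun setT (cutoff T m).
Proof.
apply: measurable_cutoff.
have sub : `[0, T] `*` [set: Omega] `<=` `[0, T0] `*` [set: Omega].
  move=> z [/=]; rewrite !in_itv/= => /andP[-> zT] _; split => //.
  by rewrite (le_trans zT)// ltW.
have T00 : 0 <= T0 by rewrite ltW// (lt_trans hT).
have mY : measurable_fun (`[0, T] `*` [set: Omega]) (fun z : R * Omega => Yt z.1 z.2).
  apply: measurable_funS sub _; first exact: measurableX.
  exact: (progressive_measurable hP hB T00 pY).
apply: (@eq_measurable_fun _ _ _ _ _ (fun z : R * Omega => k1 z.1 *
  expR (- ((Yt z.1 z.2 - y) ^+ 2 * k2 z.1)))).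
  move=> z; rewrite inE => -[/=]; rewrite in_itv /= => zT _.
  by rewrite /k1 /k2 clamp_id.
apply: measurable_funM.
  by apply: measurable_funTS; exact: (measurableT_comp mk1 measurable_fst).
apply: measurableT_comp => //; apply: measurable_funN; apply: measurable_funM.
  by apply: measurable_funX; exact: measurable_funB.
by apply: measurable_funTS; exact: (measurableT_comp mk2 measurable_fst).
Qed.

End donsker.

(** * Optimality *)

Section verification.
Context {d : measure_display} {Omega : measurableType d} {R : realType}.
Variables (P : probability Omega R) (B : R -> Omega -> R).
Variables (T T0 x0 L y : R) (U : set R) (phi : R -> R) (Yt : R -> Omega -> R).
Variables (b sigma f : Omega -> R -> R -> R -> R -> R) (g : Omega -> R -> R -> R).
Variables (ustar xstar p q : R -> Omega -> R).
Local Notation m := (donsker_density T0 phi Yt y).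
Hypotheses (hP : measure_is_complete P) (hB : brownian_motion P B).
Hypotheses (hT : 0 < T) (hT0 : T < T0).
Hypotheses (hU0 : U !=set0) (hU : convex_set (U : set (convex_lmodType R^o))).
Hypotheses (hphi : measurable_fun `[0, T0] phi)
  (hphi2 : (\int[lebesgue_measure]_(s in `[0%R, T0]) (phi s ^+ 2)%:E < +oo)%E)
  (hphi_pos : forall t, 0 <= t <= T -> 0 < tail_sqnorm T0 phi t)
  (hYt : ito_integral P B T0 (fun s _ => phi s) Yt).
Hypotheses (hb : coef_adapted P B T U b) (hsigma : coef_adapted P B T U sigma)
  (hf : coef_adapted P B T U f) (hg : gain_measurable P B T g).
Hypotheses (hL : 0 < L) (hA : regular_coefficients T U b sigma f g L).
Hypotheses (hustar : admissible P B T U ustar)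
  (hxstar : state_equation P B T x0 b sigma y ustar xstar)
  (hpq : adjoint_equation P B T b sigma f g y m ustar xstar p q).
Local Notation Filt t := (g_sigma_algebraType (filtration_events P B t)).
Local Notation mu := (@lebesgue_measure R).
Local Notation cut := (cutoff T).
Local Notation along c x u := (fun t w => c w t (x t w) (u t w) y).

Let Tge0 : 0 <= T. Proof. exact: ltW. Qed.
Let TT : 0 <= T <= T. Proof. by rewrite Tge0 lexx. Qed.
Let itvU : is_interval U. Proof. exact: convex_set_is_interval. Qed.
Let pY : progressive P B T0 Yt. Proof. by case: hYt. Qed.

Let coef_measurable c x u : coef_continuous T U c -> coef_adapted P B T U c ->
  progressive P B T x -> admissible P B T U u -> measurable_fun setT (cut (along c x u)).
Proof.
move=> cc ac px [uU pu _]; have [u0 Uu0] := hU0.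
exact: (coef_process_measurable hP hB Tge0 itvU Uu0 y cc ac px pu uU).
Qed.

Let coef_adapts c x u : coef_continuous T U c -> coef_adapted P B T U c ->
  progressive P B T x -> admissible P B T U u -> adapted P B T (along c x u).
Proof.
move=> cc ac px [uU pu _]; have [u0 Uu0] := hU0.
exact: (coef_process_adapted itvU Uu0 y cc ac px pu uU).
Qed.

Let admissible_sq_integrable u : admissible P B T U u ->
  sq_integrable (mu \x P)%E (cut u).
Proof.
move=> [uU pu /(_ 2%N isT) mom]; apply: sq_integrable_moment => //.
exact: (progressive_measurable_cutoff hP hB Tge0 pu).
Qed.

Let m_gt0 t w : 0 <= t <= T -> 0 < m t w.
Proof. by move=> tT; apply: (donsker_density_gt0 (T := T)). Qed.

Let mK : R := (Num.sqrt (2 * pi * tail_sqnorm T0 phi T))^-1.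

Let m_le t w : 0 <= t <= T -> m t w <= mK.
Proof. by move=> tT; apply: (donsker_density_le (T := T)). Qed.

Let am : adapted P B T m.
Proof. exact: (donsker_density_adapted (T0 := T0)). Qed.

Let mm : measurable_fun setT (cut m).
Proof. exact: (measurable_donsker_density hP hB y hT hT0 hphi hphi2 hphi_pos pY). Qed.

Let delta := adjoint_driver b sigma f y m ustar xstar p q.

Let px_star : progressive P B T xstar. Proof. by case: hxstar => -[]. Qed.
Let pp : progressive P B T p. Proof. by case: hpq => -[]. Qed.
Let ap : adapted P B T p. Proof. by move=> t tT; exact: progressive_adapted pp tT. Qed.

Let cp_sq : sq_integrable (mu \x P)%E (cut p).
Proof. by case: hpq => sp _ _ _; exact: (square_integrable_cutoff hP hB Tge0 sp). Qed.

Let cxstar_sq : sq_integrable (mu \x P)%E (cut xstar).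
Proof. by case: hxstar => sx _ _ _; exact: (square_integrable_cutoff hP hB Tge0 sx). Qed.

Let driver_sq : sq_integrable (mu \x P)%E (cut delta) /\ adapted P B T delta.
Proof.
have [_ _ _ [M itoM _]] := hpq.
have cq_sq := ito_integrand_sq_integrable hP hB Tge0 itoM.
have pq : progressive P B T q by case: itoM => -[].
have [uU _ _] := hustar.
have [db cb cbx _] := reg_b hA; have [ds cs csx _] := reg_sigma hA.
have [df cf cfx _] := reg_f hA.
have abx : coef_adapted P B T U (coef_dx b).
  by apply: coef_dx_adapted hb => w t x u y' tT Uu; exact: (db w t x u y' tT Uu).1.
have asx : coef_adapted P B T U (coef_dx sigma).
  by apply: coef_dx_adapted hsigma => w t x u y' tT Uu; exact: (ds w t x u y' tT Uu).1.
have afx : coef_adapted P B T U (coef_dx f).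
  by apply: coef_dx_adapted hf => w t x u y' tT Uu; exact: (df w t x u y' tT Uu).1.
split; last first.
  move=> t tT; rewrite /delta /adjoint_driver.
  apply: (@measurable_funD _ (Filt t)); first apply: (@measurable_funD _ (Filt t)).
  - by apply: (@measurable_funM _ (Filt t)); [exact: (coef_adapts cbx abx px_star hustar)|exact: ap].
  - apply: (@measurable_funM _ (Filt t)); first exact: (coef_adapts csx asx px_star hustar).
    exact: progressive_adapted pq tT.
  - by apply: (@measurable_funM _ (Filt t)); [exact: (coef_adapts cfx afx px_star hustar)|exact: am].
have bx_sq := sq_integrable_bounded_process (coef_measurable cbx abx px_star hustar)
  (fun t w tT => reg_bx hA w (xstar t w) y tT (uU t w tT)) cp_sq.
have sx_sq := sq_integrable_bounded_process (coef_measurable csx asx px_star hustar)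
  (fun t w tT => reg_sigmax hA w (xstar t w) y tT (uU t w tT)) cq_sq.
have fx_sq : sq_integrable (mu \x P)%E (cut (along (coef_dx f) xstar ustar)).
  apply: (sq_integrable_growth hL _ cxstar_sq (admissible_sq_integrable hustar)).
    exact: coef_measurable.
  by move=> t w tT; apply: (reg_fx_growth hA) => //; exact: uU.
have fm_sq : sq_integrable (mu \x P)%E
    (cut (fun t w => m t w * along (coef_dx f) xstar ustar t w)).
  apply: (sq_integrable_bounded_process (K := mK)
    mm _ fx_sq) => t w tT.
  by rewrite ger0_norm ?m_le// ltW// m_gt0.
have e z : cut delta z = cut (fun t w => along (coef_dx b) xstar ustar t w * p t w) z
   + cut (fun t w => along (coef_dx sigma) xstar ustar t w * q t w) z
   + cut (fun t w => m t w * along (coef_dx f) xstar ustar t w) z.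
  by rewrite -!cutoffD; congr (_ * _); rewrite /delta /adjoint_driver [m _ _ * _]mulrC.
rewrite (funext e); apply: sq_integrableD; last exact: fm_sq.
exact: sq_integrableD.
Qed.

Let state_sq u x : admissible P B T U u -> state_equation P B T x0 b sigma y u x ->
  [/\ progressive P B T x, sq_integrable (mu \x P)%E (cut x), sq_integrable P (x T) &
   sq_integrable (mu \x P)%E (cut (along b x u)) /\ adapted P B T (along b x u)].
Proof.
move=> hu [sx _ _ [N itoN xE]]; have [px _] := sx; have [uU _ _] := hu.
have cx_sq := square_integrable_cutoff hP hB Tge0 sx.
have [_ cb _ _] := reg_b hA.
have cb_sq : sq_integrable (mu \x P)%E (cut (along b x u)).
  apply: (sq_integrable_growth hL _ cx_sq (admissible_sq_integrable hu)).
    exact: coef_measurable.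
  by move=> t w tT; apply: (reg_b_growth hA) => //; exact: uU.
split => //; last by split => //; exact: coef_adapts.
have h := sq_integrableD (sq_integrableD (sq_integrable_cst P x0)
  (sq_integrable_time_integral Tge0 cb_sq)) (ito_sq_integrable hP hB itoN TT).
apply: (sq_integrable_ae_eq _ h).
  by apply: (filtration_measurable_fun hP hB (t := T)); exact: progressive_adapted px TT.
by apply: filterS xE => w /(_ T TT).
Qed.

Let pT_eq : {ae P, forall w, p T w = gain_dx g w (xstar T w) y * m T w}.
Proof.
have [_ _ _ [M _ pE]] := hpq; apply: filterS pE => w /(_ T TT) ->.
by rewrite set_itv1 Rintegral_set1 subrr subr0 addr0.
Qed.

Let pT_sq : sq_integrable P (p T).
Proof.
have [_ _ hxT _] := state_sq hustar hxstar.
have [mx _] := hxT.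
have hn : sq_integrable P (fun w => `|xstar T w|).
  by apply: (sq_integrable_le _ hxT) => [|w]; [exact: measurableT_comp|rewrite normr_id].
have h := sq_integrableZ (L * mK) (sq_integrableD (sq_integrable_cst P 1) hn).
apply: (sq_integrable_ae_le _ h).
  by apply: (filtration_measurable_fun hP hB (t := T)); exact: ap.
apply: filterS pT_eq => w ->.
rewrite normrM; apply: le_trans (ler_norm _); rewrite mulrAC ler_pM//.
- exact: (reg_gx_growth hA).
- by rewrite ger0_norm ?m_le// ltW// m_gt0.
Qed.

(** The constant [x0] is subtracted because the duality formula concerns processes
    that start at zero. *)
Let state_duality u x : admissible P B T U u -> state_equation P B T x0 b sigma y u x ->
  sq_integrable (mu \x P)%E (cut (along sigma x u)) /\
  (\int[P]_w (p T w * (x T w - x0)))%R =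
    (\int[(mu \x P)%E]_z (cut p z * cut (along b x u) z))%R
    + (\int[(mu \x P)%E]_z (cut (along sigma x u) z * cut q z))%R
    - (\int[(mu \x P)%E]_z ((cut x z - \1_`[0, T] z.1 * x0) * cut delta z))%R.
Proof.
move=> hu hx; have [px cx_sq xT_sq [cb_sq ab]] := state_sq hu hx.
have [_ _ _ [N itoN xE]] := hx; have [_ _ _ [M itoM pE]] := hpq.
split; first exact: (ito_integrand_sq_integrable hP hB Tge0 itoN).
have one2 : sq_integrable mu (\1_`[0, T] : R -> R) by exact: sq_integrable_indic_itv.
have e z : cut (fun t w => x t w - x0) z = cut x z - \1_`[0, T] z.1 * x0.
  by rewrite /cutoff mulrBr.
have hxi : sq_integrable (mu \x P)%E (cut (fun t w => x t w - x0)).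
  rewrite (funext e); apply: sq_integrableB => //.
  exact: (sq_integrable_prod one2 (sq_integrable_cst P x0)).
have [delta_sq adelta] := driver_sq.
have := ito_product_expectation hP hB Tge0 (xi := fun t w => x t w - x0)
  cb_sq ab delta_sq adelta itoN itoM hxi _ cp_sq ap pT_sq _ _.
case.
- by have [mx _] := xT_sq; exact: measurable_funB.
- move=> t tT; apply: filterS xE => w /(_ t tT) ->; ring.
- move=> t tT; apply: filterS pE => w pw; rewrite (pw t tT) (pw T TT).
  by rewrite set_itv1 Rintegral_set1; ring.
move=> _ ->; congr (_ - _).
by apply: eq_Rintegral => z _; rewrite e.
Qed.

Hypothesis hmax : forall t, 0 <= t <= T -> {ae P, forall w,
    is_maximum
      (hamiltonian_values U b sigma f y m w t (xstar t w) (p t w) (q t w))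
      (hamiltonian b sigma f y m w t (xstar t w) (ustar t w) (p t w) (q t w))}.
Hypothesis hHhat : forall t, 0 <= t <= T -> {ae P, forall w,
    (forall x, is_maximum
       (hamiltonian_values U b sigma f y m w t x (p t w) (q t w))
       (max_hamiltonian U b sigma f y m p q w t x)) /\
    concave_function (max_hamiltonian U b sigma f y m p q w t)}.
Hypothesis hgconc : {ae P, forall w, concave_function (fun x => g w x y)}.

Let hamiltonian_derive w (t u' x' p' q' : R) : 0 <= t <= T -> U u' ->
  is_derive x' 1 (fun x => hamiltonian b sigma f y m w t x u' p' q')
    (coef_dx b w t x' u' y * p' + coef_dx sigma w t x' u' y * q' +
     coef_dx f w t x' u' y * m t w).
Proof.
move=> tT Uu; have [db _ _ _] := reg_b hA; have [ds _ _ _] := reg_sigma hA.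
have [df _ _ _] := reg_f hA.
have D c : derivable (fun x => c w t x u' y) x' 1 ->
    is_derive x' (1 : R) (fun x => c w t x u' y) (coef_dx c w t x' u' y).
  by move=> dc; rewrite /coef_dx derive1E; exact: DeriveDef.
have Db := is_deriveZ p' (D b (db w t x' u' y tT Uu).1).
have Ds := is_deriveZ q' (D sigma (ds w t x' u' y tT Uu).1).
have Df := is_deriveZ (m t w) (D f (df w t x' u' y tT Uu).1).
have h := is_deriveD (is_deriveD Db Ds) Df.
set F := (X in is_derive _ _ X _) in h.
have -> : (fun x => hamiltonian b sigma f y m w t x u' p' q') = F.
  apply/funext => x; transitivity
    (p' * b w t x u' y + q' * sigma w t x u' y + m t w * f w t x u' y) => //.
  by rewrite /hamiltonian; ring.
apply: (is_derive_eq h); transitivity (p' * coef_dx b w t x' u' y +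
  q' * coef_dx sigma w t x' u' y + m t w * coef_dx f w t x' u' y) => //.
by ring.
Qed.

(** The tangent of the Hamiltonian at [xstar t] with control [ustar t] has slope
    [delta t] and lies above the maximized Hamiltonian, hence above the
    Hamiltonian at any other state and control. *)
Let hamiltonian_le u x t : admissible P B T U u -> 0 <= t <= T -> {ae P, forall w,
  f w t (x t w) (u t w) y * m t w <= f w t (xstar t w) (ustar t w) y * m t w +
    (p t w * (b w t (xstar t w) (ustar t w) y - b w t (x t w) (u t w) y) +
     q t w * (sigma w t (xstar t w) (ustar t w) y - sigma w t (x t w) (u t w) y) +
     (x t w - xstar t w) * delta t w)}.
Proof.
move=> [uU _ _] tT; have [usU _ _] := hustar.
apply: filterS2 (hmax tT) (hHhat tT) => w [_ ub1] [maxH cH].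
pose h x' := hamiltonian b sigma f y m w t x' (ustar t w) (p t w) (q t w).
have hle x' : h x' <= max_hamiltonian U b sigma f y m p q w t x'.
  by apply: (maxH x').2; exists (ustar t w) => //; exact: usU.
have heq : h (xstar t w) = max_hamiltonian U b sigma f y m p q w t (xstar t w).
  by apply/eqP; rewrite eq_le hle /=; apply: ub1; exact: (maxH (xstar t w)).1.
have D := hamiltonian_derive w (xstar t w) (p t w) (q t w) tT (usU t w tT).
have dh : derivable h (xstar t w) 1 by case: D.
have dE : derive1 h (xstar t w) = delta t w by rewrite derive1E; case: D.
have le1 := concave_le_tangent cH hle heq dh (x t w); rewrite dE in le1.
have le2 : hamiltonian b sigma f y m w t (x t w) (u t w) (p t w) (q t w) <=
    max_hamiltonian U b sigma f y m p q w t (x t w).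
  by apply: (maxH (x t w)).2; exists (u t w) => //; exact: uU.
have := le_trans le2 le1; rewrite /h /hamiltonian; lra.
Qed.

(** The slope of g at the optimal terminal state, weighted by the density, is the
    terminal value of [p]. *)
Let gain_le x : {ae P, forall w,
  g w (x T w) y * m T w <= g w (xstar T w) y * m T w + p T w * (x T w - xstar T w)}.
Proof.
apply: filterS2 hgconc pT_eq => w gc ->.
have [dg _ _ _] := reg_g hA w y.
have := concave_le_tangent gc (fun x => lexx _) erefl (dg (xstar T w)).1 (x T w).
rewrite -/(gain_dx g w (xstar T w) y) => le1.
rewrite mulrAC -mulrDl ler_wpM2r//.
exact/ltW/m_gt0.
Qed.

Local Notation running x u := (fun t w => f w t (x t w) (u t w) y * m t w).

Let measurable_running u x : admissible P B T U u -> progressive P B T x ->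
  measurable_fun setT (cut (running x u)).
Proof.
move=> hu px; have [_ cf _ _] := reg_f hA.
rewrite (funext (cutoffM T (along f x u) m)).
by apply: measurable_funM => //; exact: coef_measurable.
Qed.

Let integral_running x u w :
  (\int[mu]_(t in `[0%R, T]) (f w t (x t w) (u t w) y * m t w)%:E =
   \int[mu]_t (cut (running x u) (t, w))%:E)%E.
Proof.
rewrite integral_mkcond; apply: eq_integral => t _.
by rewrite cutoffE /patch mem_itv_cc; case: ifP.
Qed.

Let measurable_gain x : measurable_fun setT (x T) ->
  measurable_fun setT (fun w => g w (x T w) y * m T w).
Proof.
move=> mx; apply: measurable_funM; last first.
  by apply: (filtration_measurable_fun hP hB (t := T)); exact: am.
apply: (measurable_fun_caratheodory (I := setT) (a := 0) (c := fun w x => g w x y)) => //.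
- by move=> v _; apply: (filtration_measurable_fun hP hB (t := T)); exact: hg.
- move=> w s _ _ sx; have [_ cg _ _] := reg_g hA w y.
  by apply: (@continuous_cvg _ _ _ _ _ _ (fun x => g w x y)); first exact: cg.
Qed.

(** The corrections to the running and terminal gains have opposite expectations
    by [state_duality], used for both controls. *)
Let performance_le u x : admissible P B T U u -> state_equation P B T x0 b sigma y u x ->
  (performance P T f g y m u x <= performance P T f g y m ustar xstar)%E.
Proof.
move=> hu hx; have [px cx_sq xT_sq [cb_sq _]] := state_sq hu hx.
have [cs_sq dual] := state_duality hu hx.
have [_ _ xsT_sq [cbs_sq _]] := state_sq hustar hxstar.
have [css_sq dual_star] := state_duality hustar hxstar.
have [delta_sq _] := driver_sq.
have cq_sq : sq_integrable (mu \x P)%E (cut q).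
  by have [_ _ _ [M itoM _]] := hpq; exact: (ito_integrand_sq_integrable hP hB Tge0 itoM).
have one2 : sq_integrable mu (\1_`[0, T] : R -> R) by exact: sq_integrable_indic_itv.
have base_sq := sq_integrable_prod one2 (sq_integrable_cst P x0).
(* x - xstar is written as (x - x0) - (xstar - x0), the form in which duality
   applies to each state *)
pose D1 z := cut p z * cut (along b xstar ustar) z - cut p z * cut (along b x u) z.
pose D2 z := cut (along sigma xstar ustar) z * cut q z - cut (along sigma x u) z * cut q z.
pose D3 z := (cut x z - \1_`[0, T] z.1 * x0) * cut delta z
  - (cut xstar z - \1_`[0, T] z.1 * x0) * cut delta z.
pose D z := D1 z + D2 z + D3 z.
have ib := sq_integrable_mul cp_sq cb_sq; have ibs := sq_integrable_mul cp_sq cbs_sq.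
have isg := sq_integrable_mul cs_sq cq_sq; have isgs := sq_integrable_mul css_sq cq_sq.
have ix := sq_integrable_mul (sq_integrableB cx_sq base_sq) delta_sq.
have ixs := sq_integrable_mul (sq_integrableB cxstar_sq base_sq) delta_sq.
have iD1 := integrableB_EFin ibs ib; have iD2 := integrableB_EFin isgs isg.
have iD3 := integrableB_EFin ix ixs; have iD12 := integrableD_EFin iD1 iD2.
have iD : (mu \x P)%E.-integrable setT (EFin \o D) by exact: integrableD_EFin.
have mD : measurable_fun setT D by apply/measurable_EFinP; exact: measurable_int iD.
have mF := measurable_running hu px; have mFs := measurable_running hustar px_star.
have leF t : {ae P, forall w,
    cut (running x u) (t, w) <= cut (running xstar ustar) (t, w) + D (t, w)}.
  have [tT|tT] := boolP (0 <= t <= T); last first.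
    by apply: aeW => w; rewrite /D /D1 /D2 /D3 !cutoff_out// !(mul0r, mulr0) !subrr !addr0.
  apply: filterS (hamiltonian_le x hu tT) => w le.
  rewrite /D /D1 /D2 /D3 !cutoff_in//=; apply: le_trans le _.
  by rewrite le_eqVlt; apply/orP; left; apply/eqP; ring.
(* the performance integrates in time on each path, so the exceptional events must
   not depend on time *)
have path := ae_swap_le mu mF (measurable_funD mFs mD) leF.
pose Dw w := (\int[mu]_t D (t, w))%R.
have [iDw eDw] := Rintegral21 iD.
have inner : {ae P, forall w,
   (\int[mu]_t (cut (running x u) (t, w))%:E <=
    \int[mu]_t (cut (running xstar ustar) (t, w))%:E + (Dw w)%:E)%E}.
  apply: filterS2 path (ae_integrable2 iD) => w le iw.
  rewrite /Dw /Rintegral fineK; last exact: integrable_fin_num.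
  apply: le_integral_add_integrable => //.
  - by apply/measurable_EFinP; exact: (measurableT_comp mF (pair2_measurable w)).
  - by apply/measurable_EFinP; exact: (measurableT_comp mFs (pair2_measurable w)).
  - by apply: filterS le => t le _; rewrite -EFinD lee_fin.
pose K w := Dw w + p T w * (x T w - xstar T w).
have hdx := sq_integrableB xT_sq xsT_sq.
have iK : P.-integrable setT (EFin \o K).
  by apply: integrableD_EFin iDw _; exact: sq_integrable_mul.
have K0 : (\int[P]_w K w)%R = 0.
  rewrite RintegralD//; last exact: sq_integrable_mul.
  have -> : (\int[P]_w (p T w * (x T w - xstar T w)))%R =
      (\int[P]_w (p T w * (x T w - x0)))%R - (\int[P]_w (p T w * (xstar T w - x0)))%R.
    rewrite -RintegralB//.
    - by apply: eq_Rintegral => w _; ring.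
    - by apply: sq_integrable_mul => //; apply: sq_integrableB => //; exact: sq_integrable_cst.
    - by apply: sq_integrable_mul => //; apply: sq_integrableB => //; exact: sq_integrable_cst.
  rewrite dual dual_star /Dw -eDw RintegralD// RintegralD//.
  rewrite /D1 RintegralB// /D2 RintegralB// /D3 RintegralB//.
  by ring.
have mI v z : measurable_fun setT (cut (running z v)) ->
    measurable_fun setT (fun w => \int[mu]_t (cut (running z v) (t, w))%:E)%E.
  by move=> mz; exact: measurable_integral1.
rewrite /performance; under eq_integral do rewrite integral_running.
under [in leRHS]eq_integral do rewrite integral_running.
have := @le_integral_add_integrable _ _ _ P setT
  (fun w => \int[mu]_t (cut (running x u) (t, w))%:E + (g w (x T w) y * m T w)%:E)%E
  (fun w => \int[mu]_t (cut (running xstar ustar) (t, w))%:E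
     + (g w (xstar T w) y * m T w)%:E)%E K measurableT _ _ iK _.
rewrite (_ : (\int[P]_w (K w)%:E)%E = 0%E) ?adde0; last first.
  by rewrite -[RHS](congr1 EFin K0) /Rintegral fineK//; exact: integrable_fin_num.
apply.
- apply: emeasurable_funD; first exact: mI.
  by apply/measurable_EFinP; apply: measurable_gain; case: xT_sq.
- apply: emeasurable_funD; first exact: mI.
  by apply/measurable_EFinP; apply: measurable_gain; case: xsT_sq.
- apply: filterS2 inner (gain_le x) => w le1 le2 _.
  rewrite /K EFinD addeACA; exact: leeD.
Qed.

Theorem performance_sup :
  performance P T f g y m ustar xstar =
  ereal_sup [set j | exists u x : R -> Omega -> R,
    [/\ admissible P B T U u, state_equation P B T x0 b sigma y u x &
        j = performance P T f g y m u x]].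
Proof.
apply/eqP; rewrite eq_le; apply/andP; split.
  by apply: ereal_sup_ubound; exists ustar, xstar.
by apply: ge_ereal_sup => _ [u [x [hu hx ->]]]; exact: performance_le.
Qed.

End verification.

Unset Implicit Arguments.

Theorem proposition3p2 (d : measure_display) (Omega : measurableType d)
  (R : realType) (P : probability Omega R) (B : R -> Omega -> R)
  (T T0 x0 L y : R) (U : set R) (phi : R -> R) (Yt : R -> Omega -> R)
  (b sigma f : Omega -> R -> R -> R -> R -> R) (g : Omega -> R -> R -> R)
  (ustar xstar p q : R -> Omega -> R)
  (m := donsker_density T0 phi Yt y)
  (hP : measure_is_complete P)
  (hB : brownian_motion P B)
  (hT : 0 < T) (hT0 : T < T0)
  (hU0 : U !=set0) (hU : convex_set (U : set (convex_lmodType R^o)))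
  (hphi : measurable_fun `[0, T0] phi)
  (hphi2 : (\int[lebesgue_measure]_(s in `[0%R, T0]) (phi s ^+ 2)%:E < +oo)%E)
  (hphi_pos : forall t, 0 <= t <= T -> 0 < tail_sqnorm T0 phi t)
  (hYt : ito_integral P B T0 (fun s _ => phi s) Yt)
  (hb : coef_adapted P B T U b)
  (hsigma : coef_adapted P B T U sigma)
  (hf : coef_adapted P B T U f)
  (hg : gain_measurable P B T g)
  (hL : 0 < L)
  (hA : regular_coefficients T U b sigma f g L)
  (hustar : admissible P B T U ustar)
  (hxstar : state_equation P B T x0 b sigma y ustar xstar)
  (hpq : adjoint_equation P B T b sigma f g y m ustar xstar p q)
  (hmax : forall t, 0 <= t <= T -> {ae P, forall w,
    is_maximum
      (hamiltonian_values U b sigma f y m w t (xstar t w) (p t w) (q t w))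
      (hamiltonian b sigma f y m w t (xstar t w) (ustar t w) (p t w) (q t w))})
  (hHhat : forall t, 0 <= t <= T -> {ae P, forall w,
    (forall x, is_maximum
       (hamiltonian_values U b sigma f y m w t x (p t w) (q t w))
       (max_hamiltonian U b sigma f y m p q w t x)) /\
    concave_function (max_hamiltonian U b sigma f y m p q w t)})
  (hgconc : {ae P, forall w, concave_function (fun x => g w x y)}) :
  performance P T f g y m ustar xstar =
  ereal_sup [set j | exists u x : R -> Omega -> R,
    [/\ admissible P B T U u, state_equation P B T x0 b sigma y u x &
        j = performance P T f g y m u x]].
Proof.
exact: (performance_sup hP hB hT hT0 hU0 hU hphi hphi2 hphi_pos hYt
  hb hsigma hf hg hL hA hustar hxstar hpq hmax hHhat hgconc).
Qed.
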